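(* Let $\mathcal X$ be a Polish space with metric $d$ bounded by $1$, and let $\mathcal Q,\bar{\mathcal Q}\colon\mathcal X\to\mathcal M_+(\mathcal X)$ be measurable. Let $A\subset\mathcal X$, $\varepsilon\in(0,1]$ and $K\ge1$ be such that $$\sup_{x\in\mathcal X}\mathcal Q(x,\mathcal X)\le K,\quad\|\mathcal Q(x)-\mathcal Q(y)\|_1\le Kd(x,y)\ (x,y\in\mathcal X),$$ $$\sup_{x\in A}\bar{\mathcal Q}(x,\mathcal X\setminus A)\le\varepsilon,\quad\sup_{x\in A}\|\mathcal Q(x)-\bar{\mathcal Q}(x)\|_1\le\varepsilon.$$ Fix $n>0$, $\bar x\in A$ and $x\in\mathcal X$, and let $\mu^{[n]}_x$ and $\bar\mu^{[n]}_{\bar x}$ be the recursive Poisson point processes of depth $n$ with kernels $\mathcal Q$ and $\bar{\mathcal Q}$ started at $x$ and $\bar x$ respectively. Then there exists a coupling between $\mu^{[n]}_x$ and $\bar\mu^{[n]}_{\bar x}$ such that $$\mathbf E\bigl(1\wedge\|\mu^{[n]}_x-\bar\mu^{[n]}_{\bar x}\|_1\bigr)\le C\bigl(\sqrt\varepsilon+d(x,\bar x)\bigr),$$ where $C$ depends only on $K$ and $n$.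
   Context: $\mathcal M_+(\mathcal X)$ is the space of finite positive measures on $\mathcal X$. For finite positive measures, $\|\mu-\pi\|_1=\sup\{\int fd\mu-\int fd\pi: \mathrm{Lip}(f)\le1,\ \sup|f|\le1\}$. Recursive Poisson point process of depth $n$ with kernel $\mathcal Q$ started at $x$: $\mu^0_x=\delta_x$; for $\ell\ge1$, conditionally on $\mu^0_x,\dots,\mu^{\ell-1}_x$, $\mu^\ell_x$ is a Poisson point process on $\mathcal X$ with intensity $\int\mathcal Q(y,\cdot)\,\mu^{\ell-1}_x(dy)$; $\mu^{[n]}_x=\sum_{\ell=0}^n\mu^\ell_x$. *)

(* Defs.v *)
From HB Require Import structures.
From mathcomp Require Import all_boot all_order all_algebra.
From mathcomp Require Import all_classical all_reals all_analysis.
From mathcomp Require Import measurable_realfun.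
Set Implicit Arguments. Unset Strict Implicit. Unset Printing Implicit Defensive.
Import Order.TTheory GRing.Theory Num.Theory.
Import numFieldNormedType.Exports.
Local Open Scope classical_set_scope.
Local Open Scope ring_scope.

Section Defs.
Context {R : realType}.

Section Metric.
Context {T : Type} (dist : T -> T -> R).

Definition is_metric : Prop :=
  [/\ (forall x y, 0 <= dist x y),
      (forall x y, dist x y = 0 <-> x = y),
      (forall x y, dist x y = dist y x) &
      (forall x y z, dist x z <= dist x y + dist y z)].

Definition dist_cauchy (u : nat -> T) : Prop :=
  forall e, 0 < e -> exists N, forall m k, (N <= m)%N -> (N <= k)%N -> dist (u m) (u k) < e.

Definition dist_converges (u : nat -> T) (l : T) : Prop :=
  forall e, 0 < e -> exists N, forall m, (N <= m)%N -> dist (u m) l < e.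

Definition dist_complete : Prop :=
  forall u, dist_cauchy u -> exists l, dist_converges u l.

Definition dist_separable : Prop :=
  exists u : nat -> T, forall x e, 0 < e -> exists k, dist x (u k) < e.

Definition polish_metric : Prop := [/\ is_metric, dist_complete & dist_separable].

Definition dist_open (U : set T) : Prop :=
  forall x, U x -> exists2 r, 0 < r & [set y | dist x y < r] `<=` U.

End Metric.

Definition borel_for {dX} (X : measurableType dX) (dist : X -> X -> R) : Prop :=
  (@measurable _ X) = <<s [set U | dist_open dist U] >>.

Section BL.
Context {dX} {X : measurableType dX} (dist : X -> X -> R).

Definition lip1_bdd1 (f : X -> R) : Prop :=
  (forall x y, `|f x - f y| <= dist x y) /\ (forall x, `|f x| <= 1).

Definition BLnorm (mu pi : set X -> \bar R) : \bar R :=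
  ereal_sup ((fun f => (\int[mu]_y (f y)%:E - \int[pi]_y (f y)%:E)%E)
               @` [set f | lip1_bdd1 f]).
End BL.

(* Poisson probability mass function (Poisson(0) = delta_0) *)
Definition pois (lam : R) (k : nat) : R :=
  lam ^+ k / k`!%:R * expR (- lam).

Section RPPP.
Context {dX} {X : measurableType dX} {dO} {Omega : measurableType dO}.

Definition intensity (Q : R.-ker X ~> X) (m : set X -> \bar R) (B : set X) : \bar R :=
  (\int[m]_y Q y B)%E.

Definition gen_sigma (mu : nat -> Omega -> {measure set X -> \bar R}) (l : nat) :
  set (set Omega) :=
  <<s [set S | exists j B (Y : set \bar R), [/\ (j < l)%N, measurable B, measurable Y &
           S = (fun w => mu j w B) @^-1` Y]] >>.

(* mu^0, ..., mu^n (random measures on the probability space (Omega, P)) form a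
   recursive Poisson point process of depth n with kernel Q started at x:
   mu^0 = delta_x, each mu^l is a random finite counting measure, and
   conditionally on mu^0,...,mu^(l-1), mu^l is a Poisson point process with
   intensity int Q(y,.) mu^(l-1)(dy), i.e. for every event E of
   sigma(mu^0,...,mu^(l-1)) and pairwise disjoint measurable B_1..B_k:
   P(E /\ mu^l(B_i) = m_i for all i) = E[1_E prod_i Pois(Lambda(B_i))(m_i)]. *)
Definition recursive_PPP (P : probability Omega R) (Q : R.-ker X ~> X) (x : X) (n : nat)
    (mu : nat -> Omega -> {measure set X -> \bar R}) : Prop :=
  [/\ (forall w A, mu 0%N w A = \d_x A),
      (forall l w, (l <= n)%N -> exists s : seq X,
          forall A, measurable A -> mu l w A = (\sum_(y <- s) \d_y A)%E),
      (forall l B, (l <= n)%N -> measurable B -> measurable_fun setT (fun w => mu l w B)) &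
      (forall l, (0 < l <= n)%N ->
        forall (k : nat) (B : 'I_k -> set X) (m : 'I_k -> nat) (E : set Omega),
          (forall i, measurable (B i)) ->
          (forall i j, i != j -> B i `&` B j = set0) ->
          gen_sigma mu l E ->
          P (E `&` \bigcap_(i in [set: 'I_k]) [set w | mu l w (B i) = (m i)%:R%:E]) =
          (\int[P]_(w in E)
             (\prod_(i < k) pois (fine (intensity Q (mu l.-1 w) (B i))) (m i))%:E)%E)].

Definition rppp_total (mu : nat -> Omega -> {measure set X -> \bar R}) (n : nat)
    (w : Omega) : set X -> \bar R :=
  fun A => (\sum_(l < n.+1) mu l w A)%E.

End RPPP.
End Defs.

(* Main.v *)
Require Import Defs.
From HB Require Import structures.
From mathcomp Require Import all_boot all_order all_algebra.
From mathcomp Require Import all_classical all_reals all_analysis.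
From mathcomp Require Import measurable_realfun finmap ring lra.
Set Implicit Arguments. Unset Strict Implicit. Unset Printing Implicit Defensive.
Import Order.TTheory GRing.Theory Num.Theory.
Import numFieldNormedType.Exports.
Local Open Scope classical_set_scope.
Local Open Scope ring_scope.

(** A pair of recursive Poisson processes is the pair of projections of a single
    recursive Poisson process on particles carrying a position in one or in both
    of the processes. A particle sitting at (y, y') in both processes reproduces
    by a transport plan between Q(y) and Qbar(y'): the transported mass gives
    common particles, the untransported mass gives particles of one process only.
    Kantorovich duality bounds the cost of an optimal plan by
    ||Q(y) - Qbar(y')||_1 <= K d(y, y') + eps as long as y' stays in A. To choose
    the plan measurably in (y, y'), X is cut into countably many small cells, and
    the plan is the first one in an enumeration of the finitely supported rational
    matrices on the cells that is almost optimal.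

    The function V equal to the distance of the two positions (1 for a particle of
    one process only), plus 1 if the second position has left A, plus eps for each
    position, then satisfies E[sum of V over the offspring of z] <= 7 K V(z) as long
    as z has not left A. Hence the expected sum of V over generation l, before a
    particle has left A, is at most (7 K)^l (d(x, xbar) + 2 eps). The sum of V over
    all generations bounds the distance of the two processes if no particle has left
    A, and is at least 1 otherwise. *)


Local Open Scope ereal_scope.

(** * Integral functionals and kernel operators *)

(** Outside [A] nothing is known about [Qbar] beyond the finiteness of each [Qbar y], so
    expectations cannot be propagated past an escape. The truncation by 1 pays for that event, which
    is why the escape indicator is part of V. The term eps for each position makes the estimate
    multiplicative: a particle at (y, y) has distance 0, but its offspring may have expected cost of
    order eps, and V must dominate it. The argument is linear in eps; the square root enters only
    through eps <= sqrt eps, valid for eps <= 1. Measures are handled as integration functionals.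
    [Qbar] has no uniform mass bound, and the coupled process needs sums, densities, compositions
    and products of kernels: for functionals these are plain formulas, and a measure is built from
    one only when the probability space is constructed. A transport plan is kept as a density with
    respect to the product of Q(y) and Qbar(y'), so that the mass it leaves over has a density too.
    The conditional laws of both projections are computed given the joint past, which contains the
    past of each of them. *)

Definition nnmeas {R : realType} {d} {Y : measurableType d} (f : Y -> \bar R) :=
  measurable_fun setT f /\ forall y, 0 <= f y.

(** Countable additivity stands in for monotone convergence. Positivity is asked of all nonnegative
    functions, so that sign arguments need no measurability. *)
Record integral_functional {R : realType} {d} {Y : measurableType d}
    (L : (Y -> \bar R) -> \bar R) : Prop := IntegralFunctional {
  ifun_ge0 : forall f, (forall y, 0 <= f y) -> 0 <= L f ;
  ifunD : forall f g, nnmeas f -> nnmeas g ->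
    L (fun y => f y + g y) = L f + L g ;
  ifunZ : forall (r : R) f, (0 <= r)%R -> nnmeas f ->
    L (fun y => r%:E * f y) = r%:E * L f ;
  ifun_nneseries : forall f : nat -> Y -> \bar R, (forall k, nnmeas (f k)) ->
    L (fun y => \sum_(k <oo) f k y) = \sum_(k <oo) L (f k) }.

(* The integral operators of transition kernels; measurability is required
   with an extra parameter so that operators can be composed. *)
Record kernel_operator {R : realType} {d d'} {X : measurableType d}
    {Y : measurableType d'} (L : X -> (Y -> \bar R) -> \bar R) : Prop :=
  KernelOperator {
  kop_functional : forall x, integral_functional (L x) ;
  kop_measurable : forall dP (P : measurableType dP) (f : P * Y -> \bar R),
    nnmeas f ->
    measurable_fun setT (fun px : P * X => L px.2 (fun y => f (px.1, y))) }.

Section nnmeas_theory.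
Context {R : realType} {d} {Y : measurableType d}.
Implicit Types f g : Y -> \bar R.

Lemma nnmeasD f g : nnmeas f -> nnmeas g -> nnmeas (fun y => f y + g y).
Proof.
move=> [mf f0] [mg g0]; split; first exact: emeasurable_funD.
by move=> y; exact: adde_ge0.
Qed.

Lemma nnmeasM f g : nnmeas f -> nnmeas g -> nnmeas (fun y => f y * g y).
Proof.
move=> [mf f0] [mg g0]; split; first exact: emeasurable_funM.
by move=> y; exact: mule_ge0.
Qed.

Lemma nnmeas_cst (r : \bar R) : 0 <= r -> nnmeas (fun _ : Y => r).
Proof. by move=> r0; split. Qed.

Lemma nnmeasZ (r : R) f : (0 <= r)%R -> nnmeas f -> nnmeas (fun y => r%:E * f y).
Proof. by move=> r0; apply: nnmeasM; apply: nnmeas_cst; rewrite lee_fin. Qed.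

Lemma nnmeas_sum I (s : seq I) (f : I -> Y -> \bar R) : (forall k, nnmeas (f k)) ->
  nnmeas (fun y => \sum_(k <- s) f k y).
Proof.
move=> hf; split; first by apply: emeasurable_sum => k; exact: (hf k).1.
by move=> y; apply: sume_ge0 => k _; exact: (hf k).2.
Qed.

Lemma nnmeas_indic (A : set Y) : measurable A -> nnmeas (fun y => (\1_A y : R)%:E).
Proof.
move=> mA; split; first by apply/measurable_EFinP; exact: measurable_indic.
by move=> y; rewrite lee_fin.
Qed.

Lemma nnmeas_EFin (h : Y -> R) : measurable_fun setT h ->
  (forall y, (0 <= h y)%R) -> nnmeas (fun y => (h y)%:E).
Proof. by move=> mh h0; split; [exact/measurable_EFinP|]. Qed.

Lemma nnmeas_comp d' (X : measurableType d') (g : X -> Y) f :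
  measurable_fun setT g -> nnmeas f -> nnmeas (fun x => f (g x)).
Proof. by move=> mg [mf f0]; split=> //; exact: measurableT_comp. Qed.

End nnmeas_theory.

Section functional_theory.
Context {R : realType} {d} {Y : measurableType d}.
Variable (L : (Y -> \bar R) -> \bar R).
Hypothesis hL : integral_functional L.

Lemma ifun0 : L (fun=> 0) = 0.
Proof.
have := ifunZ hL (lexx 0%R) (nnmeas_cst (lexx (0 : \bar R))).
by rewrite !mul0e.
Qed.

Lemma ifun_sum I (s : seq I) (f : I -> Y -> \bar R) : (forall k, nnmeas (f k)) ->
  L (fun y => \sum_(k <- s) f k y) = \sum_(k <- s) L (f k).
Proof.
move=> hf; elim: s => [|i s ih].
  by under eq_fun do rewrite big_nil; rewrite big_nil ifun0.
under eq_fun do rewrite big_cons.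
by rewrite big_cons ifunD// ?ih//; exact: nnmeas_sum.
Qed.

Definition functional_measure of integral_functional L :=
  fun A : set Y => L (fun y => (\1_A y)%:E).

Local Notation mu := (functional_measure hL).

Let mu0 : mu set0 = 0.
Proof.
by rewrite /functional_measure -[RHS]ifun0; congr L; apply/funext => y; rewrite indic0.
Qed.

Let mu_ge0 A : 0 <= mu A.
Proof. by apply: (ifun_ge0 hL) => y; rewrite lee_fin. Qed.

Let mu_sigma_additive : semi_sigma_additive mu.
Proof.
move=> F mF tF mUF.
rewrite [X in _ --> X](_ : _ = \sum_(n <oo) mu (F n)).
  by apply: is_cvg_nneseries => n _ _; exact: mu_ge0.
rewrite /functional_measure -(ifun_nneseries hL); last first.
  by move=> k; exact: nnmeas_indic.
congr L; apply/funext => y.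
by rewrite indic_bigcup.
Qed.

HB.instance Definition _ := isMeasure.Build _ _ _ mu mu0 mu_ge0 mu_sigma_additive.

Import HBNNSimple.

Let integral_nnsfun_functional (h : {nnsfun Y >-> R}) :
  \int[mu]_y (h y)%:E = L (fun y => (h y)%:E).
Proof.
pose s := fset_set (h @` setT).
pose f (i : 'I_#|`s|) y : \bar R := (s`_i)%:E * (\1_(h @^-1` [set s`_i]) y)%:E.
have s_ge0 (i : 'I_#|`s|) : (0 <= s`_i)%R.
  have : s`_i \in s by rewrite mem_nth.
  by rewrite in_fset_set// => /set_mem[y _ <-].
have mh i : measurable (h @^-1` [set s`_i]) by exact: measurable_sfunP.
have hf i : nnmeas (f i) by apply: nnmeasZ => //; exact: nnmeas_indic.
have hE y : (h y)%:E = \sum_(i < #|`s|) f i y.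
  by rewrite fimfunEord -sumEFin; apply: eq_bigr => i _; rewrite EFinM.
under eq_integral do rewrite hE.
under [in RHS]eq_fun do rewrite hE.
rewrite ge0_integral_sum//; last 2 first.
- by move=> i; exact: (hf i).1.
- by move=> i y _; exact: (hf i).2.
rewrite ifun_sum//; apply: eq_bigr => i _.
rewrite ge0_integralZl//; last 2 first.
- by apply/measurable_EFinP; exact: measurable_indic.
- by rewrite lee_fin.
by rewrite integral_indic// setIT ifunZ//; exact: nnmeas_indic.
Qed.

(** Both sides agree on simple functions. A general [f] is the series of the increments of an
    increasing simple approximation, since the axioms speak of series and not of monotone limits. *)
Lemma integral_functional_measure f : nnmeas f -> \int[mu]_y f y = L f.
Proof.
move=> [mf f0]; pose f_ := nnsfun_approx measurableT mf.
have nd_f y : nondecreasing_seq (fun n => f_ n y).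
  by move=> m n mn; exact/lefP/nd_nnsfun_approx.
pose g n y : \bar R := (f_ n y - (if n is m.+1 then f_ m y else 0))%R%:E.
have hg n : nnmeas (g n).
  apply: nnmeas_EFin => [|y].
    by apply: measurable_funB => //; case: n.
  by case: n => [|n]; rewrite ?subr0// subr_ge0 nd_f.
have sum_g n y : \sum_(k < n.+1) g k y = (f_ n y)%:E.
  elim: n => [|n ih]; first by rewrite big_ord1 /g subr0.
  by rewrite big_ord_recr/= ih /g -EFinD addrCA subrr addr0.
have sum_Lg n : \sum_(k < n.+1) L (g k) = \int[mu]_y (f_ n y)%:E.
  rewrite integral_nnsfun_functional -ifun_sum//; congr L.
  by apply/funext => y; rewrite sum_g.
have fE y : f y = \sum_(k <oo) g k y.
  apply/esym/cvg_lim => //; rewrite -cvg_shiftS/=.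
  under eq_fun do rewrite big_mkord sum_g.
  exact: cvg_nnsfun_approx.
transitivity (\sum_(k <oo) L (g k)); last first.
  by rewrite -(ifun_nneseries hL)//; congr L; exact/funext.
have -> : \int[mu]_y f y = \int[mu]_y limn (fun n => (f_ n y)%:E).
  apply: eq_integral => y _; apply/esym/cvg_lim => //.
  exact: cvg_nnsfun_approx.
apply/esym/cvg_lim => //; rewrite -cvg_shiftS/=.
under eq_fun do rewrite big_mkord sum_Lg.
apply: (@cvg_monotone_convergence _ _ _ mu setT measurableT (fun n y => (f_ n y)%:E)).
- by move=> n; exact/measurable_EFinP.
- by move=> n y _; rewrite lee_fin.
- by move=> y _ m n mn; rewrite lee_fin nd_f.
Qed.

Lemma functional_probability : L (fun=> 1) = 1 ->
  exists P : probability Y R, forall f, nnmeas f -> \int[P]_y f y = L f.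
Proof.
move=> L1.
have muT : mu setT = 1.
  by rewrite -L1 /functional_measure; congr L; apply/funext => y; rewrite indicT.
pose mP := Measure_isProbability.Build _ _ _ mu muT.
pose P : probability Y R := HB.pack mu mP.
by exists P; exact: integral_functional_measure.
Qed.

End functional_theory.

Section kernel_operator_theory.
Context {R : realType} {d d'} {X : measurableType d} {Y : measurableType d'}.
Variable L : X -> (Y -> \bar R) -> \bar R.
Hypothesis hL : kernel_operator L.

Lemma kop_nnmeas_param dP (P : measurableType dP) (f : P * Y -> \bar R) :
  nnmeas f -> nnmeas (fun px : P * X => L px.2 (fun y => f (px.1, y))).
Proof.
move=> hf; split; first exact: (kop_measurable hL).
by move=> px; apply: (ifun_ge0 (kop_functional hL _)) => y; exact: hf.2.
Qed.

Lemma kop_nnmeas (f : Y -> \bar R) : nnmeas f -> nnmeas (fun x => L x f).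
Proof.
move=> hf.
have h := @kop_nnmeas_param _ unit _ (nnmeas_comp measurable_snd hf).
by apply: (nnmeas_comp (g := pair tt) _ h); exact: pair1_measurable.
Qed.

Lemma kop_nnmeas_diag (f : X * Y -> \bar R) :
  nnmeas f -> nnmeas (fun x => L x (fun y => f (x, y))).
Proof.
move=> hf; apply: (nnmeas_comp (g := fun x => (x, x)) _ (kop_nnmeas_param hf)).
exact: measurable_fun_pair.
Qed.

Lemma kop_map d1 (W : measurableType d1) (g : W -> X) : measurable_fun setT g ->
  kernel_operator (fun w => L (g w)).
Proof.
move=> mg; split=> [w|dP P f hf]; first exact: (kop_functional hL).
apply: (measurableT_comp (f := fun px : P * X => L px.2 (fun y => f (px.1, y)))
  (g := fun pw : P * W => (pw.1, g pw.2))).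
  exact: (kop_measurable hL).
by apply: measurable_fun_pair => //; exact: measurableT_comp.
Qed.

Lemma kop_scale (h : X -> R) : measurable_fun setT h -> (forall x, (0 <= h x)%R) ->
  kernel_operator (fun x f => (h x)%:E * L x f).
Proof.
move=> mh h0; split=> [x|dP P f hf].
  have hLx := kop_functional hL x; split.
  - by move=> f f0; rewrite mule_ge0 ?lee_fin//; exact: (ifun_ge0 hLx).
  - by move=> f g hf hg; rewrite (ifunD hLx)// muleDr// ge0_adde_def// inE;
      apply: (ifun_ge0 hLx); [exact: hf.2|exact: hg.2].
  - by move=> r f r0 hf; rewrite (ifunZ hLx)// muleCA.
  - move=> f hf; rewrite (ifun_nneseries hLx)// nneseriesZl// => k _.
    by apply: (ifun_ge0 hLx); exact: (hf k).2.
apply: emeasurable_funM; last exact: (kop_measurable hL).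
by apply/measurable_EFinP; exact: measurableT_comp.
Qed.

End kernel_operator_theory.

Section kernel_operator_constructions.
Context {R : realType} {d d'} {X : measurableType d} {Y : measurableType d'}.
Implicit Type L : X -> (Y -> \bar R) -> \bar R.

Lemma kop_dirac (g : X -> Y) : measurable_fun setT g ->
  kernel_operator (fun x (f : Y -> \bar R) => f (g x)).
Proof.
move=> mg; split=> [x|dP P f [mf _]]; first by split.
apply: (measurableT_comp mf (g := fun px : P * X => (px.1, g px.2))).
by apply: measurable_fun_pair => //; exact: measurableT_comp.
Qed.

Lemma kop_add L1 L2 : kernel_operator L1 -> kernel_operator L2 ->
  kernel_operator (fun x f => L1 x f + L2 x f).
Proof.
move=> h1 h2; split=> [x|dP P f hf].
  have h1x := kop_functional h1 x; have h2x := kop_functional h2 x; split.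
  - by move=> f f0; rewrite adde_ge0//; [exact: (ifun_ge0 h1x)|exact: (ifun_ge0 h2x)].
  - by move=> f g hf hg; rewrite (ifunD h1x)// (ifunD h2x)// addeACA.
  - move=> r f r0 hf; rewrite (ifunZ h1x)// (ifunZ h2x)// muleDr//.
    by rewrite ge0_adde_def// inE; [apply: (ifun_ge0 h1x)|apply: (ifun_ge0 h2x)]; exact: hf.2.
  - move=> f hf; rewrite (ifun_nneseries h1x)// (ifun_nneseries h2x)// -nneseriesD//.
    + by move=> k _ _; apply: (ifun_ge0 h1x); exact: (hf k).2.
    + by move=> k _ _; apply: (ifun_ge0 h2x); exact: (hf k).2.
by apply: emeasurable_funD; [exact: (kop_measurable h1)|exact: (kop_measurable h2)].
Qed.

Lemma kop_series (L : nat -> X -> (Y -> \bar R) -> \bar R) :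
  (forall k, kernel_operator (L k)) ->
  kernel_operator (fun x f => \sum_(k <oo) L k x f).
Proof.
move=> hL; have L0 k x f : (forall y, 0 <= f y) -> 0 <= L k x f.
  exact: (ifun_ge0 (kop_functional (hL k) x)).
split=> [x|dP P f hf].
  have hLx k := kop_functional (hL k) x; split.
  - by move=> f f0; apply: nneseries_ge0 => k _ _; exact: L0.
  - move=> f g hf hg; rewrite -nneseriesD//; last 2 first.
    + by move=> k _ _; apply: L0; exact: hf.2.
    + by move=> k _ _; apply: L0; exact: hg.2.
    by apply: eq_eseriesr => k _; rewrite (ifunD (hLx k)).
  - move=> r f r0 hf; rewrite -nneseriesZl//; last first.
      by move=> k _; apply: L0; exact: hf.2.
    by apply: eq_eseriesr => k _; rewrite (ifunZ (hLx k)).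
  - move=> f hf; rewrite nneseries_interchange; last first.
      by move=> i j; apply: L0; exact: (hf i).2.
    by apply: eq_eseriesr => k _; rewrite (ifun_nneseries (hLx k)).
apply: ge0_emeasurable_sum => [k px _ _|k _]; last exact: (kop_measurable (hL k)).
by apply: L0 => y; exact: hf.2.
Qed.

(** The point x enters twice, as argument of [L] and as parameter of [M]. It is doubled, one copy is
    carried along as a parameter, and the diagonal is taken at the end: this is what the extra
    parameter in [kop_measurable] is for. *)
Lemma kop_comp d1 (W : measurableType d1) L (M : X * Y -> (W -> \bar R) -> \bar R) :
  kernel_operator L -> kernel_operator M ->
  kernel_operator (fun x f => L x (fun y => M (x, y) f)).
Proof.
move=> hL hM.
have hMx x f : nnmeas f -> nnmeas (fun y => M (x, y) f).
  move=> hf; apply: (nnmeas_comp _ (kop_nnmeas hM hf)); exact: pair1_measurable.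
split=> [x|dP P f hf].
  have hLx := kop_functional hL x; have hMxy y := kop_functional hM (x, y); split.
  - by move=> f f0; apply: (ifun_ge0 hLx) => y; exact: (ifun_ge0 (hMxy y)).
  - move=> f g hf hg; rewrite -(ifunD hLx); [congr (L x)|exact: hMx|exact: hMx].
    by apply/funext => y; rewrite (ifunD (hMxy y)).
  - move=> r f r0 hf; rewrite -(ifunZ hLx)//; [congr (L x)|exact: hMx].
    by apply/funext => y; rewrite (ifunZ (hMxy y)).
  - move=> f hf; rewrite -(ifun_nneseries hLx); last by move=> k; exact: hMx.
    by congr (L x); apply/funext => y; rewrite (ifun_nneseries (hMxy y)).
have h1 := kop_nnmeas_param hM hf.
have h2 : nnmeas (fun q : (P * X) * Y => M (q.1.2, q.2) (fun w => f (q.1.1, w))).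
  apply: (nnmeas_comp (g := fun q : (P * X) * Y => (q.1.1, (q.1.2, q.2))) _ h1).
  apply: measurable_fun_pair; first exact: measurableT_comp.
  by apply: measurable_fun_pair => //; exact: measurableT_comp.
have hLs := kop_map hL (@measurable_snd _ _ P X).
exact: (kop_nnmeas_diag hLs h2).1.
Qed.

(** Pulling a kernel back to a product with a parameter space turns a parametrized integrand into a
    function on source times target. *)
Definition kernel_preimage dW (W : measurableType dW) (k : R.-ker X ~> Y)
  (g : W -> X) of measurable_fun setT g : W -> {measure set Y -> \bar R} :=
  fun w => k (g w).

Section kernel_preimage_instance.
Context dW (W : measurableType dW) (k : R.-ker X ~> Y) (g : W -> X).
Hypothesis mg : measurable_fun setT g.

Let measurable_kernel_preimage U : measurable U ->
  measurable_fun setT (kernel_preimage k mg ^~ U).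
Proof. by move=> mU; apply: (measurableT_comp (measurable_kernel k U mU)). Qed.

HB.instance Definition _ := isKernel.Build _ _ _ _ _ (kernel_preimage k mg)
  measurable_kernel_preimage.

End kernel_preimage_instance.

Import HBNNSimple.

(** Measurability of the measures of sections only asks for a bound on [k w] that may depend on [w],
    so finiteness at each point is enough. *)
Lemma measurable_fun_integral_ker dW (W : measurableType dW) (k : R.-ker W ~> Y)
    (f : W * Y -> \bar R) : (forall w, k w setT < +oo) -> nnmeas f ->
  measurable_fun setT (fun w => \int[k w]_y f (w, y)).
Proof.
move=> kfin [mf f0]; pose f_ := nnsfun_approx measurableT mf.
apply: (measurable_fun_xsection_integral f k f_).
- by move=> a b ab; exact/nd_nnsfun_approx.
- by move=> z; exact/cvg_nnsfun_approx.
- move=> n r.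
  rewrite (_ : (fun _ => _) =
    (fun w => mrestr (k w) measurableT (xsection (f_ n @^-1` [set r]) w))); last first.
    by apply/funext => w; rewrite /mrestr setIT.
  have kb w : exists M, forall U, measurable U -> mrestr (k w) measurableT U < M%:E.
    exists (fine (k w setT) + 1)%R => U mU; rewrite EFinD fineK; last first.
      by rewrite ge0_fin_numE.
    rewrite (@le_lt_trans _ _ (k w setT))//.
      by rewrite /mrestr setIT; apply: le_measure => //; exact: mem_set.
    by rewrite lteDl// ge0_fin_numE.
  have mA : measurable (f_ n @^-1` [set r]) by exact: measurable_sfunP.
  by have [] := measurable_prod_subset_xsection_kernel kb mA.
Qed.

Lemma kop_integral (k : R.-ker X ~> Y) : (forall x, k x setT < +oo) ->
  kernel_operator (fun x f => \int[k x]_y f y).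
Proof.
move=> kfin; split=> [x|dP P f hf].
  split.
  - by move=> f f0; exact: integral_ge0.
  - by move=> f g [mf f0] [mg g0]; rewrite ge0_integralD.
  - by move=> r f r0 [mf f0]; rewrite ge0_integralZl// lee_fin.
  - move=> f hf; rewrite integral_nneseries//.
    + by move=> n; exact: (hf n).1.
    + by move=> n y _; exact: (hf n).2.
apply: (measurable_fun_integral_ker (k := kernel_preimage k (@measurable_snd _ _ P X))
  (f := fun q : (P * X) * Y => f (q.1.1, q.2))).
  by move=> px; exact: kfin.
apply: nnmeas_comp hf.
by apply: measurable_fun_pair => //; exact: measurableT_comp.
Qed.

End kernel_operator_constructions.

(** * Finite configurations and Poisson point processes *)

(** Gluing over the countably many values of [g]. It reduces sums over lists of variable length to
    sums with a fixed number of terms, and a selected plan to a fixed one. *)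
Lemma measurable_fun_nat_case d d' (X : measurableType d) (W : measurableType d')
    (g : X -> nat) (f : nat -> X -> W) :
  measurable_fun setT g -> (forall k, measurable_fun setT (f k)) ->
  measurable_fun setT (fun x => f (g x) x).
Proof.
move=> mg mf _ A mA; rewrite setTI.
rewrite (_ : _ @^-1` _ = \bigcup_k (g @^-1` [set k] `&` f k @^-1` A)).
  apply: bigcupT_measurable => k; apply: measurableI.
    by rewrite -[_ @^-1` _]setTI; exact: mg.
  by rewrite -[_ @^-1` _]setTI; exact: mf.
apply/seteqP; split=> [x Ax|x [k _ [/= <-//]]].
by exists (g x).
Qed.

HB.instance Definition _ (T : pointedType) := isPointed.Build (seq T) [::].

(** Length and coordinates generate the sigma-algebra; a coordinate beyond the end reads [point], so
    every coordinate map is total. Points are kept in order and with repetition; counting measures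
    are formed only after projection. *)
Definition seq_generator {d} (Z : measurableType d) : set (set (seq Z)) :=
  [set S | (exists k, S = [set s | size s = k]) \/
    exists i B, measurable B /\ S = [set s | B (nth point s i)]].
Arguments seq_generator {d} Z _.

Notation config Z := (g_sigma_algebraType (seq_generator Z)).

Section config_theory.
Context {d} {Z : measurableType d}.

Lemma measurable_config_size : measurable_fun setT (size : config Z -> nat).
Proof.
move=> _ A _; rewrite setTI.
rewrite (_ : _ @^-1` _ = \bigcup_(k in A) [set s | size s = k]).
  apply: bigcup_measurable => k _; apply: sub_sigma_algebra.
  by left; exists k.
by apply/seteqP; split=> [s As|s [k Ak /= sk]]; [exists (size s)|rewrite /= sk].
Qed.

Lemma measurable_config_nth i :
  measurable_fun setT (fun s : config Z => nth point s i).
Proof.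
move=> _ B mB; rewrite setTI; apply: sub_sigma_algebra.
by right; exists i, B.
Qed.

Lemma measurable_fun_config d' (W : measurableType d') (f : W -> config Z) :
  measurable_fun setT (fun w => size (f w)) ->
  (forall i, measurable_fun setT (fun w => nth point (f w) i)) ->
  measurable_fun setT f.
Proof.
move=> msize mnth; apply: (@measurability _ _ W (config Z) setT f (seq_generator Z)) => //.
move=> _ [_ [[k ->]|[i [B [mB ->]]]] <-].
- exact: (msize measurableT [set k]).
- exact: (mnth i measurableT B).
Qed.

Lemma measurable_config_cons :
  measurable_fun setT (fun zs : Z * config Z => zs.1 :: zs.2 : config Z).
Proof.
apply: measurable_fun_config => [|[|i]] /=.
- have : measurable_fun setT (S : nat -> nat) by [].
  move=> /measurableT_comp; apply.
  by apply: measurableT_comp => //; exact: measurable_config_size.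
- exact: measurable_fst.
- by apply: (measurableT_comp (measurable_config_nth i)).
Qed.

Lemma measurable_config_sum {R : realType} (h : Z -> R) : measurable_fun setT h ->
  measurable_fun setT (fun s : config Z => (\sum_(z <- s) h z)%R).
Proof.
move=> mh.
under eq_fun do rewrite (big_nth point) big_mkord.
apply: (measurable_fun_nat_case
  (f := fun k (s : config Z) => (\sum_(i < k) h (nth point s i))%R)).
  exact: measurable_config_size.
move=> k; apply: measurable_sum => i.
by apply: (measurableT_comp mh); exact: measurable_config_nth.
Qed.

Lemma nnmeas_config_sum {R : realType} (f : Z -> \bar R) : nnmeas f ->
  nnmeas (fun s : config Z => \sum_(z <- s) f z).
Proof.
move=> [mf f0]; split; last by move=> s; exact: sume_ge0.
under eq_fun do rewrite (big_nth point) big_mkord.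
apply: (measurable_fun_nat_case
  (f := fun k (s : config Z) => \sum_(i < k) f (nth point s i))).
  exact: measurable_config_size.
move=> k; apply: emeasurable_sum => i.
by apply: (measurableT_comp mf); exact: measurable_config_nth.
Qed.

Lemma kop_config {R : realType} d' (Y : measurableType d')
    (L : Z -> (Y -> \bar R) -> \bar R) : kernel_operator L ->
  kernel_operator (fun (s : config Z) f => \sum_(z <- s) L z f).
Proof.
move=> hL; split=> [s|dP P f hf].
  have L0 z f : (forall y, 0 <= f y) -> 0 <= L z f.
    exact: (ifun_ge0 (kop_functional hL z)).
  have hLz z := kop_functional hL z; split.
  - by move=> f f0; apply: sume_ge0 => z _; exact: L0.
  - move=> f g hf hg; rewrite -big_split/=; apply: eq_bigr => z _.
    exact: (ifunD (hLz z)).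
  - move=> r f r0 hf; rewrite ge0_sume_distrr; last first.
      by move=> z _; apply: L0; exact: hf.2.
    by apply: eq_bigr => z _; exact: (ifunZ (hLz z)).
  - move=> f hf; rewrite nneseries_sum; last by move=> z k _; apply: L0; exact: (hf k).2.
    by apply: eq_bigr => z _; exact: (ifun_nneseries (hLz z)).
under eq_fun do rewrite (big_nth point) big_mkord.
apply: (measurable_fun_nat_case (g := fun ps : P * config Z => size ps.2)
  (f := fun k (ps : P * config Z) =>
          \sum_(i < k) L (nth point ps.2 i) (fun y => f (ps.1, y)))).
  exact: (measurableT_comp measurable_config_size).
move=> k; apply: emeasurable_sum => i.
apply: (measurableT_comp (kop_nnmeas_param hL hf).1
  (g := fun ps : P * config Z => (ps.1, nth point ps.2 i))).
apply: measurable_fun_pair => //.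
exact: (measurableT_comp (measurable_config_nth i)).
Qed.

End config_theory.

(** The k-fold product measure of [L], as a functional on lists of length k. *)
Fixpoint functional_pow {R : realType} {Z : Type}
    (L : (Z -> \bar R) -> \bar R) (k : nat) (f : seq Z -> \bar R) : \bar R :=
  if k is k'.+1 then L (fun z => functional_pow L k' (fun s => f (z :: s)))
  else f [::].

(* The Poisson point process of intensity L, as a sequence of a Poisson number of
   independent points of law L / L(1). *)
Definition poisson_functional {R : realType} {Z : Type}
    (L : (Z -> \bar R) -> \bar R) (f : seq Z -> \bar R) : \bar R :=
  \sum_(k <oo) (expR (- fine (L (fun=> 1%E))) / k`!%:R)%:E * functional_pow L k f.

Section poisson_operator.
Context {R : realType} {d d'} {W : measurableType d} {Z : measurableType d'}.
Variable L : W -> (Z -> \bar R) -> \bar R.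
Hypothesis hL : kernel_operator L.

Lemma kop_functional_pow k :
  kernel_operator (fun w (f : config Z -> \bar R) => functional_pow (L w) k f).
Proof.
elim: k => [|k ih] /=.
  exact: (kop_dirac (g := fun _ : W => [::] : config Z)).
apply: (kop_comp (M := fun wz (f : config Z -> \bar R) =>
  functional_pow (L wz.1) k (fun s => f (wz.2 :: s))) hL).
apply: (kop_comp (M := fun (q : (W * Z) * config Z) (f : config Z -> \bar R) =>
    f (q.1.2 :: q.2)) (kop_map ih measurable_fst)).
apply: kop_dirac.
apply: (measurableT_comp measurable_config_cons
  (g := fun q : (W * Z) * config Z => (q.1.2, q.2))).
by apply: measurable_fun_pair => //; exact: measurableT_comp.
Qed.

Lemma kop_poisson :
  kernel_operator (fun w (f : config Z -> \bar R) => poisson_functional (L w) f).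
Proof.
apply: kop_series => k; apply: kop_scale; first exact: kop_functional_pow.
  apply: measurable_funM => //; apply: measurableT_comp => //.
  apply: measurable_funN; apply: measurableT_comp; first exact: fine_measurable.
  exact: (kop_nnmeas hL (nnmeas_cst lee01)).1.
by move=> w; rewrite divr_ge0// expR_ge0.
Qed.

End poisson_operator.

Lemma nneseries_expR {R : realType} (x : R) : (0 <= x)%R ->
  \sum_(k <oo) (x ^+ k / k`!%:R)%:E = (expR x)%:E.
Proof.
move=> x0; rewrite expRE -EFin_lim; last first.
  by rewrite /pseries/=; under eq_fun do rewrite mulrC; exact: is_cvg_series_exp_coeff.
apply/congr_lim/funext => n/=; rewrite /pseries/= /series/= -sumEFin//.
by under [RHS]eq_bigr do rewrite mulrC.
Qed.

Lemma nneseriesS {R : realType} (f : nat -> \bar R) : (forall k, 0 <= f k) ->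
  \sum_(k <oo) f k = f 0%N + \sum_(k <oo) f k.+1.
Proof.
move=> f0; rewrite nneseries_recl//; congr (_ + _).
by rewrite -nneseries_addn//; apply: eq_eseriesr => k _; rewrite addn1.
Qed.

Lemma nneseries_shift {R : realType} (f : nat -> \bar R) m :
  (forall k, 0 <= f k) -> (forall k, (k < m)%N -> f k = 0) ->
  \sum_(k <oo) f k = \sum_(k <oo) f (k + m)%N.
Proof.
move=> f0 fm; rewrite (nneseries_split 0 m)// add0n big_mkord big1 ?add0e.
  by rewrite nneseries_addn.
by move=> i _; exact: fm.
Qed.

Section poisson_functional_theory.
Context {R : realType} {d d'} {W : measurableType d} {Z : measurableType d'}.
Variables (L : W -> (Z -> \bar R) -> \bar R) (w : W).
Hypothesis hL : kernel_operator L.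
Hypothesis Lfin : L w (fun=> 1) < +oo.

Let lam := fine (L w (fun=> 1%E)).

Let hLw : integral_functional (L w). Proof. exact: kop_functional. Qed.

Let hpow k : integral_functional (fun f : config Z -> \bar R => functional_pow (L w) k f).
Proof. exact: (kop_functional (kop_functional_pow hL k) w). Qed.

Let lamE : L w (fun=> 1) = lam%:E.
Proof. by rewrite fineK// ge0_fin_numE// (ifun_ge0 hLw). Qed.

Let lam_ge0 : (0 <= lam)%R.
Proof. by rewrite fine_ge0// (ifun_ge0 hLw). Qed.

Let L_cst (c : R) : (0 <= c)%R -> L w (fun=> c%:E) = (c * lam)%:E.
Proof.
move=> c0; rewrite EFinM -lamE -(ifunZ hLw)//.
by congr (L w); apply/funext => z; rewrite mule1.
Qed.

Lemma functional_pow_cst k (c : R) : (0 <= c)%R ->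
  functional_pow (L w) k (fun=> c%:E) = (c * lam ^+ k)%:E.
Proof.
move=> c0; elim: k => [|k ih] /=; first by rewrite expr0 mulr1.
under eq_fun do rewrite ih.
by rewrite L_cst; [rewrite -mulrA -exprSr|rewrite mulr_ge0// exprn_ge0].
Qed.

Let expN (c : R) : (expR (- lam))%:E * ((expR lam)%:E * c%:E) = c%:E.
Proof. by rewrite -!EFinM mulrA expRN mulVf ?mul1r// gt_eqF// expR_gt0. Qed.

Lemma poisson_functional_mass : poisson_functional (L w) (fun=> 1) = 1.
Proof.
rewrite /poisson_functional -/lam.
under eq_eseriesr => k _.
  rewrite functional_pow_cst// mul1r -EFinM -mulrA EFinM; over.
rewrite nneseriesZl//=; last by move=> k _; rewrite lee_fin mulr_ge0// exprn_ge0.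
under eq_eseriesr do rewrite mulrC.
by rewrite nneseries_expR// -[X in _ * X]mule1 expN.
Qed.

(** Each of the k coordinates integrates to L(h) and the k - 1 others to lam each. At k = 0 the
    exponent [k.-1] is harmless because of the factor k. *)
Lemma functional_pow_sum k (h : Z -> R) : measurable_fun setT h ->
  (forall z, (0 <= h z)%R) -> L w (EFin \o h) < +oo ->
  functional_pow (L w) k (fun s => \sum_(z <- s) (h z)%:E) =
  (k%:R * lam ^+ k.-1)%:E * L w (EFin \o h).
Proof.
move=> mh h0 Lhfin.
have nnh : nnmeas (EFin \o h) by exact: nnmeas_EFin.
have Lh0 : 0 <= L w (EFin \o h) by apply: (ifun_ge0 hLw) => z; rewrite lee_fin.
have LhE : L w (EFin \o h) = (fine (L w (EFin \o h)))%:E.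
  by rewrite fineK// ge0_fin_numE.
elim: k => [|k ih] /=; first by rewrite big_nil mul0r mul0e.
transitivity (L w (fun z => (lam ^+ k)%:E * (h z)%:E +
    (k%:R * lam ^+ k.-1 * fine (L w (EFin \o h)))%:E)).
  congr (L w); apply/funext => z; under eq_fun do rewrite big_cons.
  rewrite (ifunD (hpow k)); last 2 first.
    by apply: nnmeas_cst; rewrite lee_fin.
    exact: (nnmeas_config_sum nnh).
  by rewrite functional_pow_cst// ih [in LHS]LhE -EFinM (mulrC (h z)) EFinM.
have c0 : (0 <= k%:R * lam ^+ k.-1 * fine (L w (EFin \o h)))%R.
  by rewrite mulr_ge0// ?fine_ge0// mulr_ge0// exprn_ge0.
have p0 : (0 <= lam ^+ k)%R by rewrite exprn_ge0.
rewrite (ifunD hLw); last 2 first.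
- exact: nnmeasZ.
- by apply: nnmeas_cst; rewrite lee_fin.
rewrite (ifunZ hLw)// L_cst// LhE/= -!EFinM -EFinD; congr (_%:E).
case: k {ih c0 p0} => [|k] /=; first by ring.
by rewrite -[k.+2%:R]natr1 exprS; ring.
Qed.

(** Campbell's formula: the factor k cancels against k! and leaves the exponential series in k -
    1. *)
Lemma poisson_functional_mean (h : Z -> R) : measurable_fun setT h ->
  (forall z, (0 <= h z)%R) -> L w (EFin \o h) < +oo ->
  poisson_functional (L w) (fun s => \sum_(z <- s) (h z)%:E) = L w (EFin \o h).
Proof.
move=> mh h0 Lhfin.
have Lh0 : 0 <= L w (EFin \o h) by apply: (ifun_ge0 hLw) => z; rewrite lee_fin.
have LhE : L w (EFin \o h) = (fine (L w (EFin \o h)))%:E.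
  by rewrite fineK// ge0_fin_numE.
rewrite /poisson_functional -/lam.
under eq_eseriesr do rewrite functional_pow_sum//.
have t0 k : 0 <= (expR (- lam) / k`!%:R)%:E *
    ((k%:R * lam ^+ k.-1)%:E * L w (EFin \o h)).
  rewrite mule_ge0// ?lee_fin ?divr_ge0 ?expR_ge0//.
  by rewrite mule_ge0// lee_fin mulr_ge0// exprn_ge0.
rewrite nneseriesS// mul0r mul0e mule0 add0e.
rewrite LhE; set c := fine _.
have c0 : (0 <= c)%R by rewrite fine_ge0.
have e0 k : 0 <= (lam ^+ k / k`!%:R)%:E by rewrite lee_fin divr_ge0// exprn_ge0.
transitivity (\sum_(k <oo) (expR (- lam) * c)%:E * (lam ^+ k / k`!%:R)%:E).
  apply: eq_eseriesr => k _ /=; rewrite -!EFinM; congr (_%:E).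
  rewrite factS natrM; field.
  by rewrite -mulrS !pnatr_eq0 -lt0n fact_gt0.
rewrite nneseriesZl// nneseries_expR// -[RHS]expN -!EFinM; congr (_%:E).
by ring.
Qed.

Section counts.
Variables (r : nat) (B : 'I_r -> set Z).
Hypothesis mB : forall i, measurable (B i).
Hypothesis tB : forall i j, i != j -> B i `&` B j = set0.

Let Bout : set Z := ~` \bigcup_(i in [set: 'I_r]) B i.

Let mBout : measurable Bout.
Proof. by apply: measurableC; apply: fin_bigcup_measurable. Qed.

Definition has_counts (m : 'I_r -> nat) (s : seq Z) : bool :=
  [forall i, count (fun z => z \in B i) s == m i].

Let lamB i := fine (L w (fun z => (\1_(B i) z)%:E)).
Let lamo := fine (L w (fun z => (\1_Bout z)%:E)).

Let decr (m : 'I_r -> nat) i : 'I_r -> nat := fun j => (m j - (i == j))%N.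

(** Case analysis on the place of the first point: in exactly one [B i], whose required count drops
    by one, or in none. The factor (0 < m i) excludes the truncated subtraction 0 - 1 in [decr]. *)
Let has_counts_cons m z s : ((has_counts m (z :: s))%:R : R)%:E =
  \sum_(i < r) ((0 < m i)%N%:R * \1_(B i) z : R)%:E * (has_counts (decr m i) s)%:R%:E +
  (\1_Bout z)%:E * (has_counts m s)%:R%:E.
Proof.
have [[i zi]|zout] := pselect (exists i, B i z).
  have inB j : (z \in B j) = (j == i).
    apply/idP/eqP => [/set_mem zj|->]; last exact: mem_set.
    by apply/eqP; apply: contraT => /tB/seteqP[+ _] => /(_ z (conj zj zi)).
  rewrite (bigD1 i)//= big1 ?adde0; last first.
    by move=> j ji; rewrite indicE inB (negbTE ji) mulr0 mul0e.
  rewrite (_ : \1_Bout z = 0%R); last first.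
    by rewrite indicE memNset// => nz; apply: nz; exists i.
  rewrite mul0e adde0 indicE inB eqxx mulr1 -EFinM -natrM mulnb.
  congr (_%:R%:E); congr nat_of_bool.
  apply/forallP/andP => [h|[mi /forallP h] j].
    split; first by rewrite -(eqP (h i)) /= inB eqxx.
    apply/forallP => j; rewrite /decr -(eqP (h j))/= inB (eq_sym j i).
    by rewrite addKn.
  rewrite /= inB (eqP (h j)) /decr (eq_sym j i).
  by case: (eqVneq i j) => [<-|_] /=; rewrite ?subn0// subnKC.
have inB j : (z \in B j) = false by apply/negbTE/negP => /set_mem zj; apply: zout; exists j.
rewrite big1 ?add0e; last by move=> j _; rewrite indicE inB mulr0 mul0e.
rewrite indicE mem_set ?mul1e; last by move=> [i _ zi]; apply: zout; exists i.
congr (_%:R%:E); congr nat_of_bool.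
by apply: eq_forallb => j; rewrite /= inB.
Qed.

Lemma nnmeas_has_counts m : nnmeas (fun s : config Z => (has_counts m s)%:R%:E : \bar R).
Proof.
suff mh : measurable_fun setT (has_counts m : config Z -> bool).
  apply: nnmeas_EFin => //.
  by apply: (measurableT_comp (f := fun b : bool => b%:R : R)).
suff mc i : measurable_fun setT (fun s : config Z => count (fun z => z \in B i) s == m i).
  apply: (measurable_fun_bool true).
  rewrite setTI (_ : _ @^-1` _ = \bigcap_(i in [set: 'I_r])
    [set s : config Z | count (fun z => z \in B i) s == m i]).
    apply: fin_bigcap_measurable => // i _.
    by have := mc i measurableT [set true]; rewrite setTI; exact.
  apply/seteqP; split=> [s /= /forallP h i _|s h]; first exact: h.
  by apply/forallP => i; exact: (h i Logic.I).
have -> : (fun s : config Z => count (fun z => z \in B i) s == m i) =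
    (fun s : config Z => (\sum_(z <- s) (\1_(B i) z : R))%R == (m i)%:R).
  apply/funext => s; rewrite -(eqr_nat R) -sum1_count natr_sum/=.
  rewrite big_mkcond/=; congr (_ == _); apply: eq_bigr => z _.
  by rewrite indicE; case: ifP.
apply: measurable_fun_eqr => //; apply: measurable_config_sum.
exact: measurable_indic.
Qed.

Let msize (m : 'I_r -> nat) := (\sum_(i < r) m i)%N.

Let weight (m : 'I_r -> nat) : R := (\prod_(i < r) (lamB i ^+ m i / (m i)`!%:R))%R.

(** With |m| the sum of the m i, this is 1/k! times the multinomial mass of the lists of k points
    having m i points in each B i and the other k - |m| outside; it is 0 when k < |m|. *)
Let Gk k m : R :=
  (if (msize m <= k)%N then
     weight m * (lamo ^+ (k - msize m) / (k - msize m)`!%:R) else 0)%R.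

Let le_L (A : set Z) : measurable A -> L w (fun z => (\1_A z)%:E) < +oo.
Proof.
move=> mA; have nA := nnmeas_indic (R := R) mA.
have nCA := nnmeas_indic (R := R) (measurableC mA).
have E : L w (fun=> 1) = L w (fun z => (\1_A z)%:E) + L w (fun z => (\1_(~` A) z)%:E).
  rewrite -(ifunD hLw)//; congr (L w); apply/funext => z.
  by rewrite !indicE in_setC; case: (z \in A); rewrite /= ?adde0 ?add0e.
apply: le_lt_trans Lfin; rewrite E leeDl//.
by apply: (ifun_ge0 hLw) => z; rewrite lee_fin.
Qed.

Let L_indic (A : set Z) : measurable A ->
  L w (fun z => (\1_A z)%:E) = (fine (L w (fun z => (\1_A z)%:E)))%:E.
Proof.
move=> mA; rewrite fineK// ge0_fin_numE ?le_L//.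
by apply: (ifun_ge0 hLw) => z; rewrite lee_fin.
Qed.

Let lamB_ge0 i : (0 <= lamB i)%R.
Proof. by apply: fine_ge0; apply: (ifun_ge0 hLw) => z; rewrite lee_fin. Qed.

Let lamo_ge0 : (0 <= lamo)%R.
Proof. by apply: fine_ge0; apply: (ifun_ge0 hLw) => z; rewrite lee_fin. Qed.

Let lam_split : (lam = \sum_(i < r) lamB i + lamo)%R.
Proof.
apply: EFin_inj; rewrite -lamE EFinD -sumEFin.
under eq_bigr do rewrite -L_indic//.
rewrite -L_indic// -(ifun_sum hLw); last by move=> i; exact: nnmeas_indic.
rewrite -(ifunD hLw); [|by apply: nnmeas_sum => i; exact: nnmeas_indic|exact: nnmeas_indic].
congr (L w); apply/funext => z.
have [[i zi]|zout] := pselect (exists i, B i z).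
  rewrite (bigD1 i)//= big1 ?adde0; last first.
    move=> j ji; rewrite indicE memNset// => zj.
    by move: (tB ji) => /seteqP[+ _] => /(_ z (conj zj zi)).
  rewrite !indicE mem_set// memNset ?adde0//.
  by move=> nz; apply: nz; exists i.
rewrite big1 ?add0e.
  by rewrite indicE mem_set// => -[i _ zi]; apply: zout; exists i.
by move=> j _; rewrite indicE memNset// => zj; apply: zout; exists j.
Qed.

Let weight_decr m i :
  (lamB i * (0 < m i)%N%:R * weight (decr m i) = (m i)%:R * weight m)%R.
Proof.
case: (posnP (m i)) => [->|mi0]; first by rewrite mulr0 !mul0r.
rewrite /weight (bigD1 i)//= [in RHS](bigD1 i)//= /decr eqxx.
under eq_bigr => j ji.
  rewrite eq_sym (negbTE ji) subn0; over.
rewrite !mulrA; congr (_ * _)%R; rewrite mulr1 subn1 -[in RHS](prednK mi0).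
rewrite factS natrM exprS; field.
by rewrite -mulrS !pnatr_eq0 -lt0n fact_gt0.
Qed.

Let msize_decr m i : (0 < m i)%N -> (msize (decr m i)).+1 = msize m.
Proof.
move=> mi0; rewrite /msize (bigD1 i)//= [in RHS](bigD1 i)//= /decr eqxx.
under eq_bigr => j ji.
  rewrite eq_sym (negbTE ji) subn0; over.
by rewrite -addSn subn1 prednK.
Qed.

(** The terms of the sets B i add up to |m| times [Gk k.+1 m], the outside term gives k + 1 - |m|
    times it. *)
Let Gk_rec k m :
  (\sum_(i < r) lamB i * (0 < m i)%N%:R * Gk k (decr m i) + lamo * Gk k m =
   k.+1%:R * Gk k.+1 m)%R.
Proof.
have -> : (\sum_(i < r) lamB i * (0 < m i)%N%:R * Gk k (decr m i) =
    (msize m)%:R * Gk k.+1 m)%R.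
  rewrite /msize natr_sum mulr_suml; apply: eq_bigr => i _.
  have [mi0|mi0] := posnP (m i); first by rewrite mi0 mulr0 !mul0r.
  rewrite /Gk -(msize_decr mi0) ltnS subSS; case: ifP => _; last by rewrite !mulr0.
  by rewrite !mulrA -weight_decr mi0.
rewrite /Gk; have [mk|] := leqP (msize m) k.
  rewrite (leqW mk) subSn// factS natrM exprS.
  rewrite -[in RHS](subnK (leqW mk)) natrD subSn//.
  by field; rewrite -mulrS !pnatr_eq0 -lt0n fact_gt0.
rewrite mulr0 addr0 leq_eqVlt => /orP[/eqP mk|mk]; last by rewrite leqNgt mk !mulr0.
by rewrite -mk leqnn.
Qed.

Lemma functional_pow_counts k m :
  functional_pow (L w) k (fun s => (has_counts m s)%:R%:E) = (k`!%:R * Gk k m)%:E.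
Proof.
elim: k m => [|k ih] m /=.
  rewrite fact0 mul1r /Gk leqn0 sub0n expr0 fact0 divr1 mulr1; congr (_%:E).
  have -> : has_counts m [::] = (msize m == 0%N).
    apply/forallP/eqP => [h|/eqP].
      by rewrite /msize big1// => i _; rewrite -(eqP (h i)).
    by rewrite sum_nat_eq0 => /forall_inP h i; rewrite eq_sym h.
  case: eqVneq => // /eqP; rewrite sum_nat_eq0 => /forall_inP h.
  by rewrite /weight big1// => i _; rewrite (eqP (h i isT)) expr0 fact0 divr1.
have G0 j m' : (0 <= j`!%:R * Gk j m')%R.
  rewrite mulr_ge0// /Gk; case: ifP => // _; rewrite mulr_ge0 ?divr_ge0 ?exprn_ge0//.
  by apply: prodr_ge0 => i _; rewrite divr_ge0 ?exprn_ge0.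
transitivity (L w (fun z =>
    \sum_(i < r) ((0 < m i)%N%:R * (k`!%:R * Gk k (decr m i)))%:E * (\1_(B i) z)%:E +
    (k`!%:R * Gk k m)%:E * (\1_Bout z)%:E)).
  congr (L w); apply/funext => z; under eq_fun do rewrite has_counts_cons.
  rewrite (ifunD (hpow k)); last 2 first.
  - apply: nnmeas_sum => i; apply: nnmeasZ; last exact: nnmeas_has_counts.
    by rewrite mulr_ge0.
  - by apply: nnmeasZ => //; exact: nnmeas_has_counts.
  rewrite (ifun_sum (hpow k)); last first.
    move=> i; apply: nnmeasZ; last exact: nnmeas_has_counts.
    by rewrite mulr_ge0.
  rewrite (ifunZ (hpow k))//; last exact: nnmeas_has_counts.
  rewrite ih muleC; congr (_ + _); apply: eq_bigr => i _.
  rewrite (ifunZ (hpow k)) ?ih ?mulr_ge0//; last exact: nnmeas_has_counts.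
  by rewrite -!EFinM mulrAC.
have nnB i : nnmeas (fun z => ((0 < m i)%N%:R * (k`!%:R * Gk k (decr m i)))%:E * (\1_(B i) z)%:E).
  by apply: nnmeasZ; [rewrite mulr_ge0|exact: nnmeas_indic].
have nnBo : nnmeas (fun z => (k`!%:R * Gk k m)%:E * (\1_Bout z)%:E).
  by apply: nnmeasZ; [|exact: nnmeas_indic].
rewrite (ifunD hLw)//; last exact: nnmeas_sum.
rewrite (ifun_sum hLw)// (ifunZ hLw)//; last exact: nnmeas_indic.
rewrite L_indic// -/lamo.
under eq_bigr => i _.
  rewrite (ifunZ hLw); [|by rewrite mulr_ge0|exact: nnmeas_indic].
  rewrite L_indic// -/(lamB i) -EFinM; over.
rewrite sumEFin -EFinM -EFinD factS natrM; congr (_%:E).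
rewrite [RHS]mulrAC -Gk_rec mulrDl mulr_suml; congr (_ + _)%R; last by ring.
by apply: eq_bigr => i _; ring.
Qed.

(** Only the terms k >= |m| survive, and their sum over k - |m| is the exponential of the outside
    mass. What remains of exp(- lam) is the exponential of minus the masses of the B i, which splits
    into the normalizations of independent Poisson laws. *)
Lemma poisson_functional_counts m :
  poisson_functional (L w) (fun s => (has_counts m s)%:R%:E) =
  (\prod_(i < r) pois (fine (L w (fun z => (\1_(B i) z)%:E))) (m i))%:E.
Proof.
rewrite /poisson_functional -/lam.
have termE k : (expR (- lam) / k`!%:R * (k`!%:R * Gk k m) = expR (- lam) * Gk k m)%R.
  by field; rewrite pnatr_eq0 -lt0n fact_gt0.
under eq_eseriesr do rewrite functional_pow_counts -EFinM termE.
have w0 : (0 <= weight m)%R.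
  by apply: prodr_ge0 => i _; rewrite divr_ge0 ?exprn_ge0.
rewrite (nneseries_shift (m := msize m)); last 2 first.
- move=> k; rewrite lee_fin mulr_ge0 ?expR_ge0// /Gk; case: ifP => // _.
  by rewrite mulr_ge0 ?divr_ge0 ?exprn_ge0.
- by move=> k km; rewrite /Gk leqNgt km/= mulr0.
under eq_eseriesr => k _.
  rewrite /Gk leq_addl addnK mulrA EFinM; over.
rewrite nneseriesZl; last by move=> k _; rewrite lee_fin divr_ge0 ?exprn_ge0.
rewrite nneseries_expR// -EFinM; congr (_%:E).
rewrite /pois big_split/= -/(weight m) mulrAC mulrC; congr (_ * _)%R.
by rewrite -expRD lam_split opprD subrK -sumrN expR_sum.
Qed.

End counts.
End poisson_functional_theory.

Section functional_lemmas.
Context {R : realType} {d} {Y : measurableType d}.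

Lemma ifun_cst (L : (Y -> \bar R) -> \bar R) c : integral_functional L ->
  L (fun=> 1) = 1 -> 0 <= c -> L (fun=> c) = c.
Proof.
move=> hL L1; case: c => [c|_|//]; last first.
  (* No finite value x satisfies x = x + 1, and positivity excludes -oo. *)
  have : L (fun=> +oo) = L (fun=> +oo) + L (fun=> 1).
    by rewrite -(ifunD hL)//; exact: nnmeas_cst.
  have := ifun_ge0 hL (f := fun=> +oo) (fun=> le0y).
  rewrite L1; case: (L _) => // x _ [] /eqP.
  by rewrite addrC -subr_eq subrr eq_sym oner_eq0.
move=> c0; rewrite -[RHS]mule1 -L1 -(ifunZ hL)//.
by congr L; apply/funext => z; rewrite mule1.
Qed.

Lemma ifun_integral_kop d' (W : measurableType d') (mu : {measure set W -> \bar R})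
    (M : W -> (Y -> \bar R) -> \bar R) : kernel_operator M ->
  integral_functional (fun f => \int[mu]_w M w f).
Proof.
move=> hM; have hMf f : nnmeas f -> nnmeas (fun w => M w f) by exact: kop_nnmeas.
have hMw w := kop_functional hM w; split.
- by move=> f f0; apply: integral_ge0 => w _; exact: (ifun_ge0 (hMw w)).
- move=> f g hf hg; have [mf f0] := hMf _ hf; have [mg g0] := hMf _ hg.
  rewrite -ge0_integralD//; apply: eq_integral => w _.
  exact: (ifunD (hMw w)).
- move=> r f r0 hf; have [mf f0] := hMf _ hf.
  rewrite -ge0_integralZl ?lee_fin//; apply: eq_integral => w _.
  exact: (ifunZ (hMw w)).
- move=> f hf; rewrite -integral_nneseries//; last 2 first.
  + by move=> k; exact: (hMf _ (hf k)).1.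
  + by move=> k w _; exact: (hMf _ (hf k)).2.
  by apply: eq_integral => w _; exact: (ifun_nneseries (hMw w)).
Qed.

Lemma integral_indicM (mu : {measure set Y -> \bar R}) (E : set Y) (f : Y -> \bar R) :
  \int[mu]_(y in E) f y = \int[mu]_y ((\1_E y)%:E * f y).
Proof.
rewrite integral_mkcond; apply: eq_integral => y _.
by rewrite patchE indicE; case: ifP => _; rewrite ?mul1e ?mul0e.
Qed.

End functional_lemmas.

(** * Construction of the recursive Poisson process of a kernel operator *)

Section recursive_poisson.
Context {R : realType} {d} {Z : measurableType d}.
Variable L : Z -> (Z -> \bar R) -> \bar R.
Hypothesis hL : kernel_operator L.
Hypothesis Lfin : forall z, L z (fun=> 1) < +oo.

Definition offspring (s : seq Z) (f : seq Z -> \bar R) : \bar R :=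
  poisson_functional (fun g => \sum_(z <- s) L z g) f.

Lemma kop_offspring : kernel_operator (offspring : config Z -> (config Z -> \bar R) -> \bar R).
Proof. exact: kop_poisson (kop_config hL). Qed.

Lemma intensity_lty (s : seq Z) : \sum_(z <- s) L z (fun=> 1) < +oo.
Proof. by rewrite lte_sum_pinfty. Qed.

Lemma offspring_mass s : offspring s (fun=> 1) = 1.
Proof. exact: (poisson_functional_mass (kop_config hL) (intensity_lty s)). Qed.

(** [F l] is an abstract past of generation l + 1: it only has to contain the events on the
    configurations of generations 0 to l. Since these are configurations of coupled particles, the
    same [F] later serves both projections. *)
Lemma recursive_poisson_exists (z0 : Z) (n : nat) :
  exists (dO : measure_display) (Omega : measurableType dO) (P : probability Omega R)
    (s : nat -> Omega -> config Z) (F : nat -> set (set Omega)),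
  [/\ forall w, s 0%N w = [:: z0],
      forall l, (l <= n)%N -> measurable_fun setT (s l),
      forall l, (l < n)%N -> sigma_algebra setT (F l) /\ F l `<=` measurable,
      forall l j S, (l < n)%N -> (j <= l)%N -> measurable S -> F l (s j @^-1` S) &
      forall l E f, (l < n)%N -> F l E -> nnmeas f ->
        \int[P]_(w in E) f (s l.+1 w) = \int[P]_(w in E) offspring (s l w) f].
Proof.
elim: n => [|n [dO [Om [P [s [F [s0 ms sF sFs hF]]]]]]].
  have hu : integral_functional (fun f : unit -> \bar R => f tt) by split.
  have [P _] := functional_probability hu erefl.
  exists _, unit, P, (fun _ _ => [:: z0]), (fun _ => measurable).
  by split.
have kM0 := kop_map kop_offspring (ms n (leqnn n)).
(* Joint functional of the old sample and a new generation drawn from [offspring (s n w)]; its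
   integral over [P] is the new probability. *)
pose M w (f : Om * config Z -> \bar R) := offspring (s n w) (fun t => f (w, t)).
have hM : kernel_operator M.
  by apply: (kop_comp (M := fun wt f => f wt) kM0); apply: kop_dirac.
have hPhi := ifun_integral_kop P hM.
have [|P' hP'] := functional_probability hPhi.
  under eq_integral do rewrite /M offspring_mass.
  by rewrite (integral_cst P measurableT 1) mul1e; exact: probability_setT.
have marg (g : Om -> \bar R) : nnmeas g -> \int[P']_wt g wt.1 = \int[P]_w g w.
  move=> hg; rewrite hP'; last exact: nnmeas_comp hg.
  apply: eq_integral => w _; rewrite /M/=.
  exact: (ifun_cst (kop_functional kM0 w) (offspring_mass _) (hg.2 w)).
have margE (E : set Om) (g : Om -> \bar R) : measurable E -> nnmeas g ->
    \int[P']_(wt in fst @^-1` E) g wt.1 = \int[P]_(w in E) g w.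
  move=> mE hg; rewrite [LHS]integral_indicM [RHS]integral_indicM -marg//.
  by apply: nnmeasM => //; exact: nnmeas_indic.
pose s' l (wt : Om * config Z) : config Z := if (l <= n)%N then s l wt.1 else wt.2.
(* The old pasts are pulled back for l < n. For l = n the past is everything measurable in the old
   space. *)
pose F' l := preimage_set_system setT (@fst Om (config Z))
  (if (l < n)%N then F l else measurable).
have mF' l : (if (l < n)%N then F l else measurable) `<=` measurable.
  by case: ifP => [ln|_]; [exact: (sF l ln).2|exact: subset_refl].
exists _, (Om * config Z)%type, P', s', F'; split.
- by move=> w; rewrite /s' leq0n s0.
- move=> l _; rewrite /s'; case: leqP => ln.
    exact: (measurableT_comp (ms l ln)).
  exact: measurable_snd.
- move=> l _; split.
    apply: sigma_algebra_preimage; case: ifP => [ln|_]; first exact: (sF l ln).1.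
    exact: sigma_algebra_measurable.
  by move=> _ [E hE <-]; apply: measurable_fst => //; exact: mF' hE.
- move=> l j S; rewrite ltnS => ln jl mS; have jn := leq_trans jl ln.
  exists (s j @^-1` S).
    case: ifP => [ln'|_]; first exact: sFs.
    by rewrite -[_ @^-1` _]setTI; exact: ms.
  by rewrite setTI /s' jn.
- move=> l E' f; rewrite ltnS => ln [E hE <-{E'}] hf; rewrite setTI.
  have mE := mF' _ _ hE; rewrite /s' ln.
  have hO : nnmeas (fun w => offspring (s l w) f).
    exact: (nnmeas_comp (ms l ln) (kop_nnmeas kop_offspring hf)).
  rewrite (margE E (fun w => offspring (s l w) f))//.
  move: hE; rewrite ltnNge; case: ltngtP ln => // [ln _ hE|-> _ _] /=.
    rewrite (margE E (fun w => f (s l.+1 w)))//; last exact: nnmeas_comp (ms _ ln) hf.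
    exact: hF.
  rewrite [LHS]integral_indicM [RHS]integral_indicM hP'; last first.
    apply: nnmeasM; last exact: nnmeas_comp hf.
    by apply: nnmeas_comp (nnmeas_indic mE).
  apply: eq_integral => w _; rewrite /M.
  exact: (ifunZ (kop_functional kM0 w) (r := \1_E w)).
Qed.

End recursive_poisson.

Local Close Scope ereal_scope.

(** * Finite linear programming duality *)

Section farkas.
Context {R : realFieldType}.

(** Chooses the eliminated variable between its lower and upper bounds: the greatest lower bound
    value if there is one, else the least upper one, else 0. *)
Let between (I : finType) (P Q : pred I) (lo up : I -> R) :
  (forall k i, P k -> Q i -> lo k <= up i) ->
  exists t, (forall k, P k -> lo k <= t) /\ (forall i, Q i -> t <= up i).
Proof.
move=> h; case: (pickP P) => [k0 Pk0|nP].
  exists (lo [arg max_(k > k0 | P k) lo k]%O); case: arg_maxP => // k Pk kmax.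
  by split=> // i Qi; exact: h.
case: (pickP Q) => [i0 Qi0|nQ].
  exists (up [arg min_(i < i0 | Q i) up i]%O); case: arg_minP => // i Qi imin.
  by split=> // k; rewrite nP.
by exists 0; split=> i; rewrite ?nP ?nQ.
Qed.

(* Fourier-Motzkin elimination of the first variable: [comb u] lists the
   coefficients of the constraints of which [u] is a combination. *)
Let farkas_ord n : forall (I : finType) (a : I -> 'I_n -> R) (b : I -> R),
  (exists x : 'I_n -> R, forall i, \sum_j a i j * x j <= b i) \/
  (exists y : I -> R, [/\ forall i, 0 <= y i,
     forall j, \sum_i y i * a i j = 0 & \sum_i y i * b i < 0]).
Proof.
elim: n => [|n ih] I a b.
  case: (pickP (fun i => b i < 0)) => [i0 bi0|nb].
    right; exists (fun i => (i == i0)%:R); split=> [i|[]//|].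
      by rewrite ler0n.
    rewrite (bigD1 i0)//= eqxx mul1r big1 ?addr0// => i /negbTE ->.
    by rewrite mul0r.
  left; exists (fun=> 0) => i; rewrite big_ord0 leNgt.
  by have := nb i; rewrite /= => ->.
pose a0 i := a i ord0.
(* Indices with the wrong signs give the zero combination, that is the trivial constraint 0 <= 0, so
   the index type need not depend on the coefficients. *)
pose comb (u : (I * I) + I) (l : I) : R := match u with
  | inl (i, k) => if (0 < a0 i) && (a0 k < 0)
      then (l == i)%:R * - a0 k + (l == k)%:R * a0 i else 0
  | inr i => if a0 i == 0 then (l == i)%:R else 0 end.
have sum1 (i : I) (f : I -> R) : \sum_l (l == i)%:R * f l = f i.
  rewrite (bigD1 i)//= eqxx mul1r big1 ?addr0// => l /negbTE ->.
  by rewrite mul0r.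
have sumcomb i k (f : I -> R) : 0 < a0 i -> a0 k < 0 ->
    \sum_l comb (inl (i, k)) l * f l = - a0 k * f i + a0 i * f k.
  move=> ai ak; rewrite /= ai ak/=.
  under eq_bigr do rewrite mulrDl -!mulrA.
  by rewrite big_split/= !sum1.
have comb0 u : \sum_l comb u l * a0 l = 0.
  case: u => [[i k]|i].
    have [/andP[ai ak]|nc] := boolP ((0 < a0 i) && (a0 k < 0)).
      by rewrite sumcomb// mulNr mulrC addNr.
    by rewrite big1// => l _; rewrite /= (negbTE nc) mul0r.
  have [ai|ai] := eqVneq (a0 i) 0; first by rewrite /= ai eqxx sum1.
  by rewrite big1// => l _; rewrite /= (negbTE ai) mul0r.
have comb_ge0 u l : 0 <= comb u l.
  case: u => [[i k]|i] /=; last by case: ifP => // _; rewrite ler0n.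
  case: ifP => // /andP[ai ak]; rewrite addr_ge0// mulr_ge0 ?ler0n ?oppr_ge0//; exact: ltW.
have [[x hx]|[y [y0 ya yb]]] := ih _
    (fun u j => \sum_l comb u l * a l (lift ord0 j)) (fun u => \sum_l comb u l * b l).
  (* [s i] is the room that constraint i leaves for the first variable; [s i / a0 i] bounds that
     variable from above or from below according to the sign of [a0 i]. *)
  left; pose s i := b i - \sum_j a i (lift ord0 j) * x j.
  have hs u : 0 <= \sum_l comb u l * s l.
    have := hx u; rewrite -subr_ge0; congr (0 <= _).
    under [in RHS]eq_bigr do rewrite mulrBr.
    rewrite sumrB; congr (_ - _).
    under eq_bigr do rewrite mulr_suml.
    rewrite exchange_big/=; apply: eq_bigr => l _; rewrite mulr_sumr.
    by apply: eq_bigr => j _; rewrite mulrA.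
  have [|t [tlo tup]] := @between _ (fun k => a0 k < 0) (fun i => 0 < a0 i)
      (fun k => s k / a0 k) (fun i => s i / a0 i).
    move=> k i ak ai; have := hs (inl (i, k)); rewrite sumcomb// => h.
    rewrite ler_pdivlMr// mulrAC ler_ndivrMr//.
    by rewrite -subr_ge0; apply: le_trans h _; rewrite le_eqVlt; apply/orP; left; apply/eqP; ring.
  exists (fun j => if unlift ord0 j is Some j' then x j' else t) => i.
  rewrite big_ord_recl unlift_none; under eq_bigr do rewrite liftK.
  rewrite -lerBrDr -/(s i) -/(a0 i).
  have [ai|ai|ai] := ltgtP (a0 i) 0.
  - by have := tlo i ai; rewrite ler_ndivrMr// mulrC.
  - by have := tup i ai; rewrite ler_pdivlMr// mulrC.
  - by have := hs (inr i); rewrite /= ai eqxx mul0r sum1.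
right; exists (fun l => \sum_u y u * comb u l).
have ex (f : I -> R) : \sum_l (\sum_u y u * comb u l) * f l =
    \sum_u y u * \sum_l comb u l * f l.
  under eq_bigr do rewrite mulr_suml.
  rewrite exchange_big/=; apply: eq_bigr => u _; rewrite mulr_sumr.
  by apply: eq_bigr => l _; rewrite mulrA.
split=> [l|j|]; rewrite ?ex//.
- by apply: sumr_ge0 => u _; rewrite mulr_ge0.
- case: (unliftP ord0 j) => [j' ->|->]; first exact: ya.
  by rewrite big1// => u _; rewrite comb0 mulr0.
Qed.

Lemma farkas (I J : finType) (a : I -> J -> R) (b : I -> R) :
  (exists x : J -> R, forall i, \sum_j a i j * x j <= b i) \/
  (exists y : I -> R, [/\ forall i, 0 <= y i,
     forall j, \sum_i y i * a i j = 0 & \sum_i y i * b i < 0]).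
Proof.
have [[x hx]|[y [y0 ya yb]]] := farkas_ord (fun i (j : 'I_#|J|) => a i (enum_val j)) b.
  left; exists (fun j => x (enum_rank j)) => i.
  rewrite (reindex_onto (@enum_val J predT) enum_rank)/=; last by move=> *; rewrite enum_rankK.
  rewrite (eq_bigl predT); last by move=> j; rewrite /= enum_valK eqxx.
  by under eq_bigr do rewrite enum_valK.
right; exists y; split=> // j.
by rewrite -[j]enum_rankK; exact: ya.
Qed.

(** Partial transport in which each unit of mass of either side left in place costs 1; this gives
    the cost c - 2 for transported mass. The four requirements on r form a linear system. If it were
    infeasible, a Farkas certificate with multipliers p, q for the marginals and th for the cost
    would yield dual potentials 1 - p/th and 1 - q/th whose value exceeds W. *)
Lemma transport_duality (T : finType) (c : T -> T -> R) (a b : T -> R) (W : R) :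
  (forall i, 0 <= a i) -> (forall i, 0 <= b i) ->
  (forall p q : T -> R, (forall i, p i <= 1) -> (forall i, q i <= 1) ->
    (forall i j, p i + q j <= c i j) ->
    \sum_i p i * a i + \sum_i q i * b i <= W) ->
  exists r : T -> T -> R, [/\ forall i j, 0 <= r i j,
    forall i, \sum_j r i j <= a i, forall j, \sum_i r i j <= b j &
    \sum_i \sum_j r i j * (c i j - 2) + \sum_i a i + \sum_i b i <= W].
Proof.
move=> a0 b0 hW.
pose I : finType := ((T * T) + (T + (T + unit)))%type.
pose A (u : I) (e : T * T) : R := match u with
  | inl e' => - (e' == e)%:R
  | inr (inl i) => (i == e.1)%:R
  | inr (inr (inl j)) => (j == e.2)%:R
  | inr (inr (inr _)) => c e.1 e.2 - 2 end.
pose B (u : I) : R := match u with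
  | inl _ => 0 | inr (inl i) => a i | inr (inr (inl j)) => b j
  | inr (inr (inr _)) => W - \sum_i a i - \sum_i b i end.
have sum1 (U : finType) (i : U) (f : U -> R) : \sum_l (l == i)%:R * f l = f i.
  rewrite (bigD1 i)//= eqxx mul1r big1 ?addr0// => l /negbTE ->.
  by rewrite mul0r.
have pairE (F : T * T -> R) : \sum_e F e = \sum_i \sum_j F (i, j).
  by rewrite pair_bigA/=; apply: eq_bigr => -[].
have [[x hx]|[y [y0 ya]]] := farkas A B.
  exists (fun i j => x (i, j)); split.
  - move=> i j; have := hx (inl (i, j)) => /=.
    under eq_bigr do rewrite mulNr eq_sym.
    by rewrite sumrN sum1 oppr_le0.
  - move=> i; have := hx (inr (inl i)) => /=.
    rewrite pairE/=.
    under eq_bigr do rewrite -mulr_sumr eq_sym.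
    by rewrite sum1.
  - move=> j; have := hx (inr (inr (inl j))) => /=.
    rewrite pairE/=.
    under eq_bigr => i _.
      under eq_bigr do rewrite eq_sym.
      rewrite sum1; over.
    by [].
  - have := hx (inr (inr (inr tt))) => /=.
    rewrite pairE/=.
    under eq_bigr => i _.
      under eq_bigr do rewrite mulrC.
      over.
    by rewrite !lerBrDr addrAC.
pose p i := y (inr (inl i)); pose q j := y (inr (inr (inl j))).
pose th := y (inr (inr (inr tt))).
have p0 i : 0 <= p i by exact: y0.
have q0 j : 0 <= q j by exact: y0.
rewrite !big_sumType/= big1 ?add0r; last by move=> e _; rewrite mulr0.
rewrite (big_pred1 tt); last by case.
rewrite -/p -/q -/th => yB.
have pq i j : th * (2 - c i j) <= p i + q j.
  have := ya (i, j); rewrite !big_sumType/= (big_pred1 tt); last by case.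
  under eq_bigr do rewrite mulrN mulrC.
  rewrite sumrN sum1; under eq_bigr do rewrite mulrC; rewrite sum1.
  under eq_bigr do rewrite mulrC; rewrite sum1 -/(p i) -/(q j) -/th => h.
  have := y0 (inl (i, j)); lra.
have sp : 0 <= \sum_i p i * a i by apply: sumr_ge0 => i _; rewrite mulr_ge0.
have sq : 0 <= \sum_i q i * b i by apply: sumr_ge0 => i _; rewrite mulr_ge0.
(* With th = 0 the certificate would be a sum of nonnegative terms, yet it is negative. *)
have th0 : 0 < th.
  rewrite lt_neqAle y0 andbT eq_sym; apply/eqP => th0; move: yB.
  by rewrite /p /q in sp sq *; rewrite th0 mul0r addr0 => /(le_lt_trans (addr_ge0 sp sq)); rewrite ltxx.
have := hW (fun i => 1 - p i / th) (fun i => 1 - q i / th).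
have E1 : \sum_i (1 - p i / th) * a i = \sum_i a i - (\sum_i p i * a i) / th.
  by rewrite mulr_suml -sumrB; apply: eq_bigr => i _; rewrite mulrBl mul1r mulrAC.
have E2 : \sum_i (1 - q i / th) * b i = \sum_i b i - (\sum_i q i * b i) / th.
  by rewrite mulr_suml -sumrB; apply: eq_bigr => i _; rewrite mulrBl mul1r mulrAC.
rewrite E1 E2 => hW'; exfalso; move: yB; apply/negP; rewrite -leNgt.
have {}hW' : \sum_i a i - (\sum_i p i * a i) / th +
    (\sum_i b i - (\sum_i q i * b i) / th) <= W.
  apply: hW' => [i|i|i j]; rewrite ?gerBl ?divr_ge0// ?(ltW th0)//.
  have := pq i j; rewrite -ler_pdivlMl// => h; rewrite -!(mulrC th^-1).
  by rewrite mulrDr in h; lra.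
move: hW'; set u := _ / th; set v := _ / th => hW'.
have uE : \sum_i p i * a i = th * u by rewrite /u; field; rewrite gt_eqF.
have vE : \sum_i q i * b i = th * v by rewrite /v; field; rewrite gt_eqF.
have -> : \sum_i p i * a i + (\sum_i q i * b i + th * (W - \sum_i a i - \sum_i b i)) =
    th * (u + v + (W - \sum_i a i - \sum_i b i)) by rewrite uE vE; ring.
by rewrite mulr_ge0 ?(ltW th0)//; lra.
Qed.

End farkas.

(** * Measurable transport plans *)

Lemma measurable_fun_sublevel {R : realType} d (X : measurableType d) (f : X -> R) :
  (forall r, measurable [set x | f x < r]) -> measurable_fun setT f.
Proof.
move=> hf; apply: (@measurability _ _ X _ setT f _ (RGenInftyO.measurableE R)).
move=> _ [_ [r ->] <-]; rewrite setTI.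
by rewrite (_ : _ @^-1` _ = [set x | f x < r])//; apply/seteqP; split=> x /=;
  rewrite in_itv.
Qed.

Section first_index.

Definition first_index (P : pred nat) : nat :=
  if pselect (exists k, P k) is left h then ex_minn h else 0%N.

Lemma first_indexP (P : pred nat) : (exists k, P k) -> P (first_index P).
Proof.
by move=> h; rewrite /first_index; case: pselect => // h'; case: ex_minnP.
Qed.

Lemma measurable_first_index d (X : measurableType d) (P : nat -> X -> bool) :
  (forall k, measurable_fun setT (P k)) ->
  measurable_fun setT (fun x => first_index (P^~ x)).
Proof.
move=> mP; have mPk k : measurable [set x | P k x].
  by rewrite -[X in measurable X]setTI; apply: (mP k measurableT [set true]).
have mlow k : measurable [set x | forall j, (j < k)%N -> ~~ P j x].
  rewrite (_ : [set _ | _] = \bigcap_(j in [set j | (j < k)%N]) ~` [set x | P j x]).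
    by apply: bigcap_measurableType => j _; exact: measurableC.
  by apply/seteqP; split=> x h j jk; apply/negP; exact: h.
have mnone : measurable [set x | forall j, ~~ P j x].
  rewrite (_ : [set _ | _] = \bigcap_j ~` [set x | P j x]).
    by apply: bigcap_measurableType => j _; exact: measurableC.
  by apply/seteqP; split=> x h j => [_|]; apply/negP; exact: h.
have idx_none x : (forall j, ~~ P j x) -> first_index (P^~ x) = 0%N.
  by move=> h; rewrite /first_index; case: pselect => // h'; exfalso; case: h' => k; rewrite (negbTE (h k)).
have idx_some x k : P k x -> (forall j, (j < k)%N -> ~~ P j x) -> first_index (P^~ x) = k.
  move=> Pk low; rewrite /first_index; case: pselect => [h|]; last by case; exists k.
  case: ex_minnP => m Pm mmin; apply/eqP; rewrite eqn_leq mmin//= leqNgt.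
  by apply/negP => /low; rewrite Pm.
move=> _ A _; rewrite setTI.
(* The value 0 is also taken when no index qualifies, hence the extra piece when [A] contains 0. *)
rewrite (_ : _ @^-1` _ = (\bigcup_(k in A)
    ([set x | P k x] `&` [set x | forall j, (j < k)%N -> ~~ P j x])) `|`
    (if pselect (A 0%N) then [set x | forall j, ~~ P j x] else set0)).
  apply: measurableU; last by case: pselect => ?; [exact: mnone|exact: measurable0].
  by apply: bigcup_measurable => k _; exact: measurableI.
apply/seteqP; split=> x /=.
  move=> Ax; have [h|h] := pselect (exists k, P k x).
    left; exists (first_index (P^~ x)) => //; split; first exact: (@first_indexP (P^~ x) h).
    move=> j; rewrite /first_index; case: pselect => // h'; case: ex_minnP => m _ mmin.
    by rewrite ltnNge; apply: contra => /mmin.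
  have hn j : ~~ P j x by apply/negP => Pj; apply: h; exists j.
  by right; case: pselect => // nA; apply: nA; rewrite -(idx_none x).
case=> [[k Ak [Pk low]]|]; first by rewrite (idx_some x k).
by case: pselect => // A0 /idx_none ->.
Qed.

End first_index.

Section metric.
Context {R : realType} {dX} {X : measurableType dX} (d : X -> X -> R).
Hypothesis dmet : is_metric d.
Hypothesis dborel : borel_for d.

Lemma dist_ge0 x y : 0 <= d x y. Proof. by case: dmet. Qed.
Lemma distxx x : d x x = 0. Proof. by case: dmet => _ h _ _; apply/h. Qed.
Lemma distC x y : d x y = d y x. Proof. by case: dmet. Qed.
Lemma dist_triangle x y z : d x z <= d x y + d y z. Proof. by case: dmet. Qed.

Lemma measurable_lipschitz (f : X -> R) : (forall x y, `|f x - f y| <= d x y) ->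
  measurable_fun setT f.
Proof.
move=> lf; apply: measurable_fun_sublevel => r; rewrite dborel.
apply: sub_sigma_algebra => x /= fx; exists (r - f x); first by rewrite subr_gt0.
move=> y /= dxy; have := lf x y; rewrite ler_norml => /andP[h _].
by rewrite ltrBrDr in dxy; apply: le_lt_trans dxy; rewrite -lerBlDr; lra.
Qed.

Lemma dist_lipschitz u x y : `|d x u - d y u| <= d x y.
Proof.
have := dist_triangle x y u; have := dist_triangle y x u; rewrite (distC y x).
by rewrite ler_norml => h1 h2; apply/andP; split; lra.
Qed.

Lemma measurable_distr u : measurable_fun setT (d^~ u).
Proof. by apply: measurable_lipschitz => x y; exact: dist_lipschitz. Qed.

(** By density, d x y < r exactly when d x (u k) + d y (u k) < r for some k; this is a countable
    union of sets measurable for the product sigma-algebra. *)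
Lemma measurable_dist : dist_separable d ->
  measurable_fun setT (fun xy : X * X => d xy.1 xy.2).
Proof.
move=> [u udense]; apply: measurable_fun_sublevel => r.
rewrite (_ : [set _ | _] =
    \bigcup_k [set xy : X * X | d xy.1 (u k) + d xy.2 (u k) < r]).
  apply: bigcupT_measurable => k; rewrite -[X in measurable X]setTI.
  have m : measurable_fun setT (fun xy : X * X => d xy.1 (u k) + d xy.2 (u k)).
    by apply: measurable_funD; apply: (measurableT_comp (measurable_distr (u k))).
  rewrite (_ : [set _ | _] = (fun xy : X * X => d xy.1 (u k) + d xy.2 (u k)) @^-1`
    [set` `]-oo, r[]); last by apply/seteqP; split=> x /=; rewrite in_itv.
  by apply: m => //; exact: measurable_itv.
apply/seteqP; split=> [[x y] /= xyr|[x y] [k _ /= h]]; last first.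
  by apply: le_lt_trans h; rewrite (distC y); exact: dist_triangle.
have e0 : 0 < (r - d x y) / 2 by rewrite divr_gt0// subr_gt0.
have [k hk] := udense x _ e0; exists k => //=.
have := dist_triangle y x (u k); rewrite (distC y x) => h.
by apply: le_lt_trans (lerD (lexx _) h) _; lra.
Qed.

End metric.

(** * Transport plans proportional to the product measure on pairs of cells *)

Section cells.
Context {R : realType} {dX} {X : measurableType dX}.
Variable c : X -> nat.
Hypothesis mc : measurable_fun setT c.

Definition cell_mass (mu : {measure set X -> \bar R}) i : R :=
  fine (mu (c @^-1` [set i])).

Lemma measurable_cell i : measurable (c @^-1` [set i]).
Proof. by rewrite -[X in measurable X]setTI; exact: mc. Qed.

Lemma cell_massE (mu : {measure set X -> \bar R}) i : (mu setT < +oo)%E ->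
  mu (c @^-1` [set i]) = (cell_mass mu i)%:E.
Proof.
move=> mufin; rewrite fineK// ge0_fin_numE//; apply: le_lt_trans mufin.
by apply: le_measure => //; apply: mem_set => //; exact: measurable_cell.
Qed.

Lemma cell_mass_ge0 (mu : {measure set X -> \bar R}) i : 0 <= cell_mass mu i.
Proof. exact: fine_ge0. Qed.

Lemma integral_cell (mu : {measure set X -> \bar R}) (g : nat -> R) N :
  (mu setT < +oo)%E -> (forall j, 0 <= g j) -> (forall j, (N <= j)%N -> g j = 0) ->
  (\int[mu]_x (g (c x))%:E)%E = (\sum_(j < N) g j * cell_mass mu j)%:E.
Proof.
move=> mufin g0 gN.
have gE x : (g (c x))%:E =
    (\sum_(j < N) (g j)%:E * (\1_(c @^-1` [set nat_of_ord j]) x)%:E)%E.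
  have [cN|cN] := ltnP (c x) N.
    rewrite (bigD1 (Ordinal cN))//= big1 ?adde0 => [|j jc].
      by rewrite indicE mem_set// mule1.
    rewrite indicE memNset ?mule0//= => /eqP cj; move: jc.
    by rewrite -val_eqE/= eq_sym cj.
  rewrite gN// big1// => j _; rewrite indicE memNset ?mule0//= => cj.
  by have := ltn_ord j; rewrite -cj ltnNge cN.
under eq_integral do rewrite gE.
have nn j : nnmeas (fun x => ((g j)%:E * (\1_(c @^-1` [set j]) x)%:E)%E).
  by apply: nnmeasZ => //; apply: nnmeas_indic; exact: measurable_cell.
rewrite ge0_integral_sum//; last 2 first.
- by move=> j; exact: (nn j).1.
- by move=> j x _; exact: (nn j).2.
rewrite -sumEFin; apply: eq_bigr => j _.
have nj := nnmeas_indic (R := R) (measurable_cell j).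
rewrite ge0_integralZl//; [|exact: nj.1|by rewrite lee_fin].
rewrite integral_indic ?setIT//; last exact: measurable_cell.
by rewrite cell_massE// EFinM.
Qed.

Section plan.
Variables (mu nu : {measure set X -> \bar R}) (N : nat) (r : nat -> nat -> R).
Hypothesis mufin : (mu setT < +oo)%E.
Hypothesis nufin : (nu setT < +oo)%E.
Hypothesis r0 : forall i j, 0 <= r i j.
Hypothesis rN : forall i j, (N <= i)%N || (N <= j)%N -> r i j = 0.
Hypothesis rmu : forall i, \sum_(j < N) r i j <= cell_mass mu i.
Hypothesis rnu : forall j, \sum_(i < N) r i j <= cell_mass nu j.

(** Density, with respect to the product of [mu] and [nu], of the plan that spreads the mass [r i j]
    evenly over cell i times cell j. On a null cell the division by 0 returns 0, in accordance with
    r, which the marginal constraints force to vanish there. *)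
Definition plan_density x y : R :=
  r (c x) (c y) / (cell_mass mu (c x) * cell_mass nu (c y)).

Lemma plan_density_ge0 x y : 0 <= plan_density x y.
Proof. by rewrite divr_ge0// mulr_ge0// cell_mass_ge0. Qed.

Let r_mu0 i j : cell_mass mu i = 0 -> r i j = 0.
Proof.
move=> ai; have [jN|jN] := ltnP j N; last by rewrite rN// jN orbT.
apply/eqP; rewrite eq_le r0 andbT -ai; apply: le_trans (rmu i).
by rewrite (bigD1 (Ordinal jN))//= lerDl sumr_ge0.
Qed.

Let r_nu0 i j : cell_mass nu j = 0 -> r i j = 0.
Proof.
move=> bj; have [iN|iN] := ltnP i N; last by rewrite rN// iN.
apply/eqP; rewrite eq_le r0 andbT -bj; apply: le_trans (rnu j).
by rewrite (bigD1 (Ordinal iN))//= lerDl sumr_ge0.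
Qed.

Lemma integral_plan_density_r x :
  (\int[nu]_y (plan_density x y)%:E)%E =
  ((\sum_(j < N) r (c x) j) / cell_mass mu (c x))%:E.
Proof.
rewrite (integral_cell (g := fun j => r (c x) j / (cell_mass mu (c x) * cell_mass nu j)) (N := N))//.
- congr (_%:E); rewrite mulr_suml; apply: eq_bigr => j _.
  have [bj|bj] := eqVneq (cell_mass nu j) 0; first by rewrite (r_nu0 _ bj) !mul0r.
  have [ai|ai] := eqVneq (cell_mass mu (c x)) 0; first by rewrite (r_mu0 _ ai) !mul0r.
  by field; rewrite ai bj.
- by move=> j; rewrite divr_ge0// mulr_ge0// cell_mass_ge0.
- by move=> j jN; rewrite rN ?mul0r// jN orbT.
Qed.

Lemma integral_plan_density_l y :
  (\int[mu]_x (plan_density x y)%:E)%E =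
  ((\sum_(i < N) r i (c y)) / cell_mass nu (c y))%:E.
Proof.
rewrite (integral_cell (g := fun i => r i (c y) / (cell_mass mu i * cell_mass nu (c y))) (N := N))//.
- congr (_%:E); rewrite mulr_suml; apply: eq_bigr => i _.
  have [bj|bj] := eqVneq (cell_mass nu (c y)) 0; first by rewrite (r_nu0 _ bj) !mul0r.
  have [ai|ai] := eqVneq (cell_mass mu i) 0; first by rewrite (r_mu0 _ ai) !mul0r.
  by field; rewrite ai bj.
- by move=> i; rewrite divr_ge0// mulr_ge0// cell_mass_ge0.
- by move=> i iN; rewrite rN ?mul0r// iN.
Qed.

Lemma plan_density_r_le1 x : (\sum_(j < N) r (c x) j) / cell_mass mu (c x) <= 1.
Proof.
have := cell_mass_ge0 mu (c x); rewrite le_eqVlt => /predU1P[<-|a0].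
  by rewrite invr0 mulr0.
by rewrite ler_pdivrMr// mul1r.
Qed.

Lemma plan_density_l_le1 y : (\sum_(i < N) r i (c y)) / cell_mass nu (c y) <= 1.
Proof.
have := cell_mass_ge0 nu (c y); rewrite le_eqVlt => /predU1P[<-|a0].
  by rewrite invr0 mulr0.
by rewrite ler_pdivrMr// mul1r.
Qed.

Lemma integral_plan_leftover_mu :
  (\int[mu]_x (1 - (\sum_(j < N) r (c x) j) / cell_mass mu (c x))%:E)%E =
  (fine (mu setT) - \sum_(i < N) \sum_(j < N) r i j)%:E.
Proof.
pose g i := (\sum_(j < N) r i j) / cell_mass mu i.
have mg : measurable_fun setT (fun x => g (c x)) by exact: (measurableT_comp _ mc).
have g0 i : 0 <= g i by rewrite divr_ge0 ?sumr_ge0// cell_mass_ge0.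
have I1 : (\int[mu]_x (g (c x))%:E)%E = (\sum_(i < N) \sum_(j < N) r i j)%:E.
  rewrite (integral_cell (g := g) (N := N))//; last first.
    by move=> i iN; rewrite /g big1 ?mul0r// => j _; rewrite rN// iN.
  congr (_%:E); apply: eq_bigr => i _; rewrite /g.
  have [ai|ai] := eqVneq (cell_mass mu i) 0; last by rewrite divfK.
  by rewrite ai mulr0 big1// => j _; exact: r_mu0.
apply/eqP; rewrite EFinB -I1 fineK ?ge0_fin_numE// eq_sym -/g.
rewrite sube_eq ?I1//; [|by rewrite ge0_fin_numE|by rewrite fin_num_adde_defl].
rewrite -I1 -ge0_integralD//.
- under eq_integral do rewrite -EFinD subrK.
  by rewrite integral_cst// mul1e.
- by move=> x _; rewrite lee_fin subr_ge0 plan_density_r_le1.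
- by apply/measurable_EFinP; exact: measurable_funB.
- by move=> x _; rewrite lee_fin.
- exact/measurable_EFinP.
Qed.

Lemma integral_plan_leftover_nu :
  (\int[nu]_y (1 - (\sum_(i < N) r i (c y)) / cell_mass nu (c y))%:E)%E =
  (fine (nu setT) - \sum_(i < N) \sum_(j < N) r i j)%:E.
Proof.
pose g j := (\sum_(i < N) r i j) / cell_mass nu j.
have mg : measurable_fun setT (fun x => g (c x)) by exact: (measurableT_comp _ mc).
have g0 j : 0 <= g j by rewrite divr_ge0 ?sumr_ge0// cell_mass_ge0.
have I1 : (\int[nu]_x (g (c x))%:E)%E = (\sum_(i < N) \sum_(j < N) r i j)%:E.
  rewrite exchange_big (integral_cell (g := g) (N := N))//; last first.
    by move=> j jN; rewrite /g big1 ?mul0r// => i _; rewrite rN// jN orbT.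
  congr (_%:E); apply: eq_bigr => j _; rewrite /g.
  have [bj|bj] := eqVneq (cell_mass nu j) 0; last by rewrite divfK.
  by rewrite bj mulr0 big1// => i _; exact: r_nu0.
apply/eqP; rewrite EFinB -I1 fineK ?ge0_fin_numE// eq_sym -/g.
rewrite sube_eq ?I1//; [|by rewrite ge0_fin_numE|by rewrite fin_num_adde_defl].
rewrite -I1 -ge0_integralD//.
- under eq_integral do rewrite -EFinD subrK.
  by rewrite integral_cst// mul1e.
- by move=> x _; rewrite lee_fin subr_ge0 plan_density_l_le1.
- by apply/measurable_EFinP; exact: measurable_funB.
- by move=> x _; rewrite lee_fin.
- exact/measurable_EFinP.
Qed.

Lemma integral_plan_cost (h : X -> X -> R) (H : nat -> nat -> R) :
  measurable_fun setT (fun xy : X * X => h xy.1 xy.2) ->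
  measurable_fun setT (fun x => \int[nu]_y (plan_density x y * h x y)%:E)%E ->
  (forall x y, 0 <= h x y <= H (c x) (c y)) -> (forall i j, 0 <= H i j) ->
  (\int[mu]_x \int[nu]_y (plan_density x y * h x y)%:E <=
   (\sum_(i < N) \sum_(j < N) r i j * H i j)%:E)%E.
Proof.
move=> mh mI hH H0.
pose g i := (\sum_(j < N) r i j * H i j) / cell_mass mu i.
have g0 i : 0 <= g i.
  by rewrite divr_ge0 ?cell_mass_ge0// sumr_ge0// => j _; rewrite mulr_ge0.
have inner x : (\int[nu]_y (plan_density x y * h x y)%:E <= (g (c x))%:E)%E.
  pose f j := r (c x) j * H (c x) j / (cell_mass mu (c x) * cell_mass nu j).
  have f0 j : 0 <= f j by rewrite divr_ge0 ?mulr_ge0// ?cell_mass_ge0.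
  have -> : (g (c x))%:E = (\int[nu]_y (f (c y))%:E)%E.
    rewrite (integral_cell (g := f) (N := N))//; last first.
      by move=> j jN; rewrite /f rN ?mul0r// jN orbT.
    congr (_%:E); rewrite /g mulr_suml; apply: eq_bigr => j _; rewrite /f.
    have [bj|bj] := eqVneq (cell_mass nu j) 0; first by rewrite (r_nu0 _ bj) !mul0r.
    have [ai|ai] := eqVneq (cell_mass mu (c x)) 0; first by rewrite (r_mu0 _ ai) !mul0r.
    by field; rewrite ai bj.
  apply: ge0_le_integral => //.
  - by move=> y _; rewrite lee_fin mulr_ge0 ?plan_density_ge0//; case/andP: (hH x y).
  - apply/measurable_EFinP; apply: measurable_funM.
      apply: (measurableT_comp (f := fun j => r (c x) j / (cell_mass mu (c x) * cell_mass nu j))) => //.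
    exact: (measurableT_comp mh (pair1_measurable x)).
  - by apply/measurable_EFinP; exact: (measurableT_comp (f := f)).
  - move=> y _; rewrite lee_fin /plan_density /f mulrAC.
    rewrite ler_wpM2r ?invr_ge0 ?mulr_ge0 ?cell_mass_ge0// ler_wpM2l//.
    by case/andP: (hH x y).
have -> : (\sum_(i < N) \sum_(j < N) r i j * H i j)%:E = (\int[mu]_x (g (c x))%:E)%E.
  rewrite (integral_cell (g := g) (N := N))//; last first.
    by move=> i iN; rewrite /g big1 ?mul0r// => j _; rewrite rN ?mul0r// iN.
  congr (_%:E); apply: eq_bigr => i _; rewrite /g.
  have [ai|ai] := eqVneq (cell_mass mu i) 0; last by rewrite divfK.
  by rewrite ai mulr0 big1// => j _; rewrite r_mu0// mul0r.
apply: ge0_le_integral => //.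
- by move=> x _; apply: integral_ge0 => y _; rewrite lee_fin mulr_ge0 ?plan_density_ge0//;
    case/andP: (hH x y).
- by apply/measurable_EFinP; exact: (measurableT_comp (f := g)).
Qed.

End plan.
End cells.

(** Clipping negative entries to 0 and completing by 0 makes every code a nonnegative matrix of
    finite support, so all elements of a countable type can be tried. *)
Definition rat_matrix (R : realType) (M : nat * seq (seq rat)) i j : R :=
  if (i < M.1)%N && (j < M.1)%N then Num.max 0 (ratr (nth 0 (nth [::] M.2 i) j)) else 0.

Lemma rat_matrix_ge0 (R : realType) M i j : 0 <= rat_matrix R M i j.
Proof. by rewrite /rat_matrix; case: ifP => // _; rewrite le_max lexx. Qed.

Lemma rat_matrix_out (R : realType) M i j :
  (M.1 <= i)%N || (M.1 <= j)%N -> rat_matrix R M i j = 0.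
Proof. by rewrite /rat_matrix => /orP[] h; rewrite (ltnNge _ M.1) ?(ltnNge j) h ?andbF. Qed.

(** The rounding goes downwards, so that the marginal constraints survive it. *)
Lemma rat_matrix_approx (R : realType) N (r : 'I_N -> 'I_N -> R) eta :
  0 < eta -> (forall i j, 0 <= r i j) ->
  exists M, M.1 = N /\ forall i j : 'I_N, r i j - eta <= rat_matrix R M i j <= r i j.
Proof.
move=> eta0 r0.
pose rn (ij : nat * nat) : R :=
  if insub ij.1 is Some i then (if insub ij.2 is Some j then r i j else 0) else 0.
have rn0 ij : 0 <= rn ij by rewrite /rn; case: insub => // i; case: insub.
have /choice[q hq] ij : exists q : rat, rn ij - eta <= Num.max 0 (ratr q) <= rn ij.
  have [|q] := @rat_in_itvoo R (rn ij - eta) (rn ij); first by rewrite gtrBl.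
  rewrite in_itv/= => /andP[q1 q2]; exists q.
  by rewrite le_max (ltW q1) orbT ge_max rn0 (ltW q2).
exists (N, mkseq (fun i => mkseq (fun j => q (i, j)) N) N); split=> // i j.
rewrite /rat_matrix/= !ltn_ord/= !nth_mkseq//.
by have := hq (val i, val j); rewrite /rn/= !valK.
Qed.

(** * Discretized Kantorovich duality and nearly optimal rational plans *)

Section transport.
Context {R : realType} {dX} {X : measurableType dX} (d : X -> X -> R).
Hypothesis dmet : is_metric d.
Hypothesis dborel : borel_for d.

Lemma lip1_bdd1_measurable f : lip1_bdd1 d f -> measurable_fun setT f.
Proof. by move=> [lf _]; exact: (measurable_lipschitz dborel lf). Qed.

Lemma integrable_bounded1 (mu : {measure set X -> \bar R}) (f : X -> R) :
  (mu setT < +oo)%E -> measurable_fun setT f -> (forall x, `|f x| <= 1) ->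
  mu.-integrable setT (EFin \o f).
Proof.
move=> mufin mf f1; apply/integrableP; split; first exact/measurable_EFinP.
apply: (@le_lt_trans _ _ (\int[mu]_x cst 1%E x)%E); last by rewrite integral_cst// mul1e.
apply: ge0_le_integral => //; last by move=> x _; rewrite lee_fin.
by apply: measurableT_comp => //; exact/measurable_EFinP.
Qed.

Lemma integral_1D (mu : {measure set X -> \bar R}) (f : X -> R) :
  (mu setT < +oo)%E -> measurable_fun setT f -> (forall x, `|f x| <= 1) ->
  (\int[mu]_x (1 + f x)%:E = (fine (mu setT))%:E + \int[mu]_x (f x)%:E)%E.
Proof.
move=> mufin mf f1; under eq_integral do rewrite EFinD.
rewrite integralD//.
- by rewrite integral_cst// mul1e fineK// ge0_fin_numE.
- by apply: (integrable_bounded1 (f := fun=> 1)) => // x; rewrite normr1.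
- exact: integrable_bounded1.
Qed.

Variables (u : nat -> X) (c : X -> nat) (delta : R).
Hypothesis mc : measurable_fun setT c.
Hypothesis hc : forall x, d x (u (c x)) < delta.

Lemma cell_mass_tail (mu : {measure set X -> \bar R}) tau : (mu setT < +oo)%E -> 0 < tau ->
  exists N0, forall N, (N0 <= N)%N ->
    fine (mu setT) - tau <= \sum_(i < N) cell_mass c mu i.
Proof.
move=> mufin tau0.
have E : \bigcup_i (c @^-1` [set i]) = setT.
  by apply/seteqP; split=> // x _; exists (c x).
have h : (fun n => \sum_(0 <= i < n) mu (c @^-1` [set i]))%E @ \oo --> mu setT.
  rewrite -E; apply: measure_semi_sigma_additive.
  - by move=> i; exact: measurable_cell.
  - apply/trivIsetP => i j _ _ ij; apply/seteqP; split=> // x [/= -> /eqP].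
    by rewrite (negbTE ij).
  - by rewrite E.
have muE : mu setT = (fine (mu setT))%:E by rewrite fineK// ge0_fin_numE.
have sumE : (fun n => \sum_(0 <= i < n) mu (c @^-1` [set i]))%E =
    (fun n => (\sum_(i < n) cell_mass c mu i)%:E).
  apply/funext => n; rewrite big_mkord -sumEFin; apply: eq_bigr => i _.
  exact: cell_massE.
rewrite sumE muE in h; have [N0 _ hN0] := (cvgrPdist_lt _ _).1 (fine_cvg h) _ tau0.
exists N0 => N /hN0 /=; rewrite ltr_norml.
by move=> /andP[_ hN]; lra.
Qed.

Section pair.
Variables (mu nu : {measure set X -> \bar R}) (W : R).
Hypothesis mufin : (mu setT < +oo)%E.
Hypothesis nufin : (nu setT < +oo)%E.
Hypothesis hW : (BLnorm d mu nu <= W%:E)%E.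

Let a := cell_mass c mu.
Let b := cell_mass c nu.

Let integral_ge_cells (m : {measure set X -> \bar R}) (f : X -> R) N :
  (m setT < +oo)%E -> measurable_fun setT f -> (forall x, 0 <= f x) ->
  (forall x, f (u (c x)) - delta <= f x) ->
  ((\sum_(i < N) (f (u i) - delta) * cell_mass c m i)%:E <= \int[m]_x (f x)%:E)%E.
Proof.
move=> mfin mf f0 fd.
pose g i := if (i < N)%N then Num.max 0 (f (u i) - delta) else 0.
have g0 i : 0 <= g i by rewrite /g; case: ifP => // _; rewrite le_max lexx.
apply: (@le_trans _ _ (\int[m]_x (g (c x))%:E)%E); last first.
  apply: ge0_le_integral => //.
  - by move=> x _; rewrite lee_fin.
  - by apply/measurable_EFinP; exact: (measurableT_comp (f := g)).
  - exact/measurable_EFinP.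
  - by move=> x _; rewrite lee_fin /g; case: ifP => // _; rewrite ge_max f0 fd.
rewrite (integral_cell mc (g := g) (N := N))//; last first.
  by move=> j Nj; rewrite /g ltnNge Nj.
rewrite lee_fin; apply: ler_sum => i _; rewrite ler_wpM2r ?cell_mass_ge0//.
by rewrite /g ltn_ord le_max lexx orbT.
Qed.

(** The lower bound by cells needs a nonnegative integrand: it is applied to 1 + f under [mu] and to
    1 - f under [nu]. The added constants produce the total masses on the right. *)
Let test_bound f N : lip1_bdd1 d f ->
  \sum_(i < N) f (u i) * a i - \sum_(i < N) f (u i) * b i <=
  W + fine (mu setT) + fine (nu setT) -
    (1 - delta) * (\sum_(i < N) a i + \sum_(i < N) b i).
Proof.
move=> hf; have mf := lip1_bdd1_measurable hf; have [lf f1] := hf.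
have f1' x : -1 <= f x <= 1 by rewrite -ler_norml.
have lfc x : `|f (u (c x)) - f x| <= delta.
  by apply: le_trans (lf _ _) _; rewrite (distC dmet) ltW.
have := integral_ge_cells (f := fun x => 1 + f x) N mufin.
have := integral_ge_cells (f := fun x => 1 - f x) N nufin.
have mNf : measurable_fun setT (fun x => - f x) by exact: measurableT_comp.
have EN : (\int[nu]_x (1 - f x)%:E = (fine (nu setT))%:E + \int[nu]_x (- f x)%:E)%E.
  by apply: (integral_1D nufin mNf) => x; rewrite normrN.
rewrite EN integral_1D//.
have -> : (\int[nu]_x (- f x)%:E = - \int[nu]_x (f x)%:E)%E.
  rewrite -integralN//; apply: integrable_add_def => //.
  exact: (integrable_bounded1 nufin mf f1).
have intf (m : {measure set X -> \bar R}) : (m setT < +oo)%E ->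
    (\int[m]_x (f x)%:E)%E = (fine (\int[m]_x (f x)%:E))%:E.
  move=> mfin; rewrite fineK//; apply: integrable_fin_num => //.
  exact: integrable_bounded1.
have : (\int[mu]_x (f x)%:E - \int[nu]_x (f x)%:E <= W%:E)%E.
  by apply: le_trans hW; apply: ereal_sup_ubound; exists f.
rewrite (intf mu)// (intf nu)//; set F := fine _; set G := fine _.
rewrite -!EFinN -!EFinD !lee_fin => FG hnu hmu.
have {}hnu : \sum_(i < N) (1 - f (u i) - delta) * b i <= fine (nu setT) - G.
  apply: hnu => [|x|x]; first exact: measurable_funB.
    by case/andP: (f1' x) => ? ?; lra.
  by have := lfc x; rewrite ler_norml => /andP[? ?]; lra.
have {}hmu : \sum_(i < N) (1 + f (u i) - delta) * a i <= fine (mu setT) + F.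
  apply: hmu => [|x|x]; first exact: measurable_funD.
    by case/andP: (f1' x) => ? ?; lra.
  by have := lfc x; rewrite ler_norml => /andP[? ?]; lra.
have E1 : \sum_(i < N) (1 + f (u i) - delta) * a i =
    \sum_(i < N) f (u i) * a i + (1 - delta) * \sum_(i < N) a i.
  by rewrite mulr_sumr -big_split/=; apply: eq_bigr => i _; ring.
have E2 : \sum_(i < N) (1 - f (u i) - delta) * b i =
    - (\sum_(i < N) f (u i) * b i) + (1 - delta) * \sum_(i < N) b i.
  by rewrite mulr_sumr -sumrN -big_split/=; apply: eq_bigr => i _; ring.
by rewrite E1 in hmu; rewrite E2 in hnu; rewrite mulrDr; lra.
Qed.

(* A dual pair (p, q) is dominated by the pair (f, -f) given by the c-transform of q. *)
Let dual_test N (p q : 'I_N -> R) :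
  (forall i, p i <= 1) -> (forall j, q j <= 1) ->
  (forall i j : 'I_N, p i + q j <= d (u i) (u j)) ->
  exists2 f, lip1_bdd1 d f &
    (forall i : 'I_N, p i <= f (u i)) /\ (forall j : 'I_N, f (u j) <= - q j).
Proof.
move=> p1 q1 pq.
pose f x := \big[Num.min/1]_(j < N) (d x (u j) - q j).
have f_le x (j : 'I_N) : f x <= d x (u j) - q j by exact: bigmin_le_cond.
have f_le1 x : f x <= 1 by exact: bigmin_le_id.
have f_ge x t : t <= 1 -> (forall j : 'I_N, t <= d x (u j) - q j) -> t <= f x.
  by move=> t1 tj; apply/bigmin_geP; split=> // j _; exact: tj.
exists f; last first.
  split=> [i|j]; first by apply: f_ge => // j; rewrite lerBrDr.
  by apply: le_trans (f_le _ j) _; rewrite distxx// sub0r.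
have lip x y : f x - d x y <= f y.
  apply: f_ge => [|j]; first by have := f_le1 x; have := dist_ge0 dmet x y; lra.
  by have := f_le x j; have := dist_triangle dmet x y (u j); lra.
split=> [x y|x]; rewrite ler_norml; apply/andP; split.
- by have := lip y x; rewrite (distC dmet y x); lra.
- by have := lip x y; lra.
- by apply: f_ge => [|j]; [lra|have := q1 j; have := dist_ge0 dmet x (u j); lra].
- exact: f_le1.
Qed.

(** The factor 2 - delta is the 1 - delta of [test_bound] plus the 1 charged by [transport_duality]
    for each unit of [a] and [b]. *)
Let real_plan N : exists r : 'I_N -> 'I_N -> R, [/\ forall i j, 0 <= r i j,
    forall i : 'I_N, \sum_j r i j <= a i,
    forall j : 'I_N, \sum_i r i j <= b j &
    \sum_i \sum_j r i j * (d (u i) (u j) - 2) <=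
    W + fine (mu setT) + fine (nu setT) -
      (2 - delta) * (\sum_(i < N) a i + \sum_(i < N) b i)].
Proof.
have [||p q p1 q1 pq|r [r0 ra rb rW]] := @transport_duality _ 'I_N
    (fun i j => d (u i) (u j)) a b
    (W + fine (mu setT) + fine (nu setT) -
      (1 - delta) * (\sum_(i < N) a i + \sum_(i < N) b i)).
- by move=> i; exact: cell_mass_ge0.
- by move=> i; exact: cell_mass_ge0.
- have [f hf [pf qf]] := dual_test p1 q1 pq.
  apply: le_trans (test_bound N hf); apply: lerD.
    by apply: ler_sum => i _; rewrite ler_wpM2r ?cell_mass_ge0.
  rewrite -sumrN; apply: ler_sum => i _; rewrite -mulNr ler_wpM2r ?cell_mass_ge0//.
  by rewrite lerNr.
- by exists r; split=> //; lra.
Qed.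

(** The slack s = e - delta * (total mass) is spent in two halves. Dropping the cells from N on
    loses mass at most s/4, at price 2 - delta; rounding N^2 entries by at most eta costs at most 2
    * eta * N^2, because 2 - d <= 2, and eta is chosen to make this at most s/2. *)
Lemma rational_plan_exists e : 0 <= delta <= 2 ->
  delta * (fine (mu setT) + fine (nu setT)) < e ->
  exists M, let r := rat_matrix R M in
    [/\ forall i, \sum_(j < M.1) r i j <= a i, forall j, \sum_(i < M.1) r i j <= b j &
    \sum_(i < M.1) \sum_(j < M.1) r i j * (d (u i) (u j) - 2) +
      fine (mu setT) + fine (nu setT) <= W + e].
Proof.
move=> /andP[delta0 delta2]; rewrite -subr_gt0; set s := _ - _ => s0.
have s80 : 0 < s / 8 by rewrite divr_gt0.
have [N1 hN1] := cell_mass_tail mufin s80.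
have [N2 hN2] := cell_mass_tail nufin s80.
pose N := maxn N1 N2.
have {}hN1 := hN1 N (leq_maxl _ _); have {}hN2 := hN2 N (leq_maxr _ _).
have [r [r0 ra rb rW]] := real_plan N.
pose eta := s / (4 * (N%:R ^+ 2 + 1)).
have den0 : 0 < N%:R ^+ 2 + 1 :> R by rewrite ltr_wpDl// exprn_ge0.
have eta0 : 0 < eta by rewrite divr_gt0// mulr_gt0.
have [M [MN hM]] := rat_matrix_approx eta0 r0.
have Mr (i j : 'I_N) : rat_matrix R M i j <= r i j by case/andP: (hM i j).
have rM (i j : 'I_N) : r i j - rat_matrix R M i j <= eta.
  by case/andP: (hM i j) => h _; lra.
exists M; rewrite MN; split=> [i|j|].
- have [iN|Ni] := ltnP i N; last first.
    by rewrite big1 ?cell_mass_ge0// => j _; rewrite rat_matrix_out// MN Ni.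
  apply: le_trans (ra (Ordinal iN)); apply: ler_sum => j _.
  exact: (Mr (Ordinal iN)).
- have [jN|Nj] := ltnP j N; last first.
    by rewrite big1 ?cell_mass_ge0// => i _; rewrite rat_matrix_out// MN Nj orbT.
  apply: le_trans (rb (Ordinal jN)); apply: ler_sum => i _.
  exact: (Mr i (Ordinal jN)).
have approx : \sum_(i < N) \sum_(j < N) rat_matrix R M i j * (d (u i) (u j) - 2) <=
    \sum_(i < N) \sum_(j < N) r i j * (d (u i) (u j) - 2) + s / 2.
  apply: (@le_trans _ _ (\sum_(i < N) \sum_(j < N) (r i j * (d (u i) (u j) - 2) + eta * 2))).
    apply: ler_sum => i _; apply: ler_sum => j _.
    have h1 := Mr i j; have h2 := rM i j; have h3 := dist_ge0 dmet (u i) (u j).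
    rewrite -lerBlDl -mulrBl -mulrNN opprB opprB.
    apply: le_trans (_ : (r i j - rat_matrix R M i j) * 2 <= _).
      by rewrite ler_wpM2l; lra.
    by rewrite ler_wpM2r.
  under eq_bigr do rewrite big_split/= sumr_const card_ord.
  rewrite big_split/= sumr_const card_ord lerD2l -mulrnA.
  rewrite -[leLHS]mulr_natr natrM -expr2.
  have -> : eta * 2 * N%:R ^+ 2 = (s / 2) * (N%:R ^+ 2 / (N%:R ^+ 2 + 1)).
    by rewrite /eta; field; rewrite gt_eqF.
  rewrite ler_piMr ?divr_ge0 ?(ltW s0)// ler_pdivrMr// mul1r.
  by rewrite lerDl.
have sE : s = e - delta * (fine (mu setT) + fine (nu setT)) by [].
have h : (2 - delta) * (fine (mu setT) + fine (nu setT) - s / 4) <=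
    (2 - delta) * (\sum_(i < N) a i + \sum_(i < N) b i).
  by rewrite ler_wpM2l; rewrite ?subr_ge0//; lra.
have h2 : (2 - delta) * (s / 4) <= 2 * (s / 4).
  by rewrite ler_wpM2r ?divr_ge0 ?(ltW s0)//; lra.
have h3 : (2 - delta) * (fine (mu setT) + fine (nu setT) - s / 4) =
  2 * (fine (mu setT) + fine (nu setT)) - delta * (fine (mu setT) + fine (nu setT)) -
  (2 - delta) * (s / 4) by ring.
lra.
Qed.

End pair.
End transport.

Lemma measurable_fun_divr {R : realType} d (X : measurableType d) (f g : X -> R) :
  measurable_fun setT f -> measurable_fun setT g -> (forall x, 0 <= g x) ->
  measurable_fun setT (fun x => f x / g x).
Proof.
move=> mf mg g0; apply: measurable_funM => //.
rewrite (_ : (fun x => _) = (fun x => (g x) `^ (- 1))); last first.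
  by apply/funext => x; rewrite powR_inv1.
exact: (measurableT_comp (measurable_powR _)).
Qed.

Section coupling_density.
Context {R : realType} {dX} {X : measurableType dX} (d : X -> X -> R).
Hypothesis dmet : is_metric d.
Hypothesis dborel : borel_for d.
Hypothesis dsep : dist_separable d.
Variables (Q Qb : R.-ker X ~> X).
Hypothesis Qfin : forall y, (Q y setT < +oo)%E.
Hypothesis Qbfin : forall y, (Qb y setT < +oo)%E.
Variables (W : X * X -> R) (G : set (X * X)) (mass e : R).
Hypothesis mW : measurable_fun setT W.
Hypothesis e0 : 0 < e.
Hypothesis mass0 : 0 <= mass.
Hypothesis hW : forall p, G p -> (BLnorm d (Q p.1) (Qb p.2) <= (W p)%:E)%E.
Hypothesis hmass : forall p, G p ->
  fine (Q p.1 setT) + fine (Qb p.2 setT) <= mass.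

(** The cell radius satisfies delta * mass <= e/2. The error e is then paid twice: for the
    near-optimality of a rational plan between cell centres, and for the passage from the centres
    back to the points, which adds 2 * delta per unit of mass. The 1 in [mass + 1] keeps the
    denominator positive. *)
Let delta := Num.min 1 (e / (2 * (mass + 1))).

Let delta0 : 0 < delta.
Proof. by rewrite lt_min ltr01 divr_gt0// mulr_gt0// ltr_wpDl. Qed.

Let delta_le1 : delta <= 1.
Proof. by rewrite ge_min lexx. Qed.

Let delta_mass : delta * mass <= e / 2.
Proof.
apply: (@le_trans _ _ (e / (2 * (mass + 1)) * mass)).
  by rewrite ler_wpM2r// ge_min lexx orbT.
have m1 : 0 < mass + 1 by rewrite ltr_wpDl.
rewrite (_ : _ * mass = (e / 2) * (mass / (mass + 1))); last by field; rewrite gt_eqF.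
by rewrite ler_piMr ?divr_ge0 ?(ltW e0)// ler_pdivrMr// mul1r lerDl.
Qed.

(** For a fixed code, being an almost optimal plan at p is a measurable condition on p, and [sel]
    picks the first such code; on [G] there is one by duality. Given the code and the cells, the
    density is a quotient of measurable functions of p. *)
Lemma coupling_density_exists : exists rho : (X * X) * (X * X) -> R,
  [/\ measurable_fun setT rho, forall pq, 0 <= rho pq,
      forall p y, (\int[Qb p.2]_z (rho (p, (y, z)))%:E <= 1)%E,
      forall p z, (\int[Q p.1]_y (rho (p, (y, z)))%:E <= 1)%E &
      forall p, G p ->
        (\int[Q p.1]_y \int[Qb p.2]_z (rho (p, (y, z)) * d y z)%:E +
         \int[Q p.1]_y (1 - fine (\int[Qb p.2]_z (rho (p, (y, z)))%:E))%:E +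
         \int[Qb p.2]_z (1 - fine (\int[Q p.1]_y (rho (p, (y, z)))%:E))%:E
         <= (W p + 2 * e)%:E)%E].
Proof.
have [u udense] := dsep.
pose c x := first_index (fun k => d x (u k) < delta).
have mc : measurable_fun setT c.
  apply: (measurable_first_index (P := fun k x => d x (u k) < delta)) => k.
  by apply: measurable_fun_ltr => //; exact: measurable_distr.
have hc x : d x (u (c x)) < delta.
  exact: (first_indexP (P := fun k => d x (u k) < delta) (udense x _ delta0)).
pose M k : nat * seq (seq rat) := odflt (0%N, [::]) (choice.unpickle k).
pose r k := rat_matrix R (M k).
pose a i y := cell_mass c (Q y) i.
pose b i y := cell_mass c (Qb y) i.
have ma i : measurable_fun setT (a i).
  apply: (measurableT_comp (fine_measurable measurableT)).
  exact: measurable_kernel (measurable_cell mc i).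
have mb i : measurable_fun setT (b i).
  apply: (measurableT_comp (fine_measurable measurableT)).
  exact: measurable_kernel (measurable_cell mc i).
pose valid k (p : X * X) := [&& [forall i : 'I_(M k).1, \sum_(j < (M k).1) r k i j <= a i p.1],
  [forall j : 'I_(M k).1, \sum_(i < (M k).1) r k i j <= b j p.2] &
  \sum_(i < (M k).1) \sum_(j < (M k).1) r k i j * (d (u i) (u j) - 2) +
    fine (Q p.1 setT) + fine (Qb p.2 setT) <= W p + e].
have mforall N (f : 'I_N -> X * X -> bool) : (forall i, measurable_fun setT (f i)) ->
    measurable_fun setT (fun p => [forall i, f i p]).
  move=> mf; apply: (measurable_fun_bool true).
  rewrite setTI (_ : _ @^-1` _ = \bigcap_(i in [set: 'I_N]) [set p | f i p]).
    apply: fin_bigcap_measurable => // i _.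
    by have := mf i measurableT [set true]; rewrite setTI; exact.
  apply/seteqP; split=> [p /= /forallP h i _|p h]; first exact: h.
  by apply/forallP => i; exact: (h i Logic.I).
have mvalid k : measurable_fun setT (valid k).
  apply: measurable_and.
    apply: mforall => i; apply: measurable_fun_ler => //.
    exact: (measurableT_comp (ma i)).
  apply: measurable_and.
    apply: mforall => i; apply: measurable_fun_ler => //.
    exact: (measurableT_comp (mb i)).
  apply: measurable_fun_ler; last exact: measurable_funD.
  apply: measurable_funD; first apply: measurable_funD => //.
    apply: (measurableT_comp (fine_measurable measurableT)).
    exact: (measurableT_comp (measurable_kernel Q _ measurableT)).
  apply: (measurableT_comp (fine_measurable measurableT)).
  exact: (measurableT_comp (measurable_kernel Qb _ measurableT)).
pose sel p := first_index (valid^~ p).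
have msel : measurable_fun setT sel by exact: measurable_first_index.
(* Outside [G] no code may be valid and [sel] returns its default; the zero plan is then used, so
   the marginal bounds hold for every p. *)
pose rr k p i j := if valid k p then r k i j else 0.
have rr0 k p i j : 0 <= rr k p i j.
  by rewrite /rr; case: ifP => // _; exact: rat_matrix_ge0.
have rrN k p i j : ((M k).1 <= i)%N || ((M k).1 <= j)%N -> rr k p i j = 0.
  by move=> h; rewrite /rr; case: ifP => // _; exact: rat_matrix_out.
have rrQ k p i : \sum_(j < (M k).1) rr k p i j <= a i p.1.
  rewrite /rr; case: (boolP (valid k p)) => [/and3P[/forallP h _ _]|_]; last first.
    by rewrite big1// cell_mass_ge0.
  have [iN|Ni] := ltnP i (M k).1; first exact: (h (Ordinal iN)).
  by rewrite big1 ?cell_mass_ge0// => j _; rewrite /r rat_matrix_out// Ni.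
have rrQb k p j : \sum_(i < (M k).1) rr k p i j <= b j p.2.
  rewrite /rr; case: (boolP (valid k p)) => [/and3P[_ /forallP h _]|_]; last first.
    by rewrite big1// cell_mass_ge0.
  have [jN|Nj] := ltnP j (M k).1; first exact: (h (Ordinal jN)).
  by rewrite big1 ?cell_mass_ge0// => i _; rewrite /r rat_matrix_out// Nj orbT.
pose rho (pq : (X * X) * (X * X)) :=
  plan_density c (Q pq.1.1) (Qb pq.1.2) (rr (sel pq.1) pq.1) pq.2.1 pq.2.2.
have mrho : measurable_fun setT rho.
  have mfix k i j : measurable_fun setT (fun pq : (X * X) * (X * X) =>
      rr k pq.1 i j / (a i pq.1.1 * b j pq.1.2)).
    apply: measurable_fun_divr.
    - apply: measurable_fun_ifT => //; exact: (measurableT_comp (mvalid k)).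
    - apply: measurable_funM.
        apply: (measurableT_comp (ma i)); exact: measurableT_comp.
      apply: (measurableT_comp (mb j)); exact: measurableT_comp.
    - by move=> pq; rewrite mulr_ge0 ?cell_mass_ge0.
  apply: (measurable_fun_nat_case (g := fun pq : (X * X) * (X * X) => sel pq.1)
    (f := fun k (pq : (X * X) * (X * X)) => rr k pq.1 (c pq.2.1) (c pq.2.2) /
       (a (c pq.2.1) pq.1.1 * b (c pq.2.2) pq.1.2))).
    exact: (measurableT_comp msel).
  move=> k.
  apply: (measurable_fun_nat_case (g := fun pq : (X * X) * (X * X) => c pq.2.1)
    (f := fun i (pq : (X * X) * (X * X)) => rr k pq.1 i (c pq.2.2) /
       (a i pq.1.1 * b (c pq.2.2) pq.1.2))).
    by apply: (measurableT_comp mc); exact: measurableT_comp.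
  move=> i.
  apply: (measurable_fun_nat_case (g := fun pq : (X * X) * (X * X) => c pq.2.2)
    (f := fun j (pq : (X * X) * (X * X)) => rr k pq.1 i j /
       (a i pq.1.1 * b j pq.1.2))) => //.
  by apply: (measurableT_comp mc); exact: measurableT_comp.
have rho_r p y : (\int[Qb p.2]_z (rho (p, (y, z)))%:E)%E =
   ((\sum_(j < (M (sel p)).1) rr (sel p) p (c y) j) / a (c y) p.1)%:E.
  rewrite /rho/=.
  exact: (integral_plan_density_r mc (Qbfin _) (rr0 _ _) (@rrN _ _) (@rrQ _ _) (@rrQb _ _)).
have rho_l p z : (\int[Q p.1]_y (rho (p, (y, z)))%:E)%E =
   ((\sum_(i < (M (sel p)).1) rr (sel p) p i (c z)) / b (c z) p.2)%:E.
  rewrite /rho/=.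
  exact: (integral_plan_density_l mc (Qfin _) (rr0 _ _) (@rrN _ _) (@rrQ _ _) (@rrQb _ _)).
have rho0 pq : 0 <= rho pq by apply: plan_density_ge0; exact: rr0.
exists rho; split=> //.
- by move=> p y; rewrite rho_r lee_fin; exact: plan_density_r_le1.
- by move=> p z; rewrite rho_l lee_fin; exact: plan_density_l_le1.
move=> p Gp.
have validp : valid (sel p) p.
  apply: (first_indexP (P := valid^~ p)).
  have [||M0 /= [M1 M2 M3]] := @rational_plan_exists _ _ _ _ dmet dborel u c delta mc hc
    (Q p.1) (Qb p.2) (W p) (Qfin _) (Qbfin _) (hW Gp) e.
  - by rewrite (ltW delta0) (le_trans delta_le1)// ler1n.
  - apply: (@le_lt_trans _ _ (delta * mass)).
      by rewrite ler_wpM2l ?(ltW delta0)// hmass.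
    by apply: le_lt_trans delta_mass _; rewrite ltr_pdivrMr// ltr_pMr// ltr1n.
  exists (choice.pickle M0); rewrite /valid /r /M choice.pickleK/=.
  by rewrite M3 andbT; apply/andP; split; apply/forallP => i; [exact: M1|exact: M2].
have rrE i j : rr (sel p) p i j = r (sel p) i j by rewrite /rr validp.
set N := (M (sel p)).1.
have cost : (\int[Q p.1]_y \int[Qb p.2]_z (rho (p, (y, z)) * d y z)%:E <=
    (\sum_(i < N) \sum_(j < N) rr (sel p) p i j * (d (u i) (u j) + 2 * delta))%:E)%E.
  rewrite /rho/=.
  apply: (integral_plan_cost mc (Qfin _) (Qbfin _) (rr0 _ _) (@rrN _ _) (@rrQ _ _) (@rrQb _ _)
    (h := d) (H := fun i j => d (u i) (u j) + 2 * delta)).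
  - exact: measurable_dist.
  - have hk := kop_integral Qbfin.
    have nn : nnmeas (fun q : X * X => (rho (p, (q.1, q.2)) * d q.1 q.2)%:E).
      apply: nnmeas_EFin => [|q]; last by rewrite mulr_ge0 ?(dist_ge0 dmet).
      apply: measurable_funM; last exact: measurable_dist.
      apply: (measurableT_comp mrho (g := fun q : X * X => (p, (q.1, q.2)))).
      by apply: measurable_fun_pair => //; exact: measurable_fun_pair.
    have := kop_nnmeas_param hk nn => -[+ _].
    by move=> /measurableT_comp /(_ (pair2_measurable p.2)).
  - move=> y z; rewrite dist_ge0//=.
    have := dist_triangle dmet y (u (c y)) z.
    have := dist_triangle dmet (u (c y)) (u (c z)) z.
    by have := hc y; have := hc z; rewrite (distC dmet z); lra.
  - by move=> i j; apply: addr_ge0; [exact: (dist_ge0 dmet)|apply: mulr_ge0 => //; exact: ltW].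
have I2 : (\int[Q p.1]_y (1 - fine (\int[Qb p.2]_z (rho (p, (y, z)))%:E))%:E)%E =
    (fine (Q p.1 setT) - \sum_(i < N) \sum_(j < N) rr (sel p) p i j)%:E.
  under eq_integral do rewrite rho_r.
  exact: (integral_plan_leftover_mu mc (Qfin _) (rr0 _ _) (@rrN _ _) (@rrQ _ _)).
have I3 : (\int[Qb p.2]_z (1 - fine (\int[Q p.1]_y (rho (p, (y, z)))%:E))%:E)%E =
    (fine (Qb p.2 setT) - \sum_(i < N) \sum_(j < N) rr (sel p) p i j)%:E.
  under eq_integral do rewrite rho_l.
  exact: (integral_plan_leftover_nu mc (Qbfin _) (rr0 _ _) (@rrN _ _) (@rrQb _ _)).
rewrite I2 I3.
apply: le_trans (leeD (leeD cost (lexx _)) (lexx _)) _.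
rewrite -!EFinD lee_fin.
have /and3P[_ _ hv] := validp; rewrite -/N in hv.
have E : \sum_(i < N) \sum_(j < N) rr (sel p) p i j * (d (u i) (u j) + 2 * delta) =
   \sum_(i < N) \sum_(j < N) r (sel p) i j * (d (u i) (u j) - 2) +
   (2 + 2 * delta) * \sum_(i < N) \sum_(j < N) rr (sel p) p i j.
  rewrite mulr_sumr -big_split/=; apply: eq_bigr => i _.
  rewrite mulr_sumr -big_split/=; apply: eq_bigr => j _.
  by rewrite rrE; ring.
rewrite E.
have rsum : \sum_(i < N) \sum_(j < N) rr (sel p) p i j <= mass.
  have : 0 <= fine (Q p.1 setT) - \sum_(i < N) \sum_(j < N) rr (sel p) p i j.
    rewrite -lee_fin -I2; apply: integral_ge0 => y _.
    by rewrite lee_fin subr_ge0 rho_r/=; exact: plan_density_r_le1.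
  have := hmass Gp; have : 0 <= fine (Qb p.2 setT) by rewrite fine_ge0.
  lra.
have : delta * \sum_(i < N) \sum_(j < N) rr (sel p) p i j <= e / 2.
  by apply: le_trans delta_mass; rewrite ler_wpM2l// ltW.
lra.
Qed.

End coupling_density.

(** * Bounded Lipschitz distance of point configurations *)

Section seq_measure.
Context {R : realType} {dX} {X : measurableType dX}.

Definition seq_measure (s : seq X) : {measure set X -> \bar R} :=
  foldr (fun x (m : {measure set X -> \bar R}) => measure_add \d_x m) mzero s.

Lemma seq_measureE s A : seq_measure s A = (\sum_(x <- s) \d_x A)%E.
Proof.
elim: s => [|x s ih]; first by rewrite big_nil.
by rewrite big_cons -ih; exact: measure_addE.
Qed.

Lemma ge0_integral_seq_measure s (f : X -> \bar R) : nnmeas f ->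
  (\int[seq_measure s]_x f x = \sum_(x <- s) f x)%E.
Proof.
move=> [mf f0]; elim: s => [|x s ih]; first by rewrite big_nil integral_measure_zero.
transitivity (\int[measure_add \d_x (seq_measure s)]_y f y)%E => //.
rewrite big_cons -ih ge0_integral_measure_add//; congr (_ + _)%E.
by rewrite integral_dirac// diracT mul1e.
Qed.

Lemma integral_seq_measure s (f : X -> R) : measurable_fun setT f ->
  (\int[seq_measure s]_x (f x)%:E = (\sum_(x <- s) f x)%:E)%E.
Proof.
move=> mf; have mfE : measurable_fun setT (EFin \o f) by exact/measurable_EFinP.
rewrite integralE !ge0_integral_seq_measure; last 2 first.
- by split; [exact: measurable_funeneg|].
- by split; [exact: measurable_funepos|].
have -> : (\sum_(x <- s) (EFin \o f)^\+ x = (\sum_(x <- s) Num.max (f x) 0)%:E)%E.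
  by rewrite -sumEFin; apply: eq_bigr => x _; rewrite funeposE/= EFin_max.
have -> : (\sum_(x <- s) (EFin \o f)^\- x = (\sum_(x <- s) Num.max (- f x) 0)%:E)%E.
  by rewrite -sumEFin; apply: eq_bigr => x _; rewrite funenegE/= EFin_max.
rewrite -EFinB -sumrB; congr (_%:E); apply: eq_bigr => x _.
by case: (leP (f x) 0) => h; case: (leP (- f x) 0) => h'; lra.
Qed.

End seq_measure.

Section bounded_lipschitz.
Context {R : realType} {dX} {X : measurableType dX} (d : X -> X -> R).
Hypothesis dmet : is_metric d.
Hypothesis dborel : borel_for d.
Variable u : nat -> X.
Hypothesis udense : forall x e, 0 < e -> exists k, d x (u k) < e.

(** A countable family of test functions: minima of cones centred at the dense sequence with
    rational heights, truncated to [-1, 1]. It turns [BLnorm] of configurations into a countable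
    supremum, hence a measurable function. *)
Definition rat_lip (q : seq rat) (x : X) : R :=
  Num.max (-1) (\big[Num.min/1]_(j < size q) (d x (u j) + ratr (nth 0 q j))).

Lemma rat_lip_lip1_bdd1 q : lip1_bdd1 d (rat_lip q).
Proof.
pose f x := \big[Num.min/1]_(j < size q) (d x (u j) + ratr (nth 0 q j)).
have f_le x (j : 'I_(size q)) : f x <= d x (u j) + ratr (nth 0 q j) by exact: bigmin_le_cond.
have f_le1 x : f x <= 1 by exact: bigmin_le_id.
have lip x y : f x - d x y <= f y.
  apply/bigmin_geP; split=> [|j _]; first by have := f_le1 x; have := dist_ge0 dmet x y; lra.
  by have := f_le x j; have := dist_triangle dmet x y (u j); lra.
have lipm x y : rat_lip q x - d x y <= rat_lip q y.
  rewrite lerBlDr /rat_lip -/(f x) -/(f y) ge_max; apply/andP; split.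
    by rewrite (@le_trans _ _ (Num.max (-1) (f y)))// ?le_max ?lexx// lerDl (dist_ge0 dmet).
  by rewrite -lerBlDr (le_trans (lip x y))// le_max lexx orbT.
split=> [x y|x]; rewrite ler_norml; apply/andP; split.
- by have := lipm y x; rewrite (distC dmet y x); lra.
- by have := lipm x y; lra.
- by rewrite le_max lexx.
- by rewrite ge_max f_le1 andbT; lra.
Qed.

(** McShane's formula: [f] is the infimum of the cones d(x, u j) + f(u j). Rounding the heights
    upwards keeps the minimum above [f]; at a point of [s] it is within e of f, a third for the
    rounding and two thirds for using a nearby centre. *)
Lemma rat_lip_dense f (s : seq X) e : lip1_bdd1 d f -> 0 < e ->
  exists q, forall x, x \in s -> `|rat_lip q x - f x| <= e.
Proof.
move=> [lf f1] e0; have e3 : 0 < e / 3 by rewrite divr_gt0.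
have /choice[k hk] x : exists k, d x (u k) < e / 3 by exact: udense.
have /choice[r hr] j : exists r : rat, f (u j) <= ratr r <= f (u j) + e / 3.
  have [|r] := @rat_in_itvoo R (f (u j)) (f (u j) + e / 3); first by rewrite ltrDl.
  by rewrite in_itv/= => /andP[h1 h2]; exists r; rewrite (ltW h1) (ltW h2).
pose N := (\max_(x <- s) (k x)).+1.
exists (mkseq r N) => x xs; have kN : (k x < N)%N by rewrite ltnS leq_bigmax_seq.
have lfx y z : f y - f z <= d y z.
  by have := lf y z; rewrite ler_norml => /andP[].
have /andP[fN1 f11] : -1 <= f x <= 1 by rewrite -ler_norml.
rewrite /rat_lip size_mkseq ler_norml; apply/andP; split.
  rewrite lerBrDl (@le_trans _ _ (f x))//; first by lra.
  rewrite le_max; apply/orP; right; apply/bigmin_geP; split=> // j _.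
  by rewrite nth_mkseq//; have := lfx x (u j); case/andP: (hr j); lra.
rewrite lerBlDr ge_max; apply/andP; split; first by lra.
apply: le_trans (bigmin_le_cond _ _ (j := Ordinal kN) isT) _; rewrite /= nth_mkseq//.
have := hk x; case/andP: (hr (k x)); have := lfx (u (k x)) x; rewrite (distC dmet (u _)).
by lra.
Qed.

(** A test function matters only through its values at the points of [s] and [t], so approximation
    on finite sets is enough. *)
Lemma BLnorm_seq_measure (s t : seq X) :
  BLnorm d (seq_measure s) (seq_measure t) =
  ereal_sup [set (\sum_(x <- s) rat_lip q x - \sum_(x <- t) rat_lip q x)%:E | q in setT].
Proof.
have intE f : lip1_bdd1 d f ->
    (\int[seq_measure s]_y (f y)%:E - \int[seq_measure t]_y (f y)%:E)%E =
    (\sum_(x <- s) f x - \sum_(x <- t) f x)%:E.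
  by move=> hf; have mf := lip1_bdd1_measurable dborel hf; rewrite !integral_seq_measure.
apply/eqP; rewrite eq_le; apply/andP; split.
  apply: ge_ereal_sup => _ [f /= hf <-]; rewrite intE//.
  apply/lee_addgt0Pr => e e0.
  pose e' := e / (size (s ++ t)).+1%:R.
  have e'0 : 0 < e' by rewrite divr_gt0.
  have sum_e' (r : seq X) : \sum_(x <- r) e' = e' *+ size r.
    by rewrite big_const_seq count_predT iter_addr_0.
  have [q hq] := rat_lip_dense (s ++ t) hf e'0.
  apply: (@le_trans _ _ ((\sum_(x <- s) rat_lip q x - \sum_(x <- t) rat_lip q x)%:E + e%:E)%E).
    have hs : \sum_(x <- s) f x <= \sum_(x <- s) rat_lip q x + e' *+ size s.
      rewrite -sum_e' -big_split/= !big_seq; apply: ler_sum => x xs.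
      have := hq x; rewrite mem_cat xs/= => /(_ isT); rewrite ler_norml => /andP[? _]; lra.
    have ht : \sum_(x <- t) rat_lip q x <= \sum_(x <- t) f x + e' *+ size t.
      rewrite -sum_e' -big_split/= !big_seq; apply: ler_sum => x xt.
      have := hq x; rewrite mem_cat xt orbT/= => /(_ isT); rewrite ler_norml => /andP[_ ?]; lra.
    have : e' *+ size s + e' *+ size t <= e.
      rewrite -mulrnDr -size_cat -mulr_natr /e' mulrAC ler_pdivrMr//.
      by rewrite ler_wpM2l ?(ltW e0)// ler_nat.
    by rewrite -EFinD lee_fin; lra.
  by apply: leeD => //; apply: ereal_sup_ubound; exists q.
apply: ge_ereal_sup => _ [q _ <-]; rewrite -intE; last exact: rat_lip_lip1_bdd1.
by apply: ereal_sup_ubound; exists (rat_lip q) => //; exact: rat_lip_lip1_bdd1.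
Qed.

End bounded_lipschitz.

Local Open Scope ereal_scope.

(** * Coupled offspring *)

Lemma ifun_le {R : realType} d (Y : measurableType d) (L : (Y -> \bar R) -> \bar R)
    (f g : Y -> R) : integral_functional L ->
  measurable_fun setT f -> measurable_fun setT g ->
  (forall y, (0 <= f y <= g y)%R) -> L (EFin \o f) <= L (EFin \o g).
Proof.
move=> hL mf mg fg.
have nnf : nnmeas (EFin \o f).
  by apply: nnmeas_EFin => // y; case/andP: (fg y).
have nngf : nnmeas (fun y => (g y - f y)%:E).
  by apply: nnmeas_EFin => [|y]; [exact: measurable_funB|case/andP: (fg y); rewrite subr_ge0].
have -> : EFin \o g = (fun y => (EFin \o f) y + (g y - f y)%:E).
  by apply/funext => y; rewrite /= -EFinD addrC subrK.
by rewrite (ifunD hL)// leeDl//; apply: (ifun_ge0 hL); exact: nngf.2.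
Qed.

(** Carries the finiteness of [m] in its type, so that Fubini-Tonelli applies to the values of a
    kernel. *)
Definition finite_measure_copy {R : realType} d (T : measurableType d)
  (m : {measure set T -> \bar R}) of m setT < +oo : set T -> \bar R := m.

Section finite_measure_copy_instance.
Context {R : realType} d (T : measurableType d) (m : {measure set T -> \bar R}).
Hypothesis mfin : m setT < +oo.

HB.instance Definition _ := Measure.copy (finite_measure_copy mfin) m.

Let finite_measure_copy_fin : fin_num_fun (finite_measure_copy mfin).
Proof. exact: lty_fin_num_fun. Qed.

HB.instance Definition _ := Measure_isFinite.Build _ _ _ (finite_measure_copy mfin)
  finite_measure_copy_fin.

End finite_measure_copy_instance.

Lemma finite_fubini_tonelli {R : realType} d d' (X : measurableType d) (Y : measurableType d')
    (mu : {measure set X -> \bar R}) (nu : {measure set Y -> \bar R}) (f : X * Y -> \bar R) :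
  mu setT < +oo -> nu setT < +oo -> nnmeas f ->
  \int[mu]_x \int[nu]_y f (x, y) = \int[nu]_y \int[mu]_x f (x, y).
Proof.
move=> mufin nufin [mf f0].
exact: (@fubini_tonelli _ _ _ _ _ (finite_measure_copy mufin) (finite_measure_copy nufin) f).
Qed.

Section coupled_operator.
Context {R : realType} {dX} {X : measurableType dX}.
Variables (Q Qb : R.-ker X ~> X).
Hypothesis Qfin : forall y, Q y setT < +oo.
Hypothesis Qbfin : forall y, Qb y setT < +oo.
Variable rho : (X * X) * (X * X) -> R.
Hypothesis mrho : measurable_fun setT rho.
Hypothesis rho0 : forall pq, (0 <= rho pq)%R.
Hypothesis rho_r : forall p y, \int[Qb p.2]_z (rho (p, (y, z)))%:E <= 1.
Hypothesis rho_l : forall p z, \int[Q p.1]_y (rho (p, (y, z)))%:E <= 1.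

(* A particle: its positions in the first and in the second process, and two
   flags telling in which of the two processes it is present; the position in
   a process from which the particle is absent is irrelevant. *)
Local Notation Z := ((X * X) * (bool * bool))%type.

Let s1 (q : (X * X) * X) : R := fine (\int[Qb q.1.2]_z (rho (q.1, (q.2, z)))%:E).
Let s2 (q : (X * X) * X) : R := fine (\int[Q q.1.1]_y (rho (q.1, (y, q.2)))%:E).

Let s1E p y : \int[Qb p.2]_z (rho (p, (y, z)))%:E = (s1 (p, y))%:E.
Proof.
rewrite fineK// ge0_fin_numE; first exact: le_lt_trans (rho_r p y) (ltry _).
by apply: integral_ge0 => z _; rewrite lee_fin.
Qed.

Let s2E p z : \int[Q p.1]_y (rho (p, (y, z)))%:E = (s2 (p, z))%:E.
Proof.
rewrite fineK// ge0_fin_numE; first exact: le_lt_trans (rho_l p z) (ltry _).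
by apply: integral_ge0 => y _; rewrite lee_fin.
Qed.

Let s1_01 q : (0 <= s1 q <= 1)%R.
Proof.
case: q => p y; rewrite -!lee_fin -s1E rho_r andbT.
by apply: integral_ge0 => z _; rewrite lee_fin.
Qed.

Let s2_01 q : (0 <= s2 q <= 1)%R.
Proof.
case: q => p y; rewrite -!lee_fin -s2E rho_l andbT.
by apply: integral_ge0 => z _; rewrite lee_fin.
Qed.

(** Densities of the three kinds of offspring. A pair has common offspring with density rho and lone
    offspring with the remaining fractions 1 - s1 and 1 - s2. A lone particle has no common
    offspring and reproduces with the full kernel of its own process. *)
Let w1 (q : (Z * X) * X) : R :=
  ((q.1.1.2.1 && q.1.1.2.2)%:R * rho (q.1.1.1, (q.1.2, q.2)))%R.
Let w2 (q : Z * X) : R := (q.1.2.1%:R * (1 - q.1.2.2%:R * s1 (q.1.1, q.2)))%R.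
Let w3 (q : Z * X) : R := (q.1.2.2%:R * (1 - q.1.2.1%:R * s2 (q.1.1, q.2)))%R.

Definition coupled_op (z : Z) (f : Z -> \bar R) : \bar R :=
  \int[Q z.1.1]_y \int[Qb z.1.2]_y' ((w1 ((z, y), y'))%:E * f ((y, y'), (true, true))) +
  \int[Q z.1.1]_y ((w2 (z, y))%:E * f ((y, y), (true, false))) +
  \int[Qb z.1.2]_y' ((w3 (z, y'))%:E * f ((y', y'), (false, true))).

Let ms1 : measurable_fun setT s1.
Proof.
apply: (measurableT_comp (fine_measurable measurableT)).
have hk : kernel_operator (fun (q : (X * X) * X) f => \int[Qb q.1.2]_y f y).
  apply: (kop_map (kop_integral Qbfin) (g := fun q : (X * X) * X => q.1.2)).
  exact: measurableT_comp.
apply: (kop_nnmeas_diag hk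
  (f := fun q : ((X * X) * X) * X => (rho (q.1.1, (q.1.2, q.2)))%:E) _).1.
apply: nnmeas_EFin => //; apply: (measurableT_comp mrho
  (g := fun q : ((X * X) * X) * X => (q.1.1, (q.1.2, q.2)))).
apply: measurable_fun_pair; first exact: measurableT_comp.
by apply: measurable_fun_pair => //; exact: measurableT_comp.
Qed.

Let ms2 : measurable_fun setT s2.
Proof.
apply: (measurableT_comp (fine_measurable measurableT)).
have hk : kernel_operator (fun (q : (X * X) * X) f => \int[Q q.1.1]_y f y).
  apply: (kop_map (kop_integral Qfin) (g := fun q : (X * X) * X => q.1.1)).
  exact: measurableT_comp.
apply: (kop_nnmeas_diag hk
  (f := fun q : ((X * X) * X) * X => (rho (q.1.1, (q.2, q.1.2)))%:E) _).1.
apply: nnmeas_EFin => //; apply: (measurableT_comp mrho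
  (g := fun q : ((X * X) * X) * X => (q.1.1, (q.2, q.1.2)))).
apply: measurable_fun_pair; first exact: measurableT_comp.
by apply: measurable_fun_pair => //; exact: measurableT_comp.
Qed.

Let mflag d (W : measurableType d) (g : W -> bool) : measurable_fun setT g ->
  measurable_fun setT (fun w => (g w)%:R : R).
Proof. by move=> mg; apply: (measurableT_comp (f := fun b : bool => b%:R : R)). Qed.

Let mw1 : measurable_fun setT w1.
Proof.
apply: measurable_funM.
  apply: mflag; apply: measurable_and.
    apply: (measurableT_comp (f := fst)) => //; apply: (measurableT_comp (f := snd)) => //.
    exact: measurableT_comp.
  apply: (measurableT_comp (f := snd)) => //; apply: (measurableT_comp (f := snd)) => //.
  exact: measurableT_comp.
apply: (measurableT_comp mrho (g := fun q : (Z * X) * X => (q.1.1.1, (q.1.2, q.2)))).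
apply: measurable_fun_pair.
  by apply: (measurableT_comp (f := fst)) => //; exact: measurableT_comp.
by apply: measurable_fun_pair => //; exact: measurableT_comp.
Qed.

Let mw2 : measurable_fun setT w2.
Proof.
have m1 : measurable_fun setT (fun q : Z * X => q.1.2.1).
  by apply: (measurableT_comp (f := fst)) => //; exact: measurableT_comp.
have m2 : measurable_fun setT (fun q : Z * X => q.1.2.2).
  by apply: (measurableT_comp (f := snd)) => //; exact: measurableT_comp.
apply: measurable_funM; first exact: mflag.
apply: measurable_funB => //; apply: measurable_funM; first exact: mflag.
apply: (measurableT_comp ms1 (g := fun q : Z * X => (q.1.1, q.2))).
by apply: measurable_fun_pair => //; exact: measurableT_comp.
Qed.

Let mw3 : measurable_fun setT w3.
Proof.
have m1 : measurable_fun setT (fun q : Z * X => q.1.2.1).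
  by apply: (measurableT_comp (f := fst)) => //; exact: measurableT_comp.
have m2 : measurable_fun setT (fun q : Z * X => q.1.2.2).
  by apply: (measurableT_comp (f := snd)) => //; exact: measurableT_comp.
apply: measurable_funM; first exact: mflag.
apply: measurable_funB => //; apply: measurable_funM; first exact: mflag.
apply: (measurableT_comp ms2 (g := fun q : Z * X => (q.1.1, q.2))).
by apply: measurable_fun_pair => //; exact: measurableT_comp.
Qed.

Let w1_0 q : (0 <= w1 q)%R. Proof. by rewrite mulr_ge0. Qed.

Let w2_0 q : (0 <= w2 q)%R.
Proof.
rewrite mulr_ge0// subr_ge0; case/andP: (s1_01 (q.1.1, q.2)) => h0 h1.
by case: q.1.2.2; rewrite ?mul1r ?mul0r.
Qed.

Let w3_0 q : (0 <= w3 q)%R.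
Proof.
rewrite mulr_ge0// subr_ge0; case/andP: (s2_01 (q.1.1, q.2)) => h0 h1.
by case: q.1.2.1; rewrite ?mul1r ?mul0r.
Qed.

Lemma kop_coupled : kernel_operator coupled_op.
Proof.
have kQ : kernel_operator (fun (z : Z) f => \int[Q z.1.1]_y f y).
  apply: (kop_map (kop_integral Qfin) (g := fun z : Z => z.1.1)).
  exact: measurableT_comp.
have kQb : kernel_operator (fun (z : Z) f => \int[Qb z.1.2]_y f y).
  apply: (kop_map (kop_integral Qbfin) (g := fun z : Z => z.1.2)).
  exact: measurableT_comp.
apply: kop_add; first apply: kop_add.
- apply: (kop_comp kQ (M := fun (q : Z * X) (f : Z -> \bar R) =>
    \int[Qb q.1.1.2]_y' ((w1 (q, y'))%:E * f ((q.2, y'), (true, true))))).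
  apply: (kop_comp (kop_map kQb (@measurable_fst _ _ Z X))
    (M := fun (q : (Z * X) * X) (f : Z -> \bar R) =>
      (w1 q)%:E * f ((q.1.2, q.2), (true, true)))).
  apply: kop_scale => //; apply: (kop_dirac
    (g := fun q : (Z * X) * X => ((q.1.2, q.2), (true, true)))).
  apply: measurable_fun_pair => //; apply: measurable_fun_pair => //.
  exact: measurableT_comp.
- apply: (kop_comp kQ (M := fun (q : Z * X) (f : Z -> \bar R) =>
    (w2 q)%:E * f ((q.2, q.2), (true, false)))).
  apply: kop_scale => //; apply: (kop_dirac
    (g := fun q : Z * X => ((q.2, q.2), (true, false)))).
  by apply: measurable_fun_pair => //; exact: measurable_fun_pair.
- apply: (kop_comp kQb (M := fun (q : Z * X) (f : Z -> \bar R) =>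
    (w3 q)%:E * f ((q.2, q.2), (false, true)))).
  apply: kop_scale => //; apply: (kop_dirac
    (g := fun q : Z * X => ((q.2, q.2), (false, true)))).
  by apply: measurable_fun_pair => //; exact: measurable_fun_pair.
Qed.

(** The transported fraction s1 and the remaining fraction 1 - s1 recombine, so the first positions
    have intensity exactly [Q]. *)
Lemma coupled_op_left z (B : set X) : measurable B ->
  coupled_op z (fun z' => (z'.2.1%:R * \1_B z'.1.1)%:E) = z.2.1%:R%:E * Q z.1.1 B.
Proof.
move=> mB; rewrite /coupled_op/=.
rewrite [X in _ + X](_ : _ = 0) ?adde0; last first.
  by apply: integral0_eq => y _; rewrite mul0r mule0.
have w1E y : \int[Qb z.1.2]_y' ((w1 (z, y, y'))%:E * (1 * \1_B y)%:E) =
    ((z.2.1 && z.2.2)%:R * s1 (z.1, y) * \1_B y)%:E.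
  transitivity (\int[Qb z.1.2]_y'
      (((z.2.1 && z.2.2)%:R * \1_B y)%:E * (rho (z.1, (y, y')))%:E)).
    by apply: eq_integral => y' _; rewrite /w1/= -!EFinM; congr (_%:E); ring.
  have mr : measurable_fun setT (fun y' => (rho (z.1, (y, y')))%:E).
    apply/measurable_EFinP; apply: (measurableT_comp mrho (g := fun y' => (z.1, (y, y')))).
    by apply: measurable_fun_pair => //; exact: measurable_fun_pair.
  rewrite ge0_integralZl//; last by move=> x _; rewrite lee_fin.
  by rewrite s1E -EFinM; congr (_%:E); ring.
under eq_integral do rewrite w1E.
have [mf1 f10] : nnmeas (fun y => ((z.2.1 && z.2.2)%:R * s1 (z.1, y) * \1_B y)%:E).
  apply: nnmeas_EFin => [|y]; last by rewrite !mulr_ge0//; case/andP: (s1_01 (z.1, y)).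
  apply: measurable_funM => //; apply: measurable_funM => //.
  by apply: (measurableT_comp ms1); exact: pair1_measurable.
have [mf2 f20] : nnmeas (fun y => (w2 (z, y))%:E * (1 * \1_B y)%:E).
  apply: nnmeasM; apply: nnmeas_EFin => //.
  - by apply: (measurableT_comp mw2); exact: pair1_measurable.
  - by apply: measurable_funM => //; exact: measurable_indic.
rewrite -ge0_integralD//.
transitivity (\int[Q z.1.1]_y (z.2.1%:R%:E * (\1_B y)%:E)); last first.
  rewrite ge0_integralZl//; last by apply/measurable_EFinP; exact: measurable_indic.
  by rewrite integral_indic// setIT.
apply: eq_integral => y _; rewrite -!EFinM -EFinD /w2/=; congr (_%:E).
by case: z.2.1; case: z.2.2 => /=; ring.
Qed.

(** As for the first positions, once the two integrals of the common part are exchanged. *)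
Lemma coupled_op_right z (B : set X) : measurable B ->
  coupled_op z (fun z' => (z'.2.2%:R * \1_B z'.1.2)%:E) = z.2.2%:R%:E * Qb z.1.2 B.
Proof.
move=> mB; rewrite /coupled_op/=.
rewrite [X in _ + X + _](_ : _ = 0) ?adde0; last first.
  by apply: integral0_eq => y _; rewrite mul0r mule0.
have mw1z : measurable_fun setT (fun q : X * X => w1 ((z, q.1), q.2)).
  apply: (measurableT_comp mw1 (g := fun q : X * X => ((z, q.1), q.2))).
  by apply: measurable_fun_pair => //; exact: measurable_fun_pair.
have nnw : nnmeas (fun q : X * X => (w1 ((z, q.1), q.2))%:E * (1 * \1_B q.2)%:E).
  apply: nnmeasM; first by apply: nnmeas_EFin.
  apply: nnmeas_EFin => [|q]; last by rewrite mulr_ge0.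
  apply: measurable_funM => //.
  by apply: (measurableT_comp (f := \1_B : X -> R) (g := snd)).
rewrite (finite_fubini_tonelli (Qfin _) (Qbfin _) nnw)/=.
have w1E y' : \int[Q z.1.1]_y ((w1 (z, y, y'))%:E * (1 * \1_B y')%:E) =
    ((z.2.1 && z.2.2)%:R * s2 (z.1, y') * \1_B y')%:E.
  transitivity (\int[Q z.1.1]_y
      (((z.2.1 && z.2.2)%:R * \1_B y')%:E * (rho (z.1, (y, y')))%:E)).
    by apply: eq_integral => y _; rewrite /w1/= -!EFinM; congr (_%:E); ring.
  have mr : measurable_fun setT (fun y => (rho (z.1, (y, y')))%:E).
    apply/measurable_EFinP; apply: (measurableT_comp mrho (g := fun y => (z.1, (y, y')))).
    by apply: measurable_fun_pair => //; exact: measurable_fun_pair.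
  rewrite ge0_integralZl//; last by move=> x _; rewrite lee_fin.
  by rewrite s2E -EFinM; congr (_%:E); ring.
under eq_integral do rewrite w1E.
have [mf1 f10] : nnmeas (fun y => ((z.2.1 && z.2.2)%:R * s2 (z.1, y) * \1_B y)%:E).
  apply: nnmeas_EFin => [|y]; last by rewrite !mulr_ge0//; case/andP: (s2_01 (z.1, y)).
  apply: measurable_funM => //; apply: measurable_funM => //.
  by apply: (measurableT_comp ms2); exact: pair1_measurable.
have [mf2 f20] : nnmeas (fun y => (w3 (z, y))%:E * (1 * \1_B y)%:E).
  apply: nnmeasM; apply: nnmeas_EFin => //.
  - by apply: (measurableT_comp mw3); exact: pair1_measurable.
  - by apply: measurable_funM => //; exact: measurable_indic.
rewrite -ge0_integralD//.
transitivity (\int[Qb z.1.2]_y (z.2.2%:R%:E * (\1_B y)%:E)); last first.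
  rewrite ge0_integralZl//; last by apply/measurable_EFinP; exact: measurable_indic.
  by rewrite integral_indic// setIT.
apply: eq_integral => y _; rewrite -!EFinM -EFinD /w3/=; congr (_%:E).
by case: z.2.1; case: z.2.2 => /=; ring.
Qed.

Lemma measurable_flags (h : bool -> bool -> R) :
  measurable_fun setT (fun z : Z => h z.2.1 z.2.2).
Proof.
have m1 : measurable_fun setT (fun z : Z => z.2.1) by exact: measurableT_comp.
have m2 : measurable_fun setT (fun z : Z => z.2.2) by exact: measurableT_comp.
rewrite (_ : (fun z : Z => _) = (fun z => if z.2.1
    then (if z.2.2 then h true true else h true false)
    else (if z.2.2 then h false true else h false false))); last first.
  by apply/funext => -[? [[] []]].
by apply: measurable_fun_ifT => //; apply: measurable_fun_ifT.
Qed.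

Lemma coupled_op_number z :
  coupled_op z (fun z' => (z'.2.1%:R + z'.2.2%:R)%:E) =
  z.2.1%:R%:E * Q z.1.1 setT + z.2.2%:R%:E * Qb z.1.2 setT.
Proof.
rewrite -coupled_op_left// -coupled_op_right//.
rewrite -(ifunD (kop_functional kop_coupled z)).
- by congr (coupled_op z); apply/funext => z'; rewrite !indicT !mulr1 EFinD.
- apply: nnmeas_EFin => [|z']; last by rewrite mulr_ge0.
  by under eq_fun do rewrite indicT mulr1; exact: (measurable_flags (fun a _ => a%:R)).
- apply: nnmeas_EFin => [|z']; last by rewrite mulr_ge0.
  by under eq_fun do rewrite indicT mulr1; exact: (measurable_flags (fun _ b => b%:R)).
Qed.

Lemma coupled_op_lty z : coupled_op z (fun=> 1) < +oo.
Proof.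
apply: (@le_lt_trans _ _ (coupled_op z (fun z' => (z'.2.1%:R + z'.2.2%:R)%:E))).
  (* [coupled_op] evaluates its argument only at particles present in some process, where this
     indicator computes to 1. *)
  apply: (@le_trans _ _ (coupled_op z (EFin \o (fun z' : Z => (z'.2.1 || z'.2.2)%:R)))) => //.
  apply: (ifun_le (kop_functional kop_coupled z)).
  - exact: (measurable_flags (fun a b => (a || b)%:R)).
  - exact: (measurable_flags (fun a b => a%:R + b%:R)%R).
  - by move=> [? [a b]] /=; case: a; case: b => /=; apply/andP; split; lra.
rewrite coupled_op_number.
have lt1 (b : bool) (x : \bar R) : 0 <= x -> x < +oo -> b%:R%:E * x < +oo.
  by case: b => ? ?; rewrite ?mul1e ?mul0e.
by rewrite lte_add_pinfty// lt1.
Qed.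

Definition particle_cost (d : X -> X -> R) (z : Z) : R :=
  if z.2.1 then (if z.2.2 then d z.1.1 z.1.2 else 1%R) else z.2.2%:R.

Lemma coupled_op_pair_cost d p :
  coupled_op (p, (true, true)) (EFin \o particle_cost d) =
  \int[Q p.1]_y \int[Qb p.2]_z (rho (p, (y, z)) * d y z)%:E +
  \int[Q p.1]_y (1 - fine (\int[Qb p.2]_z (rho (p, (y, z)))%:E))%:E +
  \int[Qb p.2]_z (1 - fine (\int[Q p.1]_y (rho (p, (y, z)))%:E))%:E.
Proof.
rewrite /coupled_op/=; congr (_ + _ + _); apply: eq_integral => y _.
- by apply: eq_integral => z _; rewrite /w1 /particle_cost/= mul1r.
- by rewrite /w2 /particle_cost/= !mul1r mule1.
- by rewrite /w3 /particle_cost/= !mul1r mule1.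
Qed.

End coupled_operator.

(** * Each projection of the coupled process is a recursive Poisson process *)

Section projection.
Context {R : realType} {dZ} {Z : measurableType dZ} {dX} {X : measurableType dX}.
Variables (pos : Z -> X) (flag : Z -> bool).
Hypothesis mpos : measurable_fun setT pos.
Hypothesis mflag : measurable_fun setT flag.

Definition project (s : seq Z) : seq X := [seq pos z | z <- s & flag z].

Definition flag_indic (B : set X) (z : Z) : R := ((flag z)%:R * \1_B (pos z))%R.

Lemma measurable_flag_mul (f : X -> R) : measurable_fun setT f ->
  measurable_fun setT (fun z => (flag z)%:R * f (pos z))%R.
Proof.
move=> mf; apply: measurable_funM; last exact: (measurableT_comp mf).
by apply: (measurableT_comp (f := fun b : bool => b%:R : R)).
Qed.

Lemma nnmeas_flag_indic B : measurable B -> nnmeas (EFin \o flag_indic B).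
Proof.
move=> mB; apply: nnmeas_EFin => [|z]; last by rewrite mulr_ge0.
by apply: measurable_flag_mul; exact: measurable_indic.
Qed.

Lemma sum_project (f : X -> R) (s : seq Z) :
  (\sum_(x <- project s) f x = \sum_(z <- s) (flag z)%:R * f (pos z))%R.
Proof.
rewrite big_map big_filter big_mkcond/=; apply: eq_bigr => z _.
by case: (flag z); rewrite ?mul1r ?mul0r.
Qed.

Lemma sume_project (f : X -> \bar R) (s : seq Z) :
  \sum_(x <- project s) f x = \sum_(z <- s) (flag z)%:R%:E * f (pos z).
Proof.
rewrite big_map big_filter big_mkcond/=; apply: eq_bigr => z _.
by case: (flag z); rewrite ?mul1e ?mul0e.
Qed.

Lemma seq_measure_project (s : seq Z) B :
  seq_measure (project s) B = \sum_(z <- s) (flag_indic B z)%:E.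
Proof.
rewrite seq_measureE sume_project; apply: eq_bigr => z _.
by rewrite diracE /flag_indic indicE -EFinM.
Qed.

Lemma measurable_seq_measure_project B : measurable B ->
  measurable_fun setT (fun s : config Z => seq_measure (R := R) (project s) B).
Proof.
move=> mB; under eq_fun do rewrite seq_measure_project.
exact: (nnmeas_config_sum (nnmeas_flag_indic mB)).1.
Qed.

Variables (L : Z -> (Z -> \bar R) -> \bar R) (Q : R.-ker X ~> X).
Hypothesis hL : kernel_operator L.
Hypothesis Lfin : forall z, L z (fun=> 1) < +oo.
Hypothesis LQ : forall z B, measurable B ->
  L z (EFin \o flag_indic B) = (flag z)%:R%:E * Q (pos z) B.

(** Thinning and mapping of a Poisson process: counts of projected points in the B i are counts of
    particles in the disjoint preimages, whose intensities are given by [LQ]. *)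
Lemma offspring_project_counts (s : seq Z) k (B : 'I_k -> set X) (m : 'I_k -> nat) :
  (forall i, measurable (B i)) -> (forall i j, i != j -> B i `&` B j = set0) ->
  let Bz i := [set z | flag z /\ B i (pos z)] in
  offspring L s (fun t => (has_counts Bz m t)%:R%:E) =
  (\prod_(i < k) pois (fine (intensity Q (seq_measure (project s)) (B i))) (m i))%:E.
Proof.
move=> mB tB Bz.
have indicBz i z : \1_(Bz i) z = flag_indic (B i) z.
  rewrite /flag_indic !indicE -natrM mulnb; congr (_%:R); congr nat_of_bool.
  apply/idP/andP => [/set_mem[fz Bi]|[fz /set_mem Bi]].
    by split=> //; exact: mem_set.
  exact: mem_set.
have mBz i : measurable (Bz i).
  rewrite (_ : Bz i = (flag @^-1` [set true]) `&` (pos @^-1` B i)); last first.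
    by apply/seteqP; split=> z [].
  by apply: measurableI; rewrite -[X in measurable X]setTI; [exact: mflag|exact: mpos].
have tBz i j : i != j -> Bz i `&` Bz j = set0.
  move=> /tB/seteqP[+ _] => h; apply/seteqP; split=> // z [[_ Bi] [_ Bj]].
  exact: (h (pos z)).
etransitivity.
  exact: (poisson_functional_counts (kop_config hL) (intensity_lty Lfin s) mBz tBz).
congr (_%:E); apply: eq_bigr => i _; congr (pois (fine _) _).
rewrite /intensity ge0_integral_seq_measure; last first.
  by split=> //; exact: measurable_kernel.
rewrite sume_project; apply: eq_bigr => z _.
rewrite -LQ//; congr (L z); apply/funext => z'.
by rewrite /= indicBz.
Qed.

(** The counting measures up to generation l are functions of the configurations, so the past of the
    projection lies in [F l]. Given [F l], the law of the projected next generation depends on the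
    projection alone, hence it is also the law given the smaller past. *)
Lemma recursive_PPP_project dO (Omega : measurableType dO) (P : probability Omega R)
    (s : nat -> Omega -> config Z) (F : nat -> set (set Omega)) (z0 : Z) (n : nat) :
  flag z0 ->
  (forall w, s 0%N w = [:: z0]) ->
  (forall l, (l <= n)%N -> measurable_fun setT (s l)) ->
  (forall l, (l < n)%N -> sigma_algebra setT (F l) /\ F l `<=` measurable) ->
  (forall l j S, (l < n)%N -> (j <= l)%N -> measurable S -> F l (s j @^-1` S)) ->
  (forall l E f, (l < n)%N -> F l E -> nnmeas f ->
    \int[P]_(w in E) f (s l.+1 w) = \int[P]_(w in E) offspring L (s l w) f) ->
  recursive_PPP P Q (pos z0) n (fun l w => seq_measure (project (s l w))).
Proof.
move=> fz0 s0 ms sF sFs hF; split.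
- move=> w A; rewrite s0 seq_measure_project big_seq1 /flag_indic fz0 mul1r.
  by rewrite diracE indicE.
- by move=> l w ln; exists (project (s l w)) => A _; rewrite seq_measureE.
- move=> l B ln mB; exact: (measurableT_comp (measurable_seq_measure_project mB) (ms l ln)).
- case=> // l /= ln k B m E mB tB hE.
  have FE : F l E.
    apply: (smallest_sub (sF l ln).1 _ hE) => _ [j [B' [Y [jl mB' mY ->]]]].
    rewrite (_ : _ @^-1` _ = s j @^-1`
      ((fun t : config Z => seq_measure (R := R) (project t) B') @^-1` Y))//.
    apply: sFs => //; rewrite -[X in measurable X]setTI.
    exact: measurable_seq_measure_project.
  have mE := (sF l ln).2 E FE.
  pose Bz i := [set z | flag z /\ B i (pos z)].
  have countE i (t : seq Z) : seq_measure (R := R) (project t) (B i) =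
      (count (fun z => z \in Bz i) t)%:R%:E.
    rewrite seq_measure_project sumEFin; congr (_%:E).
    rewrite -sum1_count natr_sum [RHS]big_mkcond/=; apply: eq_bigr => z _.
    rewrite /flag_indic indicE -natrM mulnb.
    suff -> : flag z && (pos z \in B i) = (z \in Bz i) by case: ifP.
    apply/andP/idP => [[fz /set_mem Bi]|/set_mem[fz Bi]]; first exact: mem_set.
    by split=> //; exact: mem_set.
  have mBz i : measurable (Bz i).
    rewrite (_ : Bz i = (flag @^-1` [set true]) `&` (pos @^-1` B i)); last first.
      by apply/seteqP; split=> z [].
    by apply: measurableI; rewrite -[X in measurable X]setTI; [exact: mflag|exact: mpos].
  have nnc := nnmeas_has_counts (R := R) mBz m.
  pose C : set Omega := [set w | has_counts Bz m (s l.+1 w)].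
  have mC : measurable C.
    have [mc _] := nnmeas_comp (ms l.+1 ln) nnc.
    have := mc measurableT [set 1] (emeasurable_set1 _); rewrite setTI.
    congr measurable; apply/seteqP; split=> w; rewrite /C/=.
      by case: has_counts => // -[] /eqP; rewrite eq_sym oner_eq0.
    by move=> ->.
  rewrite (_ : \bigcap_(i in _) _ = C); last first.
    apply/seteqP; split=> w /=.
      move=> h; apply/forallP => i; have := h i Logic.I; rewrite /= countE => -[].
      by move/eqP; rewrite eqr_nat.
    by move=> /forallP h i _ /=; rewrite countE (eqP (h i)).
  transitivity (\int[P]_(w in E) ((has_counts Bz m (s l.+1 w))%:R)%:E).
    rewrite setIC -integral_indic//; apply: eq_integral => w _.
    rewrite indicE; congr (_%:R%:E); congr nat_of_bool.
    by apply/idP/idP => [/set_mem//|h]; exact: mem_set.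
  rewrite (hF l E (fun t => ((has_counts Bz m t)%:R)%:E) ln FE nnc).
  by apply: eq_integral => w _; rewrite offspring_project_counts.
Qed.

End projection.

Local Close Scope ereal_scope.

(** * Lyapunov estimate *)

Section BLnorm_theory.
Context {R : realType} {dX} {X : measurableType dX} (d : X -> X -> R).
Hypothesis dmet : is_metric d.
Hypothesis dborel : borel_for d.

(** Tested with the constant function -1. *)
Lemma BLnorm_mass (mu nu : {measure set X -> \bar R}) a :
  (mu setT < +oo)%E -> (nu setT < +oo)%E -> (BLnorm d mu nu <= a%:E)%E ->
  fine (nu setT) <= fine (mu setT) + a.
Proof.
move=> mufin nufin hBL.
have hf : lip1_bdd1 d (fun=> -1).
  by split=> [x y|x]; rewrite ?subrr ?normr0 ?(dist_ge0 dmet)// normrN normr1.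
have : (\int[mu]_y (-1)%:E - \int[nu]_y (-1)%:E <= a%:E)%E.
  by apply: le_trans hBL; apply: ereal_sup_ubound; exists (fun=> -1).
rewrite !integral_cst//.
have -> : mu setT = (fine (mu setT))%:E by rewrite fineK// ge0_fin_numE.
have -> : nu setT = (fine (nu setT))%:E by rewrite fineK// ge0_fin_numE.
by rewrite -!EFinM -EFinB lee_fin/=; lra.
Qed.

Lemma BLnorm_triangle (mu nu pi : {measure set X -> \bar R}) a b :
  (mu setT < +oo)%E -> (nu setT < +oo)%E -> (pi setT < +oo)%E ->
  (BLnorm d mu nu <= a%:E)%E -> (BLnorm d nu pi <= b%:E)%E ->
  (BLnorm d mu pi <= (a + b)%:E)%E.
Proof.
move=> mufin nufin pifin ha hb; apply: ge_ereal_sup => _ [f /= hf <-].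
have mf := lip1_bdd1_measurable dborel hf.
have intf (m : {measure set X -> \bar R}) : (m setT < +oo)%E ->
    (\int[m]_x (f x)%:E)%E = (fine (\int[m]_x (f x)%:E))%:E.
  move=> mfin; rewrite fineK//; apply: integrable_fin_num => //.
  by apply: integrable_bounded1 => //; case: hf.
have h1 : (\int[mu]_y (f y)%:E - \int[nu]_y (f y)%:E <= a%:E)%E.
  by apply: le_trans ha; apply: ereal_sup_ubound; exists f.
have h2 : (\int[nu]_y (f y)%:E - \int[pi]_y (f y)%:E <= b%:E)%E.
  by apply: le_trans hb; apply: ereal_sup_ubound; exists f.
move: h1 h2; rewrite (intf mu)// (intf nu)// (intf pi)//.
by rewrite -!EFinB !lee_fin; lra.
Qed.

End BLnorm_theory.

Section drift.
Context {R : realType} {dX} {X : measurableType dX} (d : X -> X -> R).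
Variables (Q Qb : R.-ker X ~> X) (A : set X) (K eps : R).
Variable rho : (X * X) * (X * X) -> R.
Hypothesis dmet : is_metric d.
Hypothesis dborel : borel_for d.
Hypothesis dsep : dist_separable d.
Hypothesis d1 : forall y z, d y z <= 1.
Hypothesis K1 : 1 <= K.
Hypothesis mA : measurable A.
Hypothesis eps0 : 0 < eps.
Hypothesis eps1 : eps <= 1.
Hypothesis QK : forall y, (Q y setT <= K%:E)%E.
Hypothesis Qbfin : forall y, (Qb y setT < +oo)%E.
Hypothesis QbA : forall y, A y -> (Qb y (~` A) <= eps%:E)%E.
Hypothesis QbK : forall y, A y -> fine (Qb y setT) <= 2 * K.
Hypothesis mrho : measurable_fun setT rho.
Hypothesis rho0 : forall pq, 0 <= rho pq.
Hypothesis rho_r : forall p y, (\int[Qb p.2]_z (rho (p, (y, z)))%:E <= 1)%E.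
Hypothesis rho_l : forall p z, (\int[Q p.1]_y (rho (p, (y, z)))%:E <= 1)%E.
Hypothesis rho_cost : forall p, A p.2 ->
  (\int[Q p.1]_y \int[Qb p.2]_z (rho (p, (y, z)) * d y z)%:E +
   \int[Q p.1]_y (1 - fine (\int[Qb p.2]_z (rho (p, (y, z)))%:E))%:E +
   \int[Qb p.2]_z (1 - fine (\int[Q p.1]_y (rho (p, (y, z)))%:E))%:E
   <= (K * d p.1 p.2 + 3 * eps)%:E)%E.

Local Notation Z := ((X * X) * (bool * bool))%type.
Local Notation L := (coupled_op Q Qb rho).

Let Qfin y : (Q y setT < +oo)%E. Proof. exact: le_lt_trans (QK y) (ltry _). Qed.

Let hL : kernel_operator L. Proof. exact: kop_coupled. Qed.

Definition escaped (z : Z) : R := z.2.2%:R * \1_(~` A) z.1.2.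

Definition lyapunov (z : Z) : R :=
  particle_cost d z + escaped z + eps * (z.2.1%:R + z.2.2%:R).

Let cost_bounds z : 0 <= particle_cost d z <= z.2.1%:R + z.2.2%:R.
Proof.
rewrite /particle_cost; case: z => -[y y'] [[] []] /=; rewrite ?(dist_ge0 dmet)/=;
  by have := d1 y y'; lra.
Qed.

Lemma measurable_particle_cost : measurable_fun setT (particle_cost d : Z -> R).
Proof.
have m1 : measurable_fun setT (fun z : Z => z.2.1) by exact: measurableT_comp.
have m2 : measurable_fun setT (fun z : Z => z.2.2) by exact: measurableT_comp.
apply: measurable_fun_ifT => //; last exact: (measurable_flags (fun _ b => b%:R)).
apply: measurable_fun_ifT => //.
exact: (measurableT_comp (measurable_dist dmet dborel dsep) measurable_fst).
Qed.

Lemma measurable_escaped : measurable_fun setT escaped.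
Proof.
apply: measurable_funM; first exact: (measurable_flags (fun _ b => b%:R)).
apply: (measurableT_comp (f := \1_(~` A) : X -> R) (g := fun z : Z => z.1.2)).
  exact: measurable_indic (measurableC mA).
exact: measurableT_comp.
Qed.

Lemma measurable_lyapunov : measurable_fun setT lyapunov.
Proof.
apply: measurable_funD; first by apply: measurable_funD;
  [exact: measurable_particle_cost|exact: measurable_escaped].
by apply: measurable_funM => //; exact: (measurable_flags (fun a b => a%:R + b%:R)).
Qed.

Let escaped_ge0 z : 0 <= escaped z. Proof. by rewrite mulr_ge0. Qed.

Lemma particle_cost_le_lyapunov z : particle_cost d z <= lyapunov z.
Proof. by rewrite /lyapunov -addrA lerDl addr_ge0// mulr_ge0 ?(ltW eps0)// addr_ge0. Qed.

Lemma escaped_le_lyapunov z : escaped z <= lyapunov z.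
Proof.
rewrite /lyapunov -addrA addrCA lerDl addr_ge0 ?mulr_ge0 ?(ltW eps0) ?addr_ge0//.
by case/andP: (cost_bounds z).
Qed.

Lemma lyapunov_ge0 z : 0 <= lyapunov z.
Proof. exact: le_trans (escaped_ge0 z) (escaped_le_lyapunov z). Qed.

(** For a pair, the offspring has cost at most K d + 3 eps, escapes at most eps, and weighted number
    at most 3 K eps; the eps terms add up to at most 7 K eps, whence the 7. A lone particle has V >=
    1, and the crude bound of the cost by the number of offspring gives at most 5 K. *)
Lemma coupled_op_lyapunov z : escaped z = 0 ->
  (L z (EFin \o lyapunov) <= (7 * K * lyapunov z)%:E)%E.
Proof.
move=> ez; have hLz := kop_functional hL z.
have mcost := measurable_particle_cost; have mesc := measurable_escaped.
have mnum := measurable_flags (X := X) (fun a b => a%:R + b%:R : R).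
have nncost : nnmeas (EFin \o particle_cost d : Z -> \bar R).
  by apply: nnmeas_EFin => // z'; case/andP: (cost_bounds z').
have nnesc : nnmeas (EFin \o escaped) by exact: nnmeas_EFin.
have nnnum : nnmeas (fun z' : Z => (z'.2.1%:R + z'.2.2%:R : R)%:E).
  by apply: nnmeas_EFin => // z'; rewrite addr_ge0.
have -> : L z (EFin \o lyapunov) = (L z (EFin \o particle_cost d) + L z (EFin \o escaped) +
    eps%:E * L z (fun z' => (z'.2.1%:R + z'.2.2%:R)%:E))%E.
  rewrite -(ifunZ hLz) ?(ltW eps0)// -!(ifunD hLz)//.
  - exact: nnmeasD.
  - by apply: nnmeasZ => //; exact: ltW.
have QE y : Q y setT = (fine (Q y setT))%:E by rewrite fineK// ge0_fin_numE.
have QbE y : Qb y setT = (fine (Qb y setT))%:E by rewrite fineK// ge0_fin_numE.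
have QK' y : fine (Q y setT) <= K by rewrite -lee_fin -QE.
have inA : z.2.2 -> A z.1.2.
  move=> z22; apply: contrapT => nA; move: ez; rewrite /escaped z22 mul1r.
  by rewrite indicE mem_set// => /eqP; rewrite oner_eq0.
have num_le : (L z (fun z' => (z'.2.1%:R + z'.2.2%:R)%:E) <=
    (K * (z.2.1%:R + 2 * z.2.2%:R))%:E)%E.
  rewrite coupled_op_number// QE QbE -!EFinM -EFinD lee_fin.
  have := QK' z.1.1.
  case: z.2.1; case: z.2.2 inA => inA /=; rewrite ?mul0r ?mul1r ?addr0 ?add0r//;
    try (have := QbK (inA isT)); lra.
have esc_le : (L z (EFin \o escaped) <= (eps * z.2.2%:R)%:E)%E.
  rewrite coupled_op_right//; last exact: measurableC.
  case: z.2.2 inA => inA; rewrite /= ?mul1e ?mul0e ?mulr1 ?mulr0//.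
  exact: QbA (inA isT).
have cost_le : (L z (EFin \o particle_cost d) <=
    L z (fun z' => (z'.2.1%:R + z'.2.2%:R)%:E))%E.
  exact: (ifun_le hLz mcost mnum cost_bounds).
have e3 : (eps%:E * L z (fun z' => (z'.2.1%:R + z'.2.2%:R)%:E) <=
    (eps * (K * (z.2.1%:R + 2 * z.2.2%:R)))%:E)%E.
  by rewrite EFinM lee_pmul2l// ?lte_fin.
have [zp|zp] := boolP (z.2.1 && z.2.2).
  have zE : z = (z.1, (true, true)).
    by case: z zp {inA num_le esc_le cost_le e3 ez hLz} => p [[] []].
  have zcost : (L z (EFin \o particle_cost d) <= (K * d z.1.1 z.1.2 + 3 * eps)%:E)%E.
    rewrite zE coupled_op_pair_cost; apply: rho_cost.
    by apply: inA; case/andP: zp.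
  apply: le_trans (leeD (leeD zcost esc_le) e3) _.
  rewrite -!EFinD lee_fin /lyapunov ez addr0 zE /particle_cost/=.
  have d0 : 0 <= d z.1.1 z.1.2 by exact: dist_ge0.
  have := mulr_ge0 (ltW eps0) (le_trans ler01 K1).
  have : eps <= eps * K by rewrite ler_peMr// ltW.
  have := mulr_ge0 (le_trans ler01 K1) d0.
  rewrite mulrDr; lra.
apply: le_trans (leeD (leeD (le_trans cost_le num_le) esc_le) e3) _.
rewrite -!EFinD lee_fin /lyapunov ez addr0.
have K0 := le_trans ler01 K1.
have eK : eps * K <= K by rewrite ler_piMl.
have eK0 : 0 <= eps * K * K by rewrite !mulr_ge0 ?(ltW eps0).
have eK1 : 0 <= eps * K by rewrite mulr_ge0 ?(ltW eps0).
have epsK : eps <= K by exact: le_trans eps1 K1.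
rewrite /particle_cost.
by case: z.2.1 zp; case: z.2.2 => //= _; rewrite ?(mulr0,addr0,add0r,mulr1); lra.
Qed.

End drift.

Section moments.
Context {R : realType} {dZ} {Z : measurableType dZ}.
Variable L : Z -> (Z -> \bar R) -> \bar R.
Hypothesis hL : kernel_operator L.
Hypothesis Lfin : forall z, (L z (fun=> 1) < +oo)%E.
Variables (V esc : Z -> R) (rate : R).
Hypothesis mV : measurable_fun setT V.
Hypothesis V0 : forall z, 0 <= V z.
Hypothesis mesc : measurable_fun setT esc.
Hypothesis esc0 : forall z, 0 <= esc z.
Hypothesis rate0 : 0 <= rate.
Hypothesis drift : forall z, esc z = 0 -> (L z (EFin \o V) <= (rate * V z)%:E)%E.

Context {dO} {Omega : measurableType dO}.
Variables (P : probability Omega R) (s : nat -> Omega -> config Z).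
Variables (F : nat -> set (set Omega)) (z0 : Z) (n : nat).
Hypothesis s0 : forall w, s 0%N w = [:: z0].
Hypothesis ms : forall l, (l <= n)%N -> measurable_fun setT (s l).
Hypothesis sF : forall l, (l < n)%N -> sigma_algebra setT (F l) /\ F l `<=` measurable.
Hypothesis sFs : forall l j S, (l < n)%N -> (j <= l)%N -> measurable S -> F l (s j @^-1` S).
Hypothesis hF : forall l E f, (l < n)%N -> F l E -> nnmeas f ->
  (\int[P]_(w in E) f (s l.+1 w) = \int[P]_(w in E) offspring L (s l w) f)%E.

(** Only the generations strictly before l are constrained. The event thus belongs to the past of
    generation l, and a first escape in generation l is still seen by the sum of V over that
    generation. *)
Definition unescaped l : set Omega :=
  [set w | forall j, (j < l)%N -> \sum_(z <- s j w) esc z = 0].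

Let mesc0 : measurable [set t : config Z | \sum_(z <- t) esc z = 0].
Proof.
rewrite -[X in measurable X]setTI.
by apply: (measurable_config_sum mesc _ (Y := [set 0])).
Qed.

Lemma unescaped_filtration l : (l < n)%N -> F l (unescaped l.+1).
Proof.
move=> ln; have [[F0 FC FU] _] := sF ln.
rewrite (_ : unescaped _ = setT `\` \bigcup_j (if (j <= l)%N
    then setT `\` (s j @^-1` [set t : config Z | \sum_(z <- t) esc z = 0]) else set0)).
  by apply: (FC); apply: FU => j; case: ifP => // jl; apply: (FC); exact: sFs.
apply/seteqP; split=> w.
  by move=> h; split=> // -[j _]; case: ifP => // jl -[_]; apply; exact: h.
move=> [_ h] j jl; apply: contrapT => nj; apply: h; exists j => //.
by rewrite -ltnS jl.
Qed.

Lemma measurable_unescaped l : (l <= n)%N -> measurable (unescaped l).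
Proof.
case: l => [_|l ln]; last by apply: (sF ln).2; exact: unescaped_filtration.
by rewrite (_ : unescaped 0 = setT)//; apply/seteqP; split.
Qed.

(** On [unescaped l.+1] every particle of generation l satisfies esc z = 0, so the drift bound
    applies to each and Campbell's formula to their sum. The induction hypothesis is then used on
    the larger event [unescaped l]. *)
Lemma moment_bound l : (l <= n)%N ->
  (\int[P]_(w in unescaped l) (\sum_(z <- s l w) (V z)%:E) <=
   (rate ^+ l * V z0)%:E)%E.
Proof.
have nnV : nnmeas (EFin \o V) by exact: nnmeas_EFin.
have nnS l' : (l' <= n)%N -> nnmeas (fun w => (\sum_(z <- s l' w) (V z)%:E)%E).
  by move=> l'n; exact: (nnmeas_comp (ms l'n) (nnmeas_config_sum nnV)).
elim: l => [_|l ih ln].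
  rewrite (_ : unescaped 0 = setT); last by apply/seteqP; split.
  under eq_integral do rewrite s0 big_seq1.
  rewrite integral_cst// [X in (_ * X)%E](_ : _ = 1%E); last exact: probability_setT.
  by rewrite mule1 expr0 mul1r.
have FE := unescaped_filtration ln; have mE := measurable_unescaped ln.
rewrite (hF (f := fun t => (\sum_(z <- t) (V z)%:E)%E) ln FE); last exact: nnmeas_config_sum.
have ln' := ltnW ln.
have [mS S0] := nnS _ ln'.
apply: (@le_trans _ _ (\int[P]_(w in unescaped l.+1)
    (rate%:E * \sum_(z <- s l w) (V z)%:E))%E).
  apply: ge0_le_integral => //.
  - move=> w _; apply: (ifun_ge0 (kop_functional (kop_offspring hL) (s l w))) => t.
    by apply: sume_ge0 => z _; rewrite lee_fin.
  - apply: measurable_funTS.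
    exact: (nnmeas_comp (ms ln') (kop_nnmeas (kop_offspring hL) (nnmeas_config_sum nnV))).1.
  - by apply: measurable_funTS; exact: measurable_funeM.
  - move=> w /(_ l (ltnSn l)) /eqP; rewrite psumr_eq0// => /allP escs.
    have Lsum : (\sum_(z <- s l w) L z (EFin \o V) <= rate%:E * \sum_(z <- s l w) (V z)%:E)%E.
      rewrite ge0_sume_distrr; last by move=> z _; rewrite lee_fin.
      rewrite big_seq [leRHS]big_seq; apply: lee_sum => z zs.
      by rewrite -EFinM; apply: drift; exact/eqP/(escs z zs).
    rewrite [leLHS](poisson_functional_mean (kop_config hL) (intensity_lty Lfin (s l w)) mV V0)//.
    by apply: le_lt_trans Lsum _; rewrite sumEFin -EFinM ltry.
rewrite ge0_integralZl//; [|exact: measurable_funTS].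
rewrite exprS -mulrA EFinM lee_wpmul2l ?lee_fin//.
apply: le_trans (ih ln'); apply: ge0_subset_integral => //.
- exact: measurable_unescaped.
- exact: measurable_funTS.
- by move=> w h j jl; apply: h; exact: ltnW.
Qed.

End moments.

(** * Measurability and upper bound of the distance of the total configurations *)

Section total_distance.
Context {R : realType} {dX} {X : measurableType dX} (d : X -> X -> R).
Hypothesis dmet : is_metric d.
Hypothesis dborel : borel_for d.
Variable u : nat -> X.
Hypothesis udense : forall x e, 0 < e -> exists k, d x (u k) < e.

Local Notation Z := ((X * X) * (bool * bool))%type.
Definition left_points : seq Z -> seq X := project (fun z : Z => z.1.1) (fun z : Z => z.2.1).
Definition right_points : seq Z -> seq X := project (fun z : Z => z.1.2) (fun z : Z => z.2.2).

Context {dO} {Omega : measurableType dO} (s : nat -> Omega -> config Z) (n : nat).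
Hypothesis ms : forall l, (l <= n)%N -> measurable_fun setT (s l).

Let mu l w : {measure set X -> \bar R} := seq_measure (left_points (s l w)).
Let mub l w : {measure set X -> \bar R} := seq_measure (right_points (s l w)).

Let totalE (S : nat -> Omega -> seq X) w :
  rppp_total (fun l w => seq_measure (S l w)) n w =
  seq_measure (flatten [seq S l w | l <- iota 0 n.+1]) :> (set X -> \bar R).
Proof.
apply/funext => B; rewrite /rppp_total seq_measureE big_flatten big_map.
rewrite -[X in iota _ X]subn0 -/(index_iota 0 n.+1) big_mkord.
by apply: eq_bigr => l _; rewrite seq_measureE.
Qed.

Let sum_flatten (S : nat -> Omega -> seq X) (f : X -> R) w :
  \sum_(x <- flatten [seq S l w | l <- iota 0 n.+1]) f x =
  \sum_(l < n.+1) \sum_(x <- S l w) f x.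
Proof.
rewrite big_flatten big_map -[X in iota _ X]subn0 -/(index_iota 0 n.+1).
by rewrite big_mkord.
Qed.

Let phi q (z : Z) : R := z.2.1%:R * rat_lip d u q z.1.1 - z.2.2%:R * rat_lip d u q z.1.2.

Let total_BLnormE w : BLnorm d (rppp_total mu n w) (rppp_total mub n w) =
  ereal_sup [set (\sum_(l < n.+1) \sum_(z <- s l w) phi q z)%:E | q in setT].
Proof.
rewrite (totalE (fun l w => left_points (s l w))) (totalE (fun l w => right_points (s l w))).
rewrite (BLnorm_seq_measure dmet dborel udense); congr ereal_sup.
apply: eq_imagel => q _; congr (_%:E).
rewrite (sum_flatten (fun l w => left_points (s l w))).
rewrite (sum_flatten (fun l w => right_points (s l w))) -sumrB.
by apply: eq_bigr => l _; rewrite !sum_project -sumrB.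
Qed.

Lemma total_BLnorm_ge0 w : (0 <= BLnorm d (rppp_total mu n w) (rppp_total mub n w))%E.
Proof.
rewrite (totalE (fun l w => left_points (s l w))) (totalE (fun l w => right_points (s l w))).
apply: ereal_sup_ubound; exists (fun=> 0).
  by split=> [y z|y]; rewrite ?subrr normr0 ?(dist_ge0 dmet).
by rewrite !integral0_eq// sube0.
Qed.

(** The supremum over rational test functions is reindexed by their codes in nat, as a supremum of a
    sequence of measurable functions. *)
Lemma measurable_total_BLnorm :
  measurable_fun setT (fun w => BLnorm d (rppp_total mu n w) (rppp_total mub n w)).
Proof.
pose code k : seq rat := odflt [::] (choice.unpickle k).
pose f k w : \bar R := (\sum_(l < n.+1) \sum_(z <- s l w) phi (code k) z)%:E.
rewrite (_ : (fun w => _) = (fun w => esups (f^~ w) 0%N)).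
  apply: measurable_fun_esups => k; apply/measurable_EFinP; apply: measurable_sum => l.
  have mlip q := lip1_bdd1_measurable dborel (rat_lip_lip1_bdd1 dmet u q).
  have mphi q : measurable_fun setT (phi q).
    apply: measurable_funB.
      apply: (measurable_flag_mul (pos := fun z : Z => z.1.1) (flag := fun z : Z => z.2.1)) => //;
      exact: measurableT_comp.
    apply: (measurable_flag_mul (pos := fun z : Z => z.1.2) (flag := fun z : Z => z.2.2)) => //;
    exact: measurableT_comp.
  have ln : (l <= n)%N by rewrite -ltnS.
  exact: (measurableT_comp (measurable_config_sum (mphi _)) (ms ln)).
apply/funext => w; rewrite total_BLnormE /esups/=; congr ereal_sup.
apply/seteqP; split=> [_ [q _ <-]|_ [k _ <-]]; last by exists (code k).
by exists (choice.pickle q) => //; rewrite /f /code choice.pickleK.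
Qed.

(** Against a test function, a common particle contributes at most d by the Lipschitz bound and a
    lone one at most 1 by the sup bound. *)
Lemma total_BLnorm_le w : (BLnorm d (rppp_total mu n w) (rppp_total mub n w) <=
  (\sum_(l < n.+1) \sum_(z <- s l w) particle_cost d z)%:E)%E.
Proof.
rewrite total_BLnormE; apply: ge_ereal_sup => _ [q _ <-]; rewrite lee_fin.
apply: ler_sum => l _; apply: ler_sum => z _.
have [lf f1] := rat_lip_lip1_bdd1 dmet u q.
have := lf z.1.1 z.1.2; have := f1 z.1.1; have := f1 z.1.2.
rewrite !ler_norml /phi /particle_cost => /andP[? ?] /andP[? ?] /andP[? ?].
by case: z.2.1; case: z.2.2; rewrite /= ?mul0r ?mul1r; lra.
Qed.

End total_distance.

Theorem theorem5p7 (R : realType) (K : R) (n : nat) :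
  1 <= K -> (0 < n)%N ->
  exists C : R,
  forall (dX : measure_display) (X : measurableType dX) (d : X -> X -> R)
         (Q Qbar : R.-ker X ~> X) (A : set X) (eps : R) (x xbar : X),
    polish_metric d -> borel_for d -> (forall y z, d y z <= 1) ->
    (forall y, (Qbar y setT < +oo)%E) ->
    measurable A -> 0 < eps -> eps <= 1 ->
    (forall y, (Q y setT <= K%:E)%E) ->
    (forall y z, (BLnorm d (Q y) (Q z) <= (K * d y z)%:E)%E) ->
    (forall y, A y -> (Qbar y (~` A) <= eps%:E)%E) ->
    (forall y, A y -> (BLnorm d (Q y) (Qbar y) <= eps%:E)%E) ->
    A xbar ->
    exists (dO : measure_display) (Omega : measurableType dO) (P : probability Omega R)
           (mu mubar : nat -> Omega -> {measure set X -> \bar R}),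
      [/\ recursive_PPP P Q x n mu,
          recursive_PPP P Qbar xbar n mubar,
          measurable_fun setT
            (fun w => mine 1%E (BLnorm d (rppp_total mu n w) (rppp_total mubar n w))) &
          (\int[P]_w mine 1%E (BLnorm d (rppp_total mu n w) (rppp_total mubar n w))
             <= (C * (Num.sqrt eps + d x xbar))%:E)%E].
Proof.
(* The factor 2 comes from V(z0) = d(x, xbar) + 2 eps, the powers from the moment bounds of
   generations 0 to n. *)
move=> K1 _; exists (2 * \sum_(l < n.+1) (7 * K) ^+ l).
move=> dX X d Q Qbar A eps x xbar [dmet _ dsep] dborel d1 Qbfin mA eps0 eps1 QK QL QbA QQb Axbar.
have K0 : 0 <= K by exact: le_trans ler01 K1.
have Qfin y : (Q y setT < +oo)%E by exact: le_lt_trans (QK y) (ltry _).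
have QKr y : fine (Q y setT) <= K by rewrite -lee_fin fineK// ge0_fin_numE.
have QbK y : A y -> fine (Qbar y setT) <= 2 * K.
  move=> Ay; have := BLnorm_mass dmet (Qfin y) (Qbfin y) (QQb y Ay).
  by have := QKr y; lra.
(* For y' in A the triangle inequality through Q(y') gives the bound K d(y, y') + eps. The masses
   are at most K and 2 K, and the selection error 2 e with e = eps leads to 3 eps. *)
have [|||p Ap|p Ap|rho [mrho rho0 rho_r rho_l rho_cost]] :=
    @coupling_density_exists _ _ _ d dmet dborel dsep Q Qbar Qfin Qbfin
      (fun p => K * d p.1 p.2 + eps) [set p | A p.2] (3 * K) eps.
- apply: measurable_funD => //; apply: measurable_funM => //.
  exact: measurable_dist.
- exact: eps0.
- by rewrite mulr_ge0.
- exact: (BLnorm_triangle dborel (Qfin _) (Qfin _) (Qbfin _) (QL _ _) (QQb _ Ap)).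
- by have := QKr p.1; have := QbK _ Ap; lra.
have {}rho_cost p : A p.2 ->
  (\int[Q p.1]_y \int[Qbar p.2]_z (rho (p, (y, z)) * d y z)%:E +
   \int[Q p.1]_y (1 - fine (\int[Qbar p.2]_z (rho (p, (y, z)))%:E))%:E +
   \int[Qbar p.2]_z (1 - fine (\int[Q p.1]_y (rho (p, (y, z)))%:E))%:E
   <= (K * d p.1 p.2 + 3 * eps)%:E)%E.
  by move=> Ap; apply: le_trans (rho_cost p Ap) _; rewrite lee_fin; lra.
pose L := coupled_op Q Qbar rho.
have hL : kernel_operator L by exact: kop_coupled.
have Lfin z : (L z (fun=> 1%E) < +oo)%E by exact: coupled_op_lty.
pose z0 : (X * X) * (bool * bool) := ((x, xbar), (true, true)).
have [dO [Om [P [s [F [s0 ms sF sFs hF]]]]]] := recursive_poisson_exists hL Lfin z0 n.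
have [u udense] := dsep.
exists dO, Om, P, (fun l w => seq_measure (left_points (s l w))),
  (fun l w => seq_measure (right_points (s l w))).
have mBL := measurable_total_BLnorm dmet dborel udense ms.
have mmin : measurable_fun setT (fun w => mine 1%E
    (BLnorm d (rppp_total (fun l w => seq_measure (left_points (s l w))) n w)
      (rppp_total (fun l w => seq_measure (right_points (s l w))) n w))).
  exact: measurable_mine.
split=> //.
- apply: (recursive_PPP_project (pos := fun z => z.1.1) (flag := fun z => z.2.1)
    _ _ hL Lfin _ (z0 := z0) isT s0 ms sF sFs hF) => //.
  + exact: measurableT_comp.
  + exact: measurableT_comp.
  + by move=> z B mB; exact: coupled_op_left.
- apply: (recursive_PPP_project (pos := fun z => z.1.2) (flag := fun z => z.2.2)
    _ _ hL Lfin _ (z0 := z0) isT s0 ms sF sFs hF) => //.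
  + exact: measurableT_comp.
  + exact: measurableT_comp.
  + by move=> z B mB; exact: coupled_op_right.
pose V := lyapunov d A eps; pose esc : (X * X) * (bool * bool) -> R := escaped A.
have mV : measurable_fun setT V by exact: measurable_lyapunov.
have V0 z : 0 <= V z by exact: lyapunov_ge0.
have esc_ge0 z : 0 <= esc z by rewrite mulr_ge0.
have drift z : esc z = 0 -> (L z (EFin \o V) <= (7 * K * V z)%:E)%E.
  by move=> ez; exact: coupled_op_lyapunov.
have rate0 : 0 <= 7 * K by rewrite mulr_ge0.
have mesc : measurable_fun setT esc by exact: measurable_escaped.
have mom l (ln : (l <= n)%N) := moment_bound hL Lfin mV V0 mesc esc_ge0 rate0 drift
  s0 ms sF sFs hF ln.
have munesc l (ln : (l <= n)%N) := measurable_unescaped mesc sF sFs ln.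
pose S l w : \bar R := (\sum_(z <- s l w) (V z)%:E)%E.
have nnS (l : 'I_n.+1) : nnmeas (S l).
  have ln : (l <= n)%N by rewrite -ltnS.
  by apply: (nnmeas_comp (ms l ln) (nnmeas_config_sum _)); exact: nnmeas_EFin.
have nnES (l : 'I_n.+1) : nnmeas (fun w => ((\1_(unescaped esc s l) w)%:E * S l w)%E).
  apply: nnmeasM => //; apply: nnmeas_indic; apply: munesc.
  by rewrite -ltnS.
have BL_le w : (mine 1 (BLnorm d (rppp_total (fun l w => seq_measure (left_points (s l w))) n w)
    (rppp_total (fun l w => seq_measure (right_points (s l w))) n w)) <=
    \sum_(l < n.+1) (\1_(unescaped esc s l) w)%:E * S l w)%E.
  (* In case of an escape the least generation l with one is used: its indicator is still 1, and its
     sum of V alone reaches 1. *)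
  have [[l0 hl0]|none] := pselect (exists l, (l <= n)%N && (\sum_(z <- s l w) esc z != 0)).
    have ex : exists l, (l <= n)%N && (\sum_(z <- s l w) esc z != 0) by exists l0.
    case: (ex_minnP ex) => l /andP[ln escl] lmin.
    rewrite ge_min; apply/orP; left.
    have ln' : (l < n.+1)%N by rewrite ltnS.
    rewrite (bigD1 (Ordinal ln'))//=.
    have -> : \1_(unescaped esc s l) w = 1%R :> R.
      rewrite indicE mem_set// => j jl; apply/eqP; apply: contraT => ej.
      by have := lmin j; rewrite (leq_trans (ltnW jl) ln) ej => /(_ isT); rewrite leqNgt jl.
    rewrite mul1e; apply: (@le_trans _ _ (S l w)); last first.
      by rewrite leeDl//; apply: sume_ge0 => j _; exact: (nnES j).2.
    have [z zs ez] : exists2 z, z \in s l w & esc z != 0.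
      by move: escl; rewrite psumr_eq0// => /allPn[z zs /= ez]; exists z.
    have ez1 : esc z = 1.
      move: ez; rewrite /esc /escaped; case: z.2.2; rewrite ?mul0r ?eqxx// mul1r.
      by rewrite indicE; case: (_ \in _); rewrite ?eqxx.
    rewrite /S sumEFin lee_fin (big_rem z)//= -ez1.
    by apply: le_trans (escaped_le_lyapunov A dmet d1 eps0 z) _; rewrite lerDl sumr_ge0.
  have all0 l : (l <= n)%N -> \sum_(z <- s l w) esc z = 0.
    move=> ln; apply/eqP; apply: contraT => el; exfalso; apply: none.
    by exists l; rewrite ln el.
  rewrite ge_min; apply/orP; right.
  apply: le_trans (total_BLnorm_le dmet dborel udense s n w) _.
  rewrite -sumEFin; apply: lee_sum => l _.
  have -> : \1_(unescaped esc s l) w = 1%R :> R.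
    rewrite indicE mem_set// => j jl; apply: all0.
    by apply: leq_trans (ltnW jl) _; rewrite -ltnS.
  rewrite mul1e /S sumEFin lee_fin; apply: ler_sum => z _.
  exact: particle_cost_le_lyapunov.
apply: (@le_trans _ _ (\int[P]_w \sum_(l < n.+1)
    ((\1_(unescaped esc s l) w)%:E * S l w))%E).
  apply: ge0_le_integral => //.
  - by move=> w _; rewrite le_min lee01/=; exact: total_BLnorm_ge0.
  - exact: (nnmeas_sum _ nnES).1.
rewrite ge0_integral_sum//; last 2 first.
- by move=> l; exact: (nnES l).1.
- by move=> l w _; exact: (nnES l).2.
apply: (@le_trans _ _ (\sum_(l < n.+1) ((7 * K) ^+ l * V z0)%:E)%E).
  apply: lee_sum => l _; rewrite -integral_indicM; apply: mom.
  by rewrite -ltnS.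
rewrite sumEFin -mulr_suml lee_fin (mulrC 2) -mulrA ler_wpM2l//.
  by apply: sumr_ge0 => l _; rewrite exprn_ge0.
rewrite /V /lyapunov /particle_cost /escaped/= indicE memNset; last by move=> nA; exact: nA.
rewrite /= mulr0 addr0.
(* This is where eps <= 1 turns the linear bound into the stated one. *)
have : eps <= Num.sqrt eps.
  rewrite -{1}(sqr_sqrtr (ltW eps0)) expr2 ler_piMr ?sqrtr_ge0//.
  by rewrite -sqrtr1 ler_sqrt.
have := dist_ge0 dmet x xbar.
lra.
Qed.
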